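(* Let $(X_n)_{n\ge1}$ be deterministic $n\times p$ matrices with $\limsup_n\ell_{n,1}/\ell_{n,p}<\infty$ and $\liminf_n\min_{i\in[p-1]}\ell_{n,i}/\ell_{n,i+1}>1$. Let $(U_n)_{n\ge1}$ satisfy Condition $\mathfrak P'$, and let $(S_{m,n})_{m,n\ge1}$ satisfy Condition (Sym) of the context for some $(G_n)_{n\ge1}$. Then for any $i\in[p]$, $$\sqrt{\frac{m}{\tau_{m,n}(G_n)_{(ii),(ii)}}}\;\hat\Lambda_{m,n,i}^{-1}(\hat\Lambda_{m,n,i}-\Lambda_{n,i})\Rightarrow\mathcal N(0,1).$$ Moreover, with $\Delta_{n,i}=\Delta_i(X_n^\top X_n,G_n)$ and $\hat\Delta_{m,n,i}=\Delta_i(X_n^\top S_{m,n}^\top S_{m,n}X_n,G_n)$, for any unit vector $c\in\mathbb R^p$ with $\liminf_{n\to\infty}c^\top\Delta_{n,i}c>0$, $$\sqrt m\,\tau_{m,n}^{-1/2}(c^\top\hat\Delta_{m,n,i}c)^{-1/2}c^\top(\hat v_{m,n,i}-v_{n,i})\Rightarrow\mathcal N(0,1).$$ In particular, under Condition (Sym-1') of the context, for $\alpha\in\{0,1\}$, $$\sqrt{\frac{m}{(2+\alpha)\tau_{m,n}}}\;\hat\Lambda_{m,n,i}^{-1}(\hat\Lambda_{m,n,i}-\Lambda_{n,i})\Rightarrow\mathcal N(0,1),$$ and for any unit vector $c\in\mathbb R^p$ with $\limsup_{n\to\infty}(c^\top v_{n,i})^2<1$, $$\sqrt{\frac m{\tau_{m,n}}}\Big(\sum_{k\ne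 i}\frac{\hat\Lambda_{m,n,i}\hat\Lambda_{m,n,k}}{(\hat\Lambda_{m,n,i}-\hat\Lambda_{m,n,k})^2}(c^\top\hat v_{m,n,k})^2\Big)^{-1/2}c^\top(\hat v_{m,n,i}-v_{n,i})\Rightarrow\mathcal N(0,1).$$
   Context: Asymptotic regime: $p$ fixed, $n\to\infty$, $m=m_n\to\infty$, $m<n$. $S_{m,n}$ is a random $m\times n$ sketching matrix. $X_n=U_nL_nV_n^\top$ is the SVD: $U_n$ is $n\times p$ with orthonormal columns, $L_n=\mathrm{diag}(\ell_{n,1},\dots,\ell_{n,p})$ with $\ell_{n,1}\ge\dots\ge\ell_{n,p}>0$, $V_n$ is $p\times p$ orthogonal. For a symmetric $p\times p$ matrix $\Xi$, $\lambda_i(\Xi)$ is its $i$-th largest eigenvalue and $v_i(\Xi)$ an associated unit eigenvector whose first nonzero coordinate is positive. $\Lambda_{n,i}=\lambda_i(X_n^\top X_n)$, $v_{n,i}=v_i(X_n^\top X_n)$, $\hat\Lambda_{m,n,i}=\lambda_i(X_n^\top S_{m,n}^\top S_{m,n}X_n)$, $\hat v_{m,n,i}=v_i(X_n^\top S_{m,n}^\top S_{m,n}X_n)$. $\mathrm{vec}$ stacks columns; entries of vectorized $p\times p$ matrices are indexed by pairs $(ij)$, $\mathrm{vec}(A)_{(ij)}=A_{ij}$. $D_p$ is the $p^2\times p(p+1)/2$ matrix $(D_p)_{(ij),(kl)}=\delta_{ik}\delta_{jl}$, $i,j,k,l\in[p]$, $k\le l$. A positive semidefinite $p^2\times p^2$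 matrix $G$ is absolutely symmetric if $G_{(ij),(kl)}=G_{(ij),(lk)}=G_{(ji),(kl)}=G_{(ji),(lk)}$ for all $i,j,k,l\in[p]$ and $D_p^\top GD_p$ is positive definite. $(P_p)_{(ij),(kl)}=\delta_{il}\delta_{jk}$ and $Q_p=\mathrm{vec}(I_p)\mathrm{vec}(I_p)^\top$. $\tau_{m,n}>0$ are scalars with $\tau_{m,n}/m\to0$, and $\mathfrak P'$ is an abstract condition on sequences $(U_n)_{n\ge1}$ (to be specified for each sketching distribution). (Sym): for $(U_n)_{n\ge1}$ satisfying $\mathfrak P'$ there is a sequence of $p^2\times p^2$ absolutely symmetric matrices $(G_n)_{n\ge1}$ and constants $0<c_0<C_0<\infty$ with $c_0I_{p(p+1)/2}\preceq D_p^\top G_nD_p\preceq C_0I_{p(p+1)/2}$, such that $$\sqrt m\,(\tau_{m,n}D_p^\top G_nD_p)^{-1/2}D_p^\top\mathrm{vec}(U_n^\top S_{m,n}^\top S_{m,n}U_n-I_p)\Rightarrow\mathcal N(0,I_{p(p+1)/2}).$$ (Sym-1'), for $\alpha\in\{0,1\}$: the special case in which $\sqrt m\,\tau_{m,n}^{-1/2}\mathrm{vec}(U_n^\top S_{m,n}^\top S_{m,n}U_n-I_p)\Rightarrow\mathcal N(0,G)$ with $G=I_{p^2}+P_p+\alpha Q_p$. For positive definite $\Xi$ with distinct eigenvalues and absolutely symmetric $G$, $$\Delta_i(\Xi,G)=\sum_{k\ne i,\,l\ne i}\frac{\lambda_i(\Xi)\sqrt{\lambda_k(\Xi)\lambda_l(\Xi)}}{(\lambda_i(\Xi)-\lambda_k(\Xi))(\lambda_i(\Xi)-\lambda_l(\Xi))}G_{(ik),(il)}v_k(\Xi)v_l(\Xi)^\top;$$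 for $\Xi$ with repeated eigenvalues, formally $\Delta_i(\Xi,G)=\infty\cdot I_p$, so that $(c^\top\Delta_i(\Xi,G)c)^{-1/2}=0$ for all nonzero $c$.
   Formalization: Eigenvector limits hold with the sign of v̂ matched to v, or literally if √(m/τ) times the first coordinate of v_{n,k} tends to ∞ (all k; only k=i in the last claim); the general eigenvector limit takes the SVD whose columns of V_n have positive first nonzero coordinate. *)

(* Defs.v *)
From HB Require Import structures.
From mathcomp Require Import all_boot all_order all_algebra.
From mathcomp Require Import all_classical all_reals all_analysis.

Set Implicit Arguments.
Unset Strict Implicit.
Unset Printing Implicit Defensive.

Import Order.TTheory GRing.Theory Num.Theory.
Import numFieldNormedType.Exports.

Local Open Scope classical_set_scope.
Local Open Scope ring_scope.

Section Matrices.
Context {R : realType}.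

Definition dotv p (c v : 'cV[R]_p) : R := (c^T *m v) 0 0.

Definition qform p (M : 'M[R]_p) (c : 'cV[R]_p) : R := (c^T *m M *m c) 0 0.

Definition psd p (M : 'M[R]_p) : Prop := M^T = M /\ forall c, 0 <= qform M c.

Definition posdef p (M : 'M[R]_p) : Prop :=
  M^T = M /\ forall c, c != 0 -> 0 < qform M c.

Definition loewner_le p (A B : 'M[R]_p) : Prop := psd (B - A).

Definition psd_sqrt p (M : 'M[R]_p) : 'M[R]_p :=
  xget 0 [set B : 'M[R]_p | psd B /\ B *m B = M].

Definition mx_invsqrt p (M : 'M[R]_p) : 'M[R]_p := invmx (psd_sqrt M).

Definition is_svd n p (X U : 'M[R]_(n, p)) (l : 'rV[R]_p) (V : 'M[R]_p) : Prop :=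
  [/\ X = U *m diag_mx l *m V^T,
      U^T *m U = 1%:M,
      V^T *m V = 1%:M,
      forall i j : 'I_p, (i <= j)%N -> l 0 j <= l 0 i
    & forall i, 0 < l 0 i].

Definition first_nz_pos p (v : 'cV[R]_p) : Prop :=
  exists2 j : 'I_p, 0 < v j 0 & forall k : 'I_p, (k < j)%N -> v k 0 = 0.

(* The eigenvalues of A with multiplicity, in nonincreasing order; such a row
   exists when A is symmetric. *)
Definition spectrum p (A : 'M[R]_p) : 'rV[R]_p :=
  xget 0 [set l : 'rV[R]_p | char_poly A = \prod_i ('X - (l 0 i)%:P) /\
                             forall i j : 'I_p, (i <= j)%N -> l 0 j <= l 0 i].

Definition eigval p (A : 'M[R]_p) (i : 'I_p) : R := spectrum A 0 i.

Definition eigvec p (A : 'M[R]_p) (i : 'I_p) : 'cV[R]_p :=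
  xget 0 [set v : 'cV[R]_p |
    [/\ A *m v = eigval A i *: v, dotv v v = 1 & first_nz_pos v]].

(* The i-th unit eigenvector of B with its sign matched to that of A: the
   convention of eigvec is discontinuous where the first coordinate vanishes,
   so eigvec B i may be close to - eigvec A i for B close to A. *)
Definition eigvec_toward p (A B : 'M[R]_p) (i : 'I_p) : 'cV[R]_p :=
  if 0 <= dotv (eigvec A i) (eigvec B i) then eigvec B i else - eigvec B i.

Definition gram n p (X : 'M[R]_(n, p)) : 'M[R]_p := X^T *m X.

Definition sketch_gram m n p (S : 'M[R]_(m, n)) (X : 'M[R]_(n, p)) : 'M[R]_p :=
  X^T *m S^T *m S *m X.

(* Position of the pair (ij) in the column-stacking vectorization, and back. *)
Definition vidx p (i j : 'I_p) : 'I_(p * p) := mxvec_index j i.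

Definition vpair p (r : 'I_(p * p)) : 'I_p * 'I_p :=
  let ji := enum_val (cast_ord (esym (mxvec_cast p p)) r) in (ji.2, ji.1).

Lemma vidxK p (i j : 'I_p) : vpair (vidx i j) = (i, j).
Proof. by rewrite /vpair /vidx /mxvec_index cast_ordK enum_rankK. Qed.

Definition vec p (A : 'M[R]_p) : 'cV[R]_(p * p) := (mxvec A^T)^T.

Lemma vecE p (A : 'M[R]_p) (i j : 'I_p) : vec A (vidx i j) 0 = A i j.
Proof. by rewrite mxE mxvecE mxE. Qed.

Definition upper p : {set 'I_p * 'I_p} := [set kl : 'I_p * 'I_p | (kl.1 <= kl.2)%N]%SET.

Lemma card_upper p : #|upper p| = (p * p.+1)./2.
Proof.
rewrite -sum1_card; under eq_bigl do rewrite inE.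
rewrite -(pair_big_dep xpredT (fun k l : 'I_p => (k <= l)%N) (fun _ _ => 1%N)) /=.
rewrite (exchange_big_dep xpredT) //=.
transitivity (\sum_(l < p) l.+1)%N.
  apply: eq_bigr => l _; rewrite (big_ord_narrow_cond (P := xpredT) (ltn_ord l)) ?sum1_card ?card_ord //.
by rewrite mulnC -[p]/(p.+1.-1) -bin2 -bin2_sum [RHS]big_mkord big_ord_recl add0n.
Qed.

(* Columns are indexed by the pairs (kl), k <= l. *)
Definition dupl p : 'M[R]_(p * p, #|upper p|) :=
  \matrix_(r, a) (vpair r == enum_val a)%:R.

Definition half_mx p (G : 'M[R]_(p * p)) : 'M[R]_#|upper p| :=
  (dupl p)^T *m G *m dupl p.

Definition abs_sym p (G : 'M[R]_(p * p)) : Prop :=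
  [/\ psd G,
      forall i j k l : 'I_p,
        [/\ G (vidx i j) (vidx k l) = G (vidx i j) (vidx l k),
            G (vidx i j) (vidx k l) = G (vidx j i) (vidx k l)
          & G (vidx i j) (vidx k l) = G (vidx j i) (vidx l k)]
    & posdef (half_mx G)].

Definition perm_P p : 'M[R]_(p * p) :=
  \matrix_(r, s) (((vpair r).1 == (vpair s).2) && ((vpair r).2 == (vpair s).1))%:R.

Definition proj_Q p : 'M[R]_(p * p) := vec 1%:M *m (vec 1%:M)^T.

(* For lam := eigval Xi and v := eigvec Xi this is Delta_i(Xi, G). *)
Definition Delta_of p (lam : 'I_p -> R) (v : 'I_p -> 'cV[R]_p)
    (G : 'M[R]_(p * p)) (i : 'I_p) : 'M[R]_p :=
  \sum_(k | k != i) \sum_(l | l != i)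
    (lam i * Num.sqrt (lam k * lam l) / ((lam i - lam k) * (lam i - lam l))
       * G (vidx i k) (vidx i l)) *: (v k *m (v l)^T).

(* c^T Delta_i c for c nonzero, Delta_i being +oo times the identity when some
   eigenvalue is repeated. *)
Definition Delta_q p (lam : 'I_p -> R) (v : 'I_p -> 'cV[R]_p)
    (G : 'M[R]_(p * p)) (i : 'I_p) (c : 'cV[R]_p) : \bar R :=
  if injectiveb lam then (qform (Delta_of lam v G i) c)%:E else +oo%E.

(* Value of Delta_q at G = I + P + alpha Q. *)
Definition Delta1_q p (lam : 'I_p -> R) (v : 'I_p -> 'cV[R]_p)
    (i : 'I_p) (c : 'cV[R]_p) : \bar R :=
  if injectiveb lam then
    (\sum_(k | k != i)
       lam i * lam k / (lam i - lam k) ^+ 2 * dotv c (v k) ^+ 2)%:E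
  else +oo%E.

Definition inv_sqrte (x : \bar R) : R :=
  if x is r%:E then (Num.sqrt r)^-1 else 0.

End Matrices.

Section ConvergenceInLaw.
Context {R : realType}.

(* Convergence in distribution of the random elements Y n, which may live on
   different probability spaces, to the random element Z. *)
Definition cvg_in_law d (T : nat -> measurableType d)
    (P : forall n, probability (T n) R) (V : topologicalType)
    (Y : forall n, T n -> V)
    d' (E : measurableType d') (mu : probability E R) (Z : E -> V) : Prop :=
  (forall n (A : set V), open A -> measurable (Y n @^-1` A)) /\
  forall f : V -> R, continuous f -> (exists M, forall x, `|f x| <= M) ->
    (\int[P n]_w (f (Y n w))%:E)%E @[n --> \oo]
      --> (\int[mu]_z (f (Z z))%:E)%E.

(* The library's normal_prob is the uniform law for a zero standard deviation,
   hence the case split. *)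
Definition normal_law (s2 : R) (A : set R) : \bar R :=
  if s2 == 0 then \d_(0 : R) A else normal_prob 0 (Num.sqrt s2) A.

(* Z ~ N(0, Sigma), Sigma possibly singular: every linear form a^T Z is
   N(0, a^T Sigma a). *)
Definition gaussian_vector k d (E : measurableType d) (mu : probability E R)
    (Z : E -> 'cV[R]_k) (Sigma : 'M[R]_k) : Prop :=
  forall a : 'cV[R]_k,
    measurable_fun [set: E] (fun z => dotv a (Z z)) /\
    forall A : set R, measurable A ->
      mu [set z | A (dotv a (Z z))] = normal_law (qform Sigma a) A.

Definition cvg_to_normal k d (T : nat -> measurableType d)
    (P : forall n, probability (T n) R) (Y : forall n, T n -> 'cV[R]_k)
    (Sigma : 'M[R]_k) : Prop :=
  exists (d' : measure_display) (E : measurableType d') (mu : probability E R)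
         (Z : E -> 'cV[R]_k),
    gaussian_vector mu Z Sigma /\ cvg_in_law P Y mu Z.

Definition cvg_to_N01 d (T : nat -> measurableType d)
    (P : forall n, probability (T n) R) (Y : forall n, T n -> R) : Prop :=
  cvg_in_law P Y (normal_prob (0 : R) 1) id.

End ConvergenceInLaw.

(* Sequences (U_n) of n x p matrices. *)
Definition frames (R : realType) (p : nat) := forall n, 'M[R]_(n, p).

Section Conditions.
Context {R : realType} (p : nat) (d : measure_display)
  (T : nat -> nat -> measurableType d) (P : forall m n, probability (T m n) R)
  (S : forall m n, T m n -> 'M[R]_(m, n)) (m : nat -> nat)
  (tau : nat -> nat -> R).

Definition orthonormal_frames (U : frames R p) : Prop :=
  forall n, (p <= n)%N -> (U n)^T *m U n = 1%:M.

Definition sketch_error (U : frames R p) n (w : T (m n) n) : 'cV[R]_(p * p) :=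
  vec (sketch_gram (S w) (U n) - 1%:M).

Definition cond_Sym (Pf : frames R p -> Prop)
    (G : frames R p -> nat -> 'M[R]_(p * p)) : Prop :=
  forall U, orthonormal_frames U -> Pf U ->
  [/\ forall n, (0 < n)%N -> abs_sym (G U n),
      exists c0 C0 : R, [/\ 0 < c0, c0 < C0 &
        forall n, (0 < n)%N -> loewner_le (c0%:M) (half_mx (G U n)) /\
                               loewner_le (half_mx (G U n)) (C0%:M)]
    & cvg_to_normal (fun n => P (m n) n)
        (fun n w => Num.sqrt (m n)%:R *:
           (mx_invsqrt (tau (m n) n *: half_mx (G U n))
              *m (dupl p)^T *m sketch_error U w))
        1%:M].

Definition cond_Sym1 (alpha : nat) (Pf : frames R p -> Prop) : Prop :=
  forall U, orthonormal_frames U -> Pf U ->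
  cvg_to_normal (fun n => P (m n) n)
    (fun n w => (Num.sqrt (m n)%:R / Num.sqrt (tau (m n) n)) *: sketch_error U w)
    (1%:M + perm_P p + alpha%:R *: proj_Q p).

End Conditions.

(* Main.v *)
Require Import Defs.
From mathcomp Require Import all_boot all_order all_algebra all_fingroup.
From mathcomp Require Import all_classical all_reals all_analysis.
From mathcomp Require Import measurable_realfun spectral complex ring lra.

Import Order.TTheory GRing.Theory Num.Theory.
Import numFieldNormedType.Exports.

Set Implicit Arguments.
Unset Strict Implicit.
Unset Printing Implicit Defensive.

Local Open Scope classical_set_scope.
Local Open Scope ring_scope.

(** Write [X = U L V^T] for the singular value decomposition and [1 + W] for the
    Gram matrix of the sketched frame [S U]. Then [X^T X = V L^2 V^T] while
    [X^T S^T S X = V L (1 + W) L V^T]: in the basis [V] sketching is a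
    multiplicative perturbation of size [1 / r], where [r = sqrt (m / tau)].
    Because the ratios of the singular values are bounded and bounded away from
    one, perturbation theory applies uniformly in [n]. As long as [r W] stays
    bounded, the relative error of the [i]-th eigenvalue, times [r], is the [i]-th
    diagonal entry of [r W] up to a vanishing term ([eigval_error_asym]), and the
    error of the [i]-th eigenvector along [c], times [r], is a linear form in the
    [i]-th row of [r W], with coefficients built from the relative gaps and the
    coordinates of [c] in the basis [V] ([eigvec_error_asym]). Weyl's
    inequality shows that the relative errors vanish, and the eigenvector equation
    then gives both expansions. The studentizing factor may be computed from
    [X^T X] instead of its sketch, so each statistic is close to a linear form in
    [r W] that the limit covariance standardizes ([student_asym],
    [student_coef_norm]).

    Both hypotheses on the sketch say that [r W] is a linear image of random
    vectors that converge to a normal law ([row_normal_Sym], [row_normal_Sym1]). A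
    statistic that is uniformly close, on every ball, to standardized linear forms
    with bounded coefficients is asymptotically standard normal
    ([slutsky_linear]). The coefficients depend on [n] and need not converge, but
    they do along any ultrafilter. Uniformity over bounded errors is expressed by
    the filter [localized] on pairs of an index and a sample point, along which
    the perturbation theory is a deterministic calculus of vanishing differences
    ([asym]).

    Convergence in law also asks that the statistics be measurable. Eigenvalues
    are Lipschitz functions of the matrix, and eigenvectors of a simple spectrum
    are read off the Lagrange interpolation formula for the eigenprojections
    ([measurable_eigval], [measurable_eigvec]); for a repeated eigenvalue the
    studentized statistics vanish.

    The eigenvectors of [X^T X] agree with the columns of [V] up to sign. The signs
    cancel when distinct directions are uncorrelated, and are trivial when the
    columns of [V] follow the convention of [eigvec]. When the first coordinate of
    an eigenvector dominates [1 / r], the normalized eigenvectors of both matrices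
    have matching signs ([eigvec_toward_stable]). *)

(** * Spectral theory of real symmetric matrices *)

Section SpectralTheorem.
Context {R : realType}.

(** Over the complexification of [R] the matrix is Hermitian, hence diagonalizable
    with real eigenvalues. *)
Lemma symmetric_eigenvalue n (A : 'M[R]_n.+1) : A^T = A ->
  exists l : R, eigenvalue A l.
Proof.
move=> symA; pose A' := map_mx (real_complex R) A.
have A'_herm : A' \is hermsymmx.
  apply: realsym_hermsym.
    apply/is_hermitianmxP; rewrite expr0 scale1r /A' -map_trmx.
    by rewrite map_mx_id // map_trmx symA.
  by apply/mxOverP => i j; rewrite mxE complex_real.
have sp_real := hermitian_spectral_diag_real A'_herm.
have /orthomx_spectralP := hermitian_normalmx A'_herm.
set Q := spectralmx A'; set sp := spectral_diag A' => defA'.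
have Qu : Q \in unitmx by apply: spectral_unit.
have : eigenvalue A' (sp 0 0).
  apply/eigenvalueP; exists (row 0 Q).
    rewrite defA' !mulmxA -row_mul mulmxV // -row_mul mul1mx.
    by rewrite row_diag_mx -scalemxAl -rowE.
  apply/negP => /eqP r0; have := row_free_unit Q; rewrite Qu => /row_freeP [B].
  move/(congr1 (fun M => row 0 M)); rewrite row_mul r0 mul0mx.
  move/(congr1 (fun M : 'rV_n.+1 => M 0 0)); rewrite !mxE /= => /eqP.
  by rewrite eq_sym oner_eq0.
have [x ->] : exists x : R, sp 0 0 = real_complex R x.
  by move/mxOverP: sp_real => /(_ 0 0) /complex_realP.
rewrite eigenvalue_root_char -map_char_poly fmorph_root => rx.
by exists x; rewrite eigenvalue_root_char.
Qed.

Lemma dotvE n (c v : 'cV[R]_n) : dotv c v = \sum_k c k 0 * v k 0.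
Proof. by rewrite /dotv mxE; apply: eq_bigr => k _; rewrite mxE. Qed.

Lemma dotvv_ge0 n (v : 'cV[R]_n) : 0 <= dotv v v.
Proof. by rewrite dotvE sumr_ge0 // => k _; rewrite -expr2 sqr_ge0. Qed.

Lemma dotvv_eq0 n (v : 'cV[R]_n) : (dotv v v == 0) = (v == 0).
Proof.
apply/idP/idP => [|/eqP ->]; last by rewrite /dotv mulmx0 mxE.
rewrite dotvE psumr_eq0 => [/allP v0|k _]; last by rewrite -expr2 sqr_ge0.
apply/eqP/matrixP => i j; rewrite mxE ord1; apply/eqP.
by have := v0 i (mem_index_enum _); rewrite implyTb mulf_eq0 orbb.
Qed.

(** Witnessed by the Householder reflection that exchanges the first basis vector
    with [v]. *)
Lemma orthogonal_completion n (v : 'cV[R]_n.+1) : dotv v v = 1 ->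
  exists H : 'M[R]_n.+1, [/\ H^T = H, H *m H = 1%:M & H *m delta_mx 0 0 = v].
Proof.
move=> v1; pose e : 'cV[R]_n.+1 := delta_mx 0 0.
have [ve|vNe] := eqVneq v e.
  by exists 1%:M; rewrite trmx1 !mul1mx.
pose u := v - e; pose s := dotv u u.
have s_neq0 : s != 0 by rewrite dotvv_eq0 subr_eq0.
have dotC (a b : 'cV[R]_n.+1) : dotv a b = dotv b a.
  by rewrite !dotvE; apply: eq_bigr => k _; rewrite mulrC.
have dot0 (a : 'cV[R]_n.+1) : dotv a e = a 0 0.
  rewrite dotvE (bigD1 0) //= big1 => [|k /negPf k0]; rewrite !mxE ?eqxx ?k0 ?mulr0 //=.
  by rewrite mulr1 addr0.
have dotB (a b : 'cV[R]_n.+1) : dotv a (b - e) = dotv a b - dotv a e.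
  by rewrite /dotv mulmxBr !mxE.
have s_eq : s = 2 - 2 * v 0 0.
  rewrite /s /u dotB (dotC _ v) dotB v1 !dot0 !mxE !eqxx /=.
  ring.
have ue : dotv u e = v 0 0 - 1 by rewrite dot0 !mxE !eqxx.
have uTu : u^T *m u = s%:M by rewrite [LHS]mx11_scalar.
exists (1%:M - (2 / s) *: (u *m u^T)); split.
- by rewrite linearB /= linearZ /= trmx_mul trmxK trmx1.
- rewrite mulmxBl mul1mx mulmxBr mulmx1 -scalemxAl -!scalemxAr.
  rewrite mulmxA -[u *m u^T *m u]mulmxA uTu mul_mx_scalar -scalemxAl !scalerA.
  have -> : 2 / s * (2 / s * s) = 2 / s + 2 / s by field.
  by rewrite scalerDl opprB addrK subrK.
- rewrite mulmxBl mul1mx -scalemxAl -mulmxA -/e.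
  rewrite [u^T *m e]mx11_scalar -/(dotv u e) ue mul_mx_scalar scalerA.
  have -> : 2 / s * (v 0 0 - 1) = -1.
    apply: (mulIf s_neq0); rewrite mulrAC divfK // s_eq; ring.
  by rewrite scaleN1r opprK /u addrC subrK.
Qed.

(** By induction on the dimension: once a reflection has moved an eigenvector to
    the first basis vector, symmetry makes the matrix block diagonal. *)
Lemma real_spectral_unsorted n (A : 'M[R]_n) : A^T = A ->
  exists (Q : 'M[R]_n) (l : 'rV[R]_n),
    Q^T *m Q = 1%:M /\ A = Q *m diag_mx l *m Q^T.
Proof.
elim: n A => [|n IHn] A symA.
  by exists 1%:M, 0; split; apply/matrixP => -[].
have [l /eigenvalueP [v vA v0]] := symmetric_eigenvalue symA.
pose s := Num.sqrt (dotv v^T v^T).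
have sv_gt0 : 0 < dotv v^T v^T.
  by rewrite lt_neqAle dotvv_ge0 eq_sym dotvv_eq0 trmx_eq0 v0.
have s_gt0 : 0 < s by rewrite sqrtr_gt0.
pose w := s^-1 *: v^T.
have w1 : dotv w w = 1.
  have -> : dotv w w = s^-1 * s^-1 * dotv v^T v^T.
    by rewrite !dotvE mulr_sumr; apply: eq_bigr => k _; rewrite !mxE; ring.
  rewrite -invfM -expr2 sqr_sqrtr ?dotvv_ge0 //.
  by rewrite mulVf ?gt_eqF.
have Aw : A *m w = l *: w.
  rewrite /w -scalemxAr -{1}symA -trmx_mul vA linearZ /=.
  by rewrite !scalerA mulrC.
have [H [symH HH He]] := orthogonal_completion w1.
have Hw : H *m w = delta_mx 0 0 by rewrite -He mulmxA HH mul1mx.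
pose B : 'M[R]_(1 + n) := H *m A *m H.
have symB : B^T = B by rewrite /B !trmx_mul symA symH mulmxA.
have Be : B *m (delta_mx 0 0 : 'cV[R]_n.+1) = l *: delta_mx 0 0.
  have -> : B *m (delta_mx 0 0 : 'cV[R]_n.+1) = H *m (A *m (H *m delta_mx 0 0)).
    by rewrite !mulmxA.
  by rewrite He Aw -scalemxAr Hw.
have Bl : lsubmx B = l *: delta_mx 0 0.
  rewrite -Be -colE; apply/matrixP => i j; rewrite ord1 !mxE.
  by apply: eq_bigr => k _; congr (_ * H _ _); apply/val_inj.
have Bul : ulsubmx B = l%:M.
  apply/matrixP => i j; rewrite !ord1.
  have := congr1 (fun M : 'cV[R]_(1 + n) => M (lshift n 0) 0) Bl.
  by rewrite !mxE /= mulr1 mulr1n.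
have Bdl : dlsubmx B = 0.
  apply/matrixP => i j; rewrite !ord1.
  have := congr1 (fun M : 'cV[R]_(1 + n) => M (rshift 1 i) 0) Bl.
  by rewrite !mxE /= mulr0.
have Bur : ursubmx B = 0.
  by rewrite -symB -trmx_dlsub Bdl trmx0.
have [|Q' [l' [Q'Q' defB']]] := IHn (drsubmx B).
  by rewrite trmx_drsub symB.
pose Q1 : 'M[R]_(1 + n) := block_mx 1%:M 0 0 Q'.
pose l1 : 'rV[R]_(1 + n) := row_mx l%:M l'.
have Q1Q1 : Q1^T *m Q1 = 1%:M.
  rewrite /Q1 tr_block_mx mulmx_block !trmx0 trmx1 !(mulmx0, mul0mx, addr0, add0r).
  by rewrite mulmx1 Q'Q' -scalar_mx_block.
have dl1 : diag_mx l1 = block_mx l%:M 0 0 (diag_mx l').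
  by rewrite /l1 diag_mx_row; congr block_mx; apply/matrixP => i j; rewrite !ord1 !mxE !mulr1n.
have defB : B = Q1 *m diag_mx l1 *m Q1^T.
  rewrite dl1 /Q1 tr_block_mx !mulmx_block !trmx0 trmx1.
  rewrite !(mulmx0, mul0mx, addr0, add0r, mul1mx, mulmx1) -defB'.
  by rewrite -{1}[B]submxK Bul Bur Bdl.
exists (H *m Q1), l1; split.
  by rewrite trmx_mul symH mulmxA -[_ *m H *m H]mulmxA HH mulmx1.
rewrite trmx_mul symH !mulmxA -[H *m Q1 *m _ *m _]mulmxA -[H *m Q1 *m _]mulmxA mulmxA.
rewrite -2!mulmxA [Q1 *m _]mulmxA -/l1.
have -> : A = H *m B *m H by rewrite /B !mulmxA HH mul1mx -mulmxA HH mulmx1.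
by rewrite {1}defB !mulmxA.
Qed.

Definition nonincreasing p (l : 'rV[R]_p) :=
  forall i j : 'I_p, (i <= j)%N -> l 0 j <= l 0 i.

Definition is_spectral p (A Q : 'M[R]_p) (l : 'rV[R]_p) :=
  [/\ Q^T *m Q = 1%:M, A = Q *m diag_mx l *m Q^T & nonincreasing l].

Lemma diag_conjE p (Q : 'M[R]_p) (l : 'rV[R]_p) i j :
  (Q *m diag_mx l *m Q^T) i j = \sum_k l 0 k * (Q i k * Q j k).
Proof.
rewrite mxE; apply: eq_bigr => k _.
rewrite mul_mx_diag !mxE; ring.
Qed.

Theorem real_spectral p (A : 'M[R]_p) : A^T = A ->
  exists (Q : 'M[R]_p) (l : 'rV[R]_p), is_spectral A Q l.
Proof.
move=> /real_spectral_unsorted [Q [l [QQ defA]]].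
pose t := [tuple l 0 i | i < p].
have tot : total (>=%R : rel R) by move=> x y; apply: le_total.
have /tuple_permP [s sE] : perm_eq (sort >=%R t) t by rewrite perm_sort.
have sort_nth (i : 'I_p) : nth 0 (sort >=%R t) i = l 0 (s i).
  rewrite sE (nth_map i) ?size_enum_ord ?ltn_ord //.
  by rewrite nth_ord_enum tnth_mktuple.
exists (col_perm s Q), (\row_i l 0 (s i)); split.
- apply/matrixP => i j; move/matrixP: QQ => /(_ (s i) (s j)).
  rewrite !mxE (inj_eq perm_inj) => <-; apply: eq_bigr => k _.
  by rewrite !mxE.
- rewrite defA; apply/matrixP => i j; rewrite !diag_conjE.
  by rewrite (reindex_inj (@perm_inj _ s)); apply: eq_bigr => k _; rewrite !mxE.
- move=> i j ij; rewrite !mxE -!sort_nth.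
  apply: (@sorted_leq_nth _ (>=%R)) => //.
  + by move=> x y z /= xy yz; apply: le_trans xy.
  + by move=> x /=.
  + exact: sort_sorted.
  + by rewrite inE size_sort size_tuple.
  + by rewrite inE size_sort size_tuple.
Qed.

Lemma char_poly_spectral p (A Q : 'M[R]_p) l : is_spectral A Q l ->
  char_poly A = \prod_i ('X - (l 0 i)%:P).
Proof.
case=> QQ -> _.
have QTQ : Q *m Q^T = 1%:M by apply: mulmx1C.
pose q := map_mx polyC Q.
have qq : q *m q^T = 1%:M by rewrite /q map_trmx -map_mxM QTQ map_mx1.
have -> : char_poly (Q *m diag_mx l *m Q^T) = char_poly (diag_mx l).
  rewrite /char_poly /char_poly_mx.
  have -> : 'X%:M - map_mx polyC (Q *m diag_mx l *m Q^T) =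
      q *m ('X%:M - map_mx polyC (diag_mx l)) *m q^T.
    rewrite !map_mxM -/q -map_trmx -/q mulmxBr mulmxBl; congr (_ - _).
    by rewrite mul_mx_scalar -scalemxAl qq scale_scalar_mx mulr1.
  by rewrite !det_mulmx mulrAC -det_mulmx qq det1 mul1r.
rewrite char_poly_trig ?diag_mx_is_trig //.
by apply: eq_bigr => i _; rewrite mxE eqxx mulr1n.
Qed.

(** A polynomial determines the multiset of its roots, hence their sorted list;
    this makes the choice in [spectrum] canonical. *)
Lemma nonincreasing_roots_uniq p (l l' : 'rV[R]_p) :
  nonincreasing l -> nonincreasing l' ->
  \prod_i ('X - (l 0 i)%:P) = \prod_i ('X - (l' 0 i)%:P) -> l = l'.
Proof.
move=> nl nl' E.
have big (m : 'rV[R]_p) : \prod_i ('X - (m 0 i)%:P) =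
    \prod_(x <- [seq m 0 i | i <- enum 'I_p]) ('X - x%:P).
  by rewrite big_map big_enum.
have srt (m : 'rV[R]_p) : nonincreasing m ->
    sorted >=%R [seq m 0 i | i <- enum 'I_p].
    move=> nm; apply/(sortedP 0) => k; rewrite size_map size_enum_ord => kp.
  have kp' := ltnW kp.
  rewrite -[k]/(val (Ordinal kp')) -[k.+1]/(val (Ordinal kp)).
  rewrite (nth_map (Ordinal kp) 0 _ (n := Ordinal kp)) ?size_enum_ord //.
  rewrite (nth_map (Ordinal kp) 0 _ (n := Ordinal kp')) ?size_enum_ord //.
  by rewrite !nth_ord_enum; apply: nm => /=.
have := E; rewrite !big => /prod_XsubC_eq /sorted_eq lE.
have {}lE : [seq l 0 i | i <- enum 'I_p] = [seq l' 0 i | i <- enum 'I_p].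
  apply: lE (srt _ nl) (srt _ nl').
    by move=> x y z /= xy yz; apply: le_trans xy.
  by move=> x y /= /andP[xy yx]; apply/eqP; rewrite eq_le xy yx.
apply/rowP => i; have := congr1 (nth 0 ^~ i) lE.
rewrite (nth_map i 0 _ (n := i)) ?size_enum_ord //.
by rewrite (nth_map i 0 _ (n := i)) ?size_enum_ord // nth_ord_enum.
Qed.

Lemma spectrumE p (A Q : 'M[R]_p) l : is_spectral A Q l -> spectrum A = l.
Proof.
move=> sp; rewrite /spectrum; case: xgetP => [m _ [chm mono]|/(_ l)]; last first.
  by case: (sp) => _ _ nl []; split => //; apply: char_poly_spectral sp.
apply: nonincreasing_roots_uniq => //; first by case: sp.
by rewrite -chm (char_poly_spectral sp).
Qed.

Lemma eigvalE p (A Q : 'M[R]_p) l i : is_spectral A Q l -> eigval A i = l 0 i.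
Proof. by rewrite /eigval => /spectrumE ->. Qed.

Lemma eigval_spectral p (A : 'M[R]_p) : A^T = A ->
  exists Q, is_spectral A Q (spectrum A).
Proof. by move=> /real_spectral [Q [l sp]]; exists Q; rewrite (spectrumE sp). Qed.

Lemma qform_spectral p (A Q : 'M[R]_p) l x : is_spectral A Q l ->
  qform A x = \sum_k l 0 k * (Q^T *m x) k 0 ^+ 2.
Proof.
case=> _ -> _.
rewrite /qform !mulmxA -[_ *m Q^T *m x]mulmxA -[x^T *m Q]trmxK trmx_mul trmxK.
rewrite mxE; apply: eq_bigr => k _.
by rewrite mul_mx_diag !mxE; ring.
Qed.

Lemma dotv_orthogonal p (Q : 'M[R]_p) x y : Q^T *m Q = 1%:M ->
  dotv (Q^T *m x) (Q^T *m y) = dotv x y.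
Proof.
move=> /mulmx1C QQ; rewrite /dotv trmx_mul trmxK !mulmxA.
by rewrite -[_ *m Q *m _]mulmxA QQ mulmx1.
Qed.

(** The span of the first eigenvectors of [A], up to the [i]-th one, meets the span
    of the eigenvectors of [B] from the [i]-th one on; a common vector compares the
    two eigenvalues. *)
Lemma weyl p (A B : 'M[R]_p) (e : R) i : A^T = A -> B^T = B ->
  (forall x, qform A x <= qform B x + e * dotv x x) ->
  eigval A i <= eigval B i + e.
Proof.
move=> /eigval_spectral [Q sA] /eigval_spectral [Q' sB] AB.
pose M1 : 'M[R]_p := pid_mx i.+1 *m Q^T; pose M2 := copid_mx i *m Q'^T.
have [QQ _ nlA] := sA; have [QQ' _ nlB] := sB.
have Qu : Q^T \in unitmx by rewrite unitmx_tr; case/mulmx1_unit: QQ.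
have Qu' : Q'^T \in unitmx by rewrite unitmx_tr; case/mulmx1_unit: QQ'.
have r1 : \rank M1 = i.+1.
  by rewrite mxrankMfree ?row_free_unit // rank_pid_mx.
have r2 : \rank M2 = (p - i)%N.
  by rewrite mxrankMfree ?row_free_unit // rank_copid_mx // ltnW.
have : (M1 :&: M2)%MS != 0.
  rewrite -mxrank_eq0; apply/negP => /eqP r0.
  have := mxrank_sum_cap M1 M2; rewrite r0 r1 r2 addn0 addSn subnKC 1?ltnW //.
  by move=> rE; have := rank_leq_col (M1 + M2)%MS; rewrite rE ltnn.
case/rowV0Pn => v; rewrite sub_capmx => /andP[/submxP[y1 vE1] /submxP[y2 vE2]] v0.
pose x := v^T.
have x_gt0 : 0 < dotv x x.
  by rewrite lt_neqAle dotvv_ge0 eq_sym dotvv_eq0 /x trmx_eq0 v0.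
have zA (k : 'I_p) : (i < k)%N -> (Q^T *m x) k 0 = 0.
  move=> ik; rewrite /x vE1 -trmx_mul !mulmxA -(mulmxA _ Q^T) QQ mulmx1.
  rewrite mxE mxE big1 // => j _; rewrite !mxE.
  case: eqP => [->|]; rewrite ?andbF ?mulr0 //.
  by rewrite ltnS leqNgt ik /= mulr0.
have zB (k : 'I_p) : (k < i)%N -> (Q'^T *m x) k 0 = 0.
  move=> ki; rewrite /x vE2 -trmx_mul !mulmxA -(mulmxA _ Q'^T) QQ' mulmx1.
  rewrite mxE mxE big1 // => j _; rewrite !mxE.
  have [jk|/eqP jk] := eqVneq j k; last first.
    by rewrite val_eqE (introF eqP jk) /= subr0 mulr0.
  by rewrite jk eqxx ki subrr mulr0.
have leA : eigval A i * dotv x x <= qform A x.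
  rewrite (qform_spectral _ sA) -(dotv_orthogonal _ _ QQ) dotvE mulr_sumr.
  apply: ler_sum => k _; rewrite -expr2.
  have [ki|ik] := leqP k i; last by rewrite zA // expr0n !mulr0.
  by rewrite ler_wpM2r ?sqr_ge0 // nlA.
have leB : qform B x <= eigval B i * dotv x x.
  rewrite (qform_spectral _ sB) -(dotv_orthogonal _ _ QQ') dotvE mulr_sumr.
  apply: ler_sum => k _; rewrite -expr2.
  have [ik|ki] := leqP i k; last by rewrite zB // expr0n !mulr0.
  by rewrite ler_wpM2r ?sqr_ge0 // nlB.
rewrite -(ler_pM2r x_gt0) mulrDl; apply: le_trans leA _.
by apply: le_trans (AB x) _; rewrite lerD2r.
Qed.

Lemma is_spectral_col p (A Q : 'M[R]_p) l i : is_spectral A Q l ->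
  A *m col i Q = l 0 i *: col i Q /\ dotv (col i Q) (col i Q) = 1.
Proof.
case=> QQ -> _; split.
  rewrite colE -!mulmxA (mulmxA Q^T) QQ mul1mx.
  have -> : diag_mx l *m delta_mx i 0 = l 0 i *: delta_mx i 0 :> 'cV_p.
    apply/matrixP => k j; rewrite mul_diag_mx !mxE ord1 eqxx andbT.
    by case: eqP => [->|]; rewrite ?mulr0.
  by rewrite -scalemxAr.
have := congr1 (fun M : 'M[R]_p => M i i) QQ; rewrite [RHS]mxE eqxx mulr1n => <-.
by rewrite dotvE mxE; apply: eq_bigr => k _; rewrite !mxE.
Qed.

Lemma first_nz_pos_sign p (v : 'cV[R]_p) : v != 0 ->
  first_nz_pos v \/ first_nz_pos (- v).
Proof.
move=> v0; have [j vj] : exists j, v j 0 != 0.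
  apply/existsP; apply: contraNT v0; rewrite negb_exists => /forallP v0.
  by apply/eqP/matrixP => i j; rewrite ord1 mxE; apply/eqP; have := v0 i; rewrite negbK.
have ex : exists n : nat, [exists j : 'I_p, (j == n :> nat) && (v j 0 != 0)].
  by exists j; apply/existsP; exists j; rewrite eqxx.
case: (ex_minnP ex) => n /existsP [k /andP[/eqP <- vk]] kmin.
have vl (l : 'I_p) : (l < k)%N -> v l 0 = 0.
  move=> lk; apply/eqP; rewrite -[_ == _]negbK; apply/negP => vl.
  have : (k <= l)%N by apply: kmin; apply/existsP; exists l; rewrite eqxx.
  by rewrite leqNgt lk.
have [vk0|vk0|/eqP] := ltgtP (v k 0) 0; last by rewrite (negPf vk).
  right; exists k => [|l lk]; rewrite mxE ?oppr_gt0 //.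
  by rewrite vl ?oppr0.
by left; exists k.
Qed.

Lemma eigvecP p (A : 'M[R]_p) i : A^T = A ->
  [/\ A *m eigvec A i = eigval A i *: eigvec A i,
      dotv (eigvec A i) (eigvec A i) = 1 & first_nz_pos (eigvec A i)].
Proof.
move=> symA; rewrite /eigvec.
case: xgetP => [v -> []//|noev]; exfalso.
have [Q sA] := eigval_spectral symA.
have [Aq q1] := is_spectral_col i sA.
have q0 : col i Q != 0 by rewrite -dotvv_eq0 q1 oner_eq0.
have [fq|fq] := first_nz_pos_sign q0; first by apply: (noev (col i Q)).
apply: (noev (- col i Q)); split => //; first by rewrite mulmxN Aq scalerN.
rewrite -q1 !dotvE; apply: eq_bigr => k _; rewrite !mxE; ring.
Qed.

(** Eigenspaces of a simple spectrum are lines. *)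
Lemma simple_eigvec p (A Q : 'M[R]_p) l i v : is_spectral A Q l ->
  injective (l 0) -> A *m v = l 0 i *: v -> dotv v v = 1 ->
  exists b : bool, v = (-1) ^+ b *: col i Q.
Proof.
case=> QQ defA _ injl Av v1.
have QTQ := mulmx1C QQ.
have yE k : k != i -> (Q^T *m v) k 0 = 0.
  move=> ki; have := congr1 (fun u => (Q^T *m u) k 0) Av.
  rewrite /= defA !mulmxA QQ mul1mx -(mulmxA (diag_mx l)) mul_diag_mx mxE.
  rewrite -scalemxAr [RHS]mxE => /eqP; rewrite -subr_eq0 -mulrBl mulf_eq0.
  by case/orP => /eqP //; move/eqP; rewrite subr_eq0 => /eqP/injl/eqP; rewrite (negPf ki).
have vE : v = (Q^T *m v) i 0 *: col i Q.
  rewrite -[LHS]mul1mx -QTQ -mulmxA; set y := Q^T *m v in yE *.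
  apply/matrixP => a b; rewrite ord1 [LHS]mxE (bigD1 i) //= big1; last first.
    by move=> k /yE ->; rewrite mulr0.
  by rewrite addr0 !mxE mulrC.
have : (Q^T *m v) i 0 ^+ 2 = 1.
  rewrite -v1 -(dotv_orthogonal _ _ QQ) dotvE (bigD1 i) //= big1 ?addr0 ?expr2 //.
  by move=> k /yE ->; rewrite mulr0.
move/eqP; rewrite sqrf_eq1 => /orP[]/eqP y1.
  by exists false; rewrite {1}vE y1.
by exists true; rewrite {1}vE y1.
Qed.

Lemma first_nz_pos_uniq p (v : 'cV[R]_p) (b : bool) :
  first_nz_pos v -> first_nz_pos ((-1) ^+ b *: v) -> b = false.
Proof.
case: b => //; rewrite scaleN1r => -[j vj jmin] [k vk kmin].
have [jk|kj|jk] := ltngtP j k.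
- by move: (kmin _ jk) vj; rewrite mxE => /eqP; rewrite oppr_eq0 => /eqP ->; rewrite ltxx.
- by move: vk; rewrite mxE jmin // oppr0 ltxx.
- by move: vk; rewrite mxE oppr_gt0 -(val_inj jk) ltNge ltW.
Qed.

(** The square roots of the eigenvalues, in an eigenbasis, give a square root. *)
Lemma psd_sqrtP p (M : 'M[R]_p) : psd M ->
  psd (psd_sqrt M) /\ psd_sqrt M *m psd_sqrt M = M.
Proof.
move=> [symM M_ge0]; rewrite /psd_sqrt; case: xgetP => [B _ //|noB]; exfalso.
have [Q sM] := eigval_spectral symM.
have [QQ defM _] := sM.
have l_ge0 i : 0 <= spectrum M 0 i.
  have [Mq q1] := is_spectral_col i sM.
  have := M_ge0 (col i Q); rewrite /qform -mulmxA Mq -scalemxAr mxE.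
  by rewrite -/(dotv _ _) q1 mulr1.
pose r : 'rV[R]_p := \row_i Num.sqrt (spectrum M 0 i).
have diagT (d : 'rV[R]_p) : (Q *m diag_mx d *m Q^T)^T = Q *m diag_mx d *m Q^T.
  by rewrite !trmx_mul trmxK tr_diag_mx mulmxA.
apply: (noB (Q *m diag_mx r *m Q^T)); split; first split => // x.
  rewrite /qform !mulmxA -[_ *m Q^T *m x]mulmxA -[x^T *m Q]trmxK trmx_mul trmxK.
  rewrite mxE sumr_ge0 // => k _; rewrite mul_mx_diag !mxE.
  by rewrite mulrAC -expr2 mulr_ge0 ?sqr_ge0 ?sqrtr_ge0.
rewrite [RHS]defM !mulmxA -[_ *m Q^T *m Q]mulmxA QQ mulmx1 -!mulmxA; congr (_ *m _).
rewrite !mulmxA; congr (_ *m _); apply/matrixP => i j; rewrite mul_diag_mx !mxE.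
case: eqP => [->|]; rewrite ?mulr0n ?mulr0 // !mulr1n -expr2 sqr_sqrtr //.
Qed.

End SpectralTheorem.

(** * Weak convergence to a normal law *)

Section Ultrafilters.

(** A filter converges as soon as all the ultrafilters refining it do; along an
    ultrafilter every bounded sequence converges, so this is how sequential
    compactness is used below. *)
Lemma cvg_ultra (I : Type) (V : topologicalType) (F : set_system I) (u : I -> V) (l : V) :
  Filter F ->
  (forall U, UltraFilter U -> F `<=` U -> u @ U --> l) -> u @ F --> l.
Proof.
move=> FF ul A Al; apply: contrapT => /= FA.
pose G : set_system I := [set X | F [set i | ~ A (u i) -> X i]].
have GF : ProperFilter G.
  split.
    move=> G0; suff /FA : F (u @^-1` A) by [].
    have G0' : F [set i | ~ A (u i) -> False] := G0.
    by apply: filterS G0' => i /= uA; apply: contrapT.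
  split; first by rewrite /G /=; apply: (@filterS _ F _ setT) => //; exact: filterT.
    move=> X Y GX GY; rewrite /G /=; apply: (@filterS2 _ F _ _ _ _ _ GX GY) => i /= Xi Yi uA.
    by split; [apply: Xi|apply: Yi].
  by move=> X Y XY; rewrite /G /=; apply: (@filterS _ F) => i /= Xi /Xi /XY.
have [U [UU GU]] := ultraFilterLemma GF.
have FU : F `<=` U.
  by move=> X FX; apply: GU; rewrite /G /=; exact: (@filterS _ F _ X _ (fun i Xi _ => Xi) FX).
have UA : U (u @^-1` A) by apply: ul FU _ Al.
have UcA : U (u @^-1` (~` A)).
  apply: GU; have FT : F setT by apply: filterT.
  by apply: (@filterS _ F _ setT _ _ FT) => i _ uA; exact: uA.
apply: (@filter_not_empty _ U); apply: filterS2 UA UcA => i; exact.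
Qed.

Lemma ultra_bounded_cvg (R : realType) (I : Type) (U : set_system I) (x : I -> R) (C : R) :
  UltraFilter U -> U [set i | `|x i| <= C] -> exists l : R, x @ U --> l.
Proof.
move=> UU Ux.
have Pf : ProperFilter (x @ U) by apply: fmap_proper_filter.
have [|l [_ lc]] := @segment_compact R (- C) C (x @ U) Pf.
  by rewrite /nbhs /=; apply: filterS Ux => i /=; rewrite in_itv /= ler_norml.
exists l => N Nl; case: (in_ultra_setVsetC (x @^-1` N) UU) => // UN.
by have [y []] := lc (~` N) N UN Nl.
Qed.

End Ultrafilters.

Section Expectations.
Context {R : realType} d (T : measurableType d) (P : probability T R).
Implicit Types f g h : T -> R.

Definition bounded_rv f :=
  measurable_fun [set: T] f /\ exists M : R, forall w, `|f w| <= M.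

Lemma bounded_rv_integrable f : bounded_rv f -> P.-integrable [set: T] (EFin \o f).
Proof.
move=> [mf [M fM]]; apply: measurable_bounded_integrable => //.
  by rewrite [X in (X < _)%E](probability_setT P) ltry.
exists M; split; first exact: num_real.
by move=> x Mx w _; apply: le_trans (fM w) (ltW Mx).
Qed.

Lemma expectationE f : bounded_rv f ->
  (\int[P]_w (f w)%:E)%E = (\int[P]_w f w)%:E.
Proof.
by move=> bf; rewrite /Rintegral fineK //; apply: integrable_fin_num (bounded_rv_integrable bf).
Qed.

Lemma expectation_near f g h (e c : R) : bounded_rv f -> bounded_rv g -> bounded_rv h ->
  (forall w, `|f w - g w| <= e + c * h w) ->
  `|\int[P]_w f w - \int[P]_w g w| <= e + c * \int[P]_w h w.
Proof.
move=> bf bg bh fgh.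
have [mf [M fM]] := bf; have [mg [N gN]] := bg; have [mh [L hL]] := bh.
have bfg : bounded_rv (fun w => f w - g w).
  split; first exact: measurable_funB.
  by exists (M + N) => w; apply: le_trans (ler_normB _ _) _; apply: lerD.
have bn : bounded_rv (fun w => `|f w - g w|).
  split; first by apply: measurableT_comp => //; case: bfg.
  by case: bfg => _ [K fgK]; exists K => w; rewrite normr_id.
have bch : bounded_rv (fun w => c * h w).
  split; first by apply: measurable_funM.
  by exists (`|c| * L) => w; rewrite normrM ler_wpM2l.
have be : bounded_rv (fun w => e).
  by split; [exact: measurable_cst|exists `|e|].
have bech : bounded_rv (fun w => e + c * h w).
  split; first by apply: measurable_funD => //; case: bch.
  exists (`|e| + `|c| * L) => w; apply: le_trans (ler_normD _ _) _.
  by rewrite lerD2l normrM ler_wpM2l.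
rewrite -RintegralB //; [|exact: bounded_rv_integrable..].
apply: le_trans (le_normr_Rintegral _ _) _ => //; first exact: bounded_rv_integrable.
apply: le_trans (le_Rintegral _ _ _ (fun w _ => fgh w)) _ => //; [exact: bounded_rv_integrable..|].
rewrite RintegralD //; [|exact: bounded_rv_integrable..].
rewrite Rintegral_cst // RintegralZl //; last exact: bounded_rv_integrable.
by rewrite [X in fine X](probability_setT P) mulr1.
Qed.

End Expectations.

Section Continuity.
Context {R : realType}.

Lemma uniform_continuity_bounded (f : R -> R) (C e : R) : continuous f -> 0 < e ->
  exists2 dl : R, 0 < dl & forall x y, `|x| <= C -> `|y - x| <= dl -> `|f y - f x| <= e.
Proof.
move=> cf e0.
have /compact_near_coveringP cK := @segment_compact R (- C) C.
have : \forall dl \near (0 : R)^'+, forall x, `[(- C), C]%classic x ->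
    forall y, `|y - x| <= dl -> `|f y - f x| <= e.
  apply: cK => x _.
  have /cvgrPdist_le /(_ (e / 2) (divr_gt0 e0 (ltr0n _ 2))) /nbhs_ballP [eta /= eta0 ball_eta] := cf x.
  have eta2 : 0 < eta / 2 by rewrite divr_gt0.
  exists (ball x (eta / 2), [set dl | dl < eta / 2]) => /=.
    by split; [exact: nbhsx_ballx|exact: nbhs_right_lt].
  move=> [x' dl] [/= xx' dlt] y yx'.
  have fx' : `|f x - f x'| <= e / 2.
    by apply: ball_eta; apply: lt_trans xx' _; rewrite gtr_pMr // invf_lt1 // ltr1n.
  have fy : `|f x - f y| <= e / 2.
    apply: ball_eta; rewrite /ball /= (splitr eta).
    rewrite -(subrKA x'); apply: le_lt_trans (ler_normD _ _) _.
    by apply: ltrD => //; rewrite distrC; apply: le_lt_trans dlt.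
  rewrite (splitr e) -(subrKA (f x)); apply: le_trans (ler_normD _ _) _.
  by apply: lerD => //; rewrite distrC.
move=> near_dl.
have [dl [dl0 dlP]] : exists dl : R, 0 < dl /\ forall x, `[(- C), C]%classic x ->
    forall y, `|y - x| <= dl -> `|f y - f x| <= e.
  by apply: (@filter_ex _ (0 : R)^'+); near=> dl; split; near: dl; [exact: nbhs_right_gt|].
exists dl => // x y xC yx; apply: dlP => //=.
by rewrite in_itv /= -ler_norml.
Unshelve. all: by end_near. Qed.

Lemma dotv_continuous k (b : 'cV[R]_k) : continuous (dotv b : 'cV[R]_k -> R).
Proof.
rewrite (_ : dotv b = fun y => \sum_i b i 0 * y i 0); last first.
  by apply/funext => v; rewrite dotvE.
apply: (continuous_big add_continuous) => i _ y.
by apply: continuousM; [exact: cst_continuous|exact: coord_continuous].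
Qed.

Lemma dotvv_continuous k : continuous (fun y : 'cV[R]_k => dotv y y : R).
Proof.
rewrite (_ : (fun y => dotv y y) = fun y : 'cV[R]_k => \sum_i y i 0 * y i 0); last first.
  by apply/funext => v; rewrite dotvE.
apply: (continuous_big add_continuous) => i _ y.
by apply: continuousM; exact: coord_continuous.
Qed.

Lemma dotvC k (b y : 'cV[R]_k) : dotv b y = dotv y b.
Proof. by rewrite !dotvE; apply: eq_bigr => i _; rewrite mulrC. Qed.

Lemma le_dotv_l1 k (b y : 'cV[R]_k) (C : R) : (forall i, `|y i 0| <= C) ->
  `|dotv b y| <= (\sum_i `|b i 0|) * C.
Proof.
move=> yC; rewrite dotvE mulr_suml; apply: le_trans (ler_norm_sum _ _ _) _.
by apply: ler_sum => i _; rewrite normrM ler_wpM2l.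
Qed.

Lemma le_coord_dotvv k (y : 'cV[R]_k) i : y i 0 ^+ 2 <= dotv y y.
Proof.
rewrite dotvE (bigD1 i) //= expr2 lerDl sumr_ge0 // => j _.
by rewrite -expr2 sqr_ge0.
Qed.

End Continuity.

Section Slutsky.
Context {R : realType}.

(** A bounded continuous surrogate for the indicator of [K <= |y|^2]. *)
Definition escape k (K : R) (y : 'cV[R]_k) : R := Num.min 1 (dotv y y / K).

Lemma escape_continuous k (K : R) : continuous (escape K : 'cV[R]_k -> R).
Proof.
move=> y; rewrite /escape.
apply: (@continuous_min R _ (fun=> 1) (fun y => dotv y y / K) y).
  exact: cst_continuous.
by apply: continuousM; [exact: dotvv_continuous|exact: cst_continuous].
Qed.

Lemma escape_bound k (K : R) (y : 'cV[R]_k) : 0 < K -> 0 <= escape K y <= 1.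
Proof.
move=> K0; rewrite /escape ge_min lexx /= andbT le_min ler01 /=.
by rewrite divr_ge0 ?dotvv_ge0 ?ltW.
Qed.

Lemma escape_normr k (K : R) (y : 'cV[R]_k) : 0 < K -> `|escape K y| <= 1.
Proof. by move=> /(escape_bound y) /andP[e0 e1]; rewrite ger0_norm. Qed.

Lemma escape_eq1 k (K : R) (y : 'cV[R]_k) : 0 < K -> K <= dotv y y -> escape K y = 1.
Proof. by move=> K0 Ky; rewrite /escape; apply/min_idPl; rewrite ler_pdivlMr // mul1r. Qed.

Section GaussianLimit.
Context k d (T : nat -> measurableType d) (P : forall n, probability (T n) R)
  (Y : forall n, T n -> 'cV[R]_k) d' (E : measurableType d') (mu : probability E R)
  (Z : E -> 'cV[R]_k) (Sigma : 'M[R]_k).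
Hypotheses (gZ : gaussian_vector mu Z Sigma) (YZ : cvg_in_law P Y mu Z).
Arguments Y : clear implicits.

Lemma measurable_continuous_comp n (g : 'cV[R]_k -> R) : continuous g ->
  measurable_fun [set: T n] (g \o Y n).
Proof.
move=> /continuousP cg; apply: (measurability _ (RGenOpens.measurableE R)).
move=> _ [_ [a [b ->] <-]]; rewrite setTI comp_preimage.
by apply: (proj1 YZ); apply: cg; exact: interval_open.
Qed.

Lemma bounded_continuous_comp n (g : 'cV[R]_k -> R) : continuous g ->
  (exists M : R, forall x, `|g x| <= M) -> bounded_rv (g \o Y n).
Proof.
by move=> cg [M gM]; split; [exact: measurable_continuous_comp|exists M => w /=].
Qed.

Lemma cvg_expectation (g : 'cV[R]_k -> R) : continuous g ->
  (exists M : R, forall x, `|g x| <= M) -> measurable_fun [set: E] (g \o Z) ->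
  (\int[P n]_w g (Y n w)) @[n --> \oo] --> \int[mu]_z g (Z z).
Proof.
move=> cg bg mg; have := proj2 YZ g cg bg.
rewrite expectationE; last by case: bg => M gM; split=> //; exists M => w /=.
under eq_fun do rewrite (expectationE _ (bounded_continuous_comp _ cg bg)).
by move/fine_cvg.
Qed.

Lemma limit_measurable (b : 'cV[R]_k) : measurable_fun [set: E] (fun z => dotv b (Z z)).
Proof. by case: (gZ b). Qed.

Lemma limit_dotvv_measurable : measurable_fun [set: E] (fun z => dotv (Z z) (Z z)).
Proof.
rewrite (_ : (fun z => _) = fun z => \sum_i dotv (delta_mx i 0) (Z z) ^+ 2).
  by apply: measurable_sum => i; apply: measurable_funX; apply: limit_measurable.
apply/funext => z; rewrite dotvE; apply: eq_bigr => i _.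
rewrite dotvE (bigD1 i) //= big1 ?addr0 => [|j /negPf ji]; rewrite !mxE ?eqxx ?ji ?mul1r ?mul0r //.
Qed.

Lemma escape_measurable (K : R) : measurable_fun [set: E] (escape K \o Z).
Proof.
rewrite (_ : escape K \o Z = (fun=> 1) \min (fun z => dotv (Z z) (Z z) * K^-1)) //.
apply: measurable_minr => //.
by apply: measurable_funM => //; exact: limit_dotvv_measurable.
Qed.

(** The limit law charges no mass at infinity, by dominated convergence. *)
Lemma limit_tight (e : R) : 0 < e ->
  exists2 N : nat, (0 < N)%N & \int[mu]_z escape N%:R (Z z) <= e.
Proof.
move=> e0.
pose h N := escape N.+1%:R \o Z.
have K0 N : (0 : R) < N.+1%:R by rewrite ltr0n.
have bh N : bounded_rv (h N).
  split; first exact: escape_measurable.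
  by exists 1 => z; apply: escape_normr.
have hz z : (h N z)%:E @[N --> \oo] --> (0%:E : \bar R).
  apply: cvg_EFin; first by near=> N.
  apply: (@squeeze_cvgr _ _ _ _ (fun=> 0) (fun N => dotv (Z z) (Z z) * N.+1%:R^-1)).
  - near=> N; rewrite /h /= (andP (escape_bound _ (K0 N))).1 /=.
    by rewrite /escape ge_min lexx orbT.
  - exact: cvg_cst.
  - rewrite -[X in _ --> X](mulr0 (dotv (Z z) (Z z))).
    by apply: cvgM; [exact: cvg_cst|exact: cvg_harmonic].
have mh N : measurable_fun [set: E] (fun z => (h N z)%:E).
  by apply/measurable_EFinP; case: (bh N).
have h1 : \forall z \ae mu, forall N, [set: E] z -> (`|(h N z)%:E| <= 1%:E)%E.
  by apply: aeW => z N _; rewrite lee_fin; apply: escape_normr.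
have h0 : \forall z \ae mu, [set: E] z -> (h N z)%:E @[N --> \oo] --> (0%:E : \bar R).
  by apply: aeW => z _; apply: hz.
have [_ _] := @dominated_convergence _ E R mu setT measurableT
   (fun N z => (h N z)%:E) (cst 0%:E) (cst 1%:E) mh (measurable_cst _) h0
   (finite_measure_integrable_cst mu 1 measurableT) h1.
rewrite integral_cst // mul0e => /= hcvg.
have {}hcvg : \int[mu]_z h N z @[N --> \oo] --> (0 : R).
  by apply/fine_cvg; move: hcvg; under eq_fun do rewrite expectationE //.
have /cvgrPdist_le /(_ e e0) := hcvg.
move=> [N _ /(_ N (leqnn _))] /=; rewrite sub0r normrN => hN.
by exists N.+1 => //; apply: le_trans hN; apply: ler_norm.
Unshelve. all: by end_near. Qed.

Lemma limit_law (b : 'cV[R]_k) (f : R -> R) : qform Sigma b = 1 ->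
  continuous f -> (exists M : R, forall x, `|f x| <= M) ->
  (\int[mu]_z (f (dotv b (Z z)))%:E = \int[normal_prob (0 : R) 1]_x (f x)%:E)%E.
Proof.
move=> b1 cf [M fM]; have [mb lawb] := gZ b.
have mf : measurable_fun [set: R] f by apply: continuous_measurable_fun.
pose bZ : {RV mu >-> measurableTypeR R} :=
  @mfun_Sub _ _ E (measurableTypeR R) (fun z => dotv b (Z z)) (mem_set mb).
have ibZ : mu.-integrable [set: E] ((EFin \o f) \o bZ).
  apply: (@bounded_rv_integrable _ _ _ mu (f \o (fun z => dotv b (Z z)))).
  by split; [exact: measurableT_comp|exists M => w /=].
rewrite -[LHS](@integral_distribution _ _ _ _ _ mu bZ (EFin \o f)) //; last first.
  exact/measurable_EFinP.
apply: eq_measure_integral => A mA _.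
by have := lawb A mA; rewrite /normal_law b1 oner_eq0 sqrtr1.
Qed.

(** On a large ball [f (X n)] is close to [f (dotv b (Y n))] by uniform continuity;
    off the ball their difference is at most [2 M], and the mass there is small
    because [escape] is a continuous test function and the limit is tight. *)
Lemma slutsky_ultra (U : set_system nat) (b : 'cV[R]_k) (X : forall n, T n -> R)
    (f : R -> R) (M : R) :
  UltraFilter U -> \oo `<=` U -> qform Sigma b = 1 ->
  (forall n, measurable_fun [set: T n] (X n)) ->
  (forall K dl : R, 0 < dl -> U [set n | forall w, dotv (Y n w) (Y n w) <= K ->
     `|X n w - dotv b (Y n w)| <= dl]) ->
  continuous f -> (forall x, `|f x| <= M) ->
  \int[P n]_w f (X n w) @[n --> U] --> \int[mu]_z f (dotv b (Z z)).
Proof.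
move=> UU oU b1 mX Xb cf fM.
have cfb : continuous (f \o dotv b).
  by move=> y; apply: continuous_comp; [exact: dotv_continuous|exact: cf].
have bfb : exists M : R, forall y, `|(f \o dotv b) y| <= M by exists M => y /=.
have mfb : measurable_fun [set: E] ((f \o dotv b) \o Z).
  apply: measurableT_comp; last exact: limit_measurable.
  exact: continuous_measurable_fun.
have cvgfb := cvg_expectation cfb bfb mfb.
have M0 : 0 <= M by apply: le_trans (fM 0).
apply/cvgrPdist_le => e e0.
pose e1 := e / 4; have e1_gt0 : 0 < e1 by rewrite divr_gt0.
pose e2 := e / (8 * (M + 1)); have M1 : 0 < M + 1 by rewrite ltr_wpDl.
have e2_gt0 : 0 < e2 by rewrite divr_gt0 // mulr_gt0.
have [N N0 tightN] := limit_tight e2_gt0.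
have NR : 0 < N%:R :> R by rewrite ltr0n.
have be : exists M : R, forall y : 'cV[R]_k, `|escape N%:R y| <= M.
  by exists 1 => y; apply: escape_normr.
have cvge := cvg_expectation (@escape_continuous k N%:R) be (escape_measurable _).
pose C := (\sum_i `|b i 0|) * N%:R.
have [dl dl0 fdl] := uniform_continuity_bounded C cf e1_gt0.
have : U [set n | `|\int[mu]_z f (dotv b (Z z)) - \int[P n]_w f (dotv b (Y n w))| <= e1].
  by apply: oU; move/cvgrPdist_le : cvgfb; apply.
have : U [set n | `|\int[mu]_z escape N%:R (Z z) - \int[P n]_w escape N%:R (Y n w)| <= e2].
  by apply: oU; move/cvgrPdist_le : cvge; apply.
have := Xb N%:R dl dl0.
apply: filterS3 => n /= XbN escN fbN.
have bX : bounded_rv (f \o X n).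
  split; last by exists M => w /=.
  by apply: measurableT_comp => //; exact: continuous_measurable_fun.
have bY := bounded_continuous_comp n cfb bfb.
have bE := bounded_continuous_comp n (@escape_continuous k N%:R) be.
have pointwise w : `|f (X n w) - f (dotv b (Y n w))| <= e1 + (2 * M) * escape N%:R (Y n w).
  have [YN|/ltW YN] := leP (dotv (Y n w) (Y n w)) N%:R.
    rewrite -[leLHS]addr0; apply: lerD; last first.
      by rewrite !mulr_ge0 //; case/andP: (escape_bound (Y n w) NR).
    apply: fdl; last exact: XbN.
    apply: le_dotv_l1 => i; have := le_coord_dotvv (Y n w) i.
    move=> /le_trans /(_ YN); rewrite -ler_sqrt ?sqrtr_sqr //.
    move=> /le_trans; apply; rewrite -[leRHS]ger0_norm // -sqrtr_sqr.
    by rewrite ler_sqrt ?exprn_ge0 // expr2 ler_peMl ?ler0n // ler1n.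
  rewrite escape_eq1 // mulr1 -[leLHS]add0r; apply: lerD; first exact: ltW.
  by apply: le_trans (ler_normB _ _) _; rewrite mulrDl mul1r lerD.
have := expectation_near (P n) bX bY bE pointwise.
rewrite /= => near_f.
have esc2 : \int[P n]_w escape N%:R (Y n w) <= 2 * e2.
  move: escN; rewrite distrC ler_norml => /andP[_]; rewrite lerBlDr => /le_trans; apply.
  by rewrite mulrDl mul1r lerD2l.
have esc4 : 2 * M * \int[P n]_w escape N%:R (Y n w) <= e / 2.
  have -> : e / 2 = (2 * (M + 1)) * (2 * e2).
    by rewrite /e2; field; rewrite gt_eqF.
  apply: le_trans (ler_wpM2l _ esc2) _; first by rewrite mulr_ge0.
  apply: ler_wpM2r; first by rewrite mulr_ge0 // ltW.
  by rewrite ler_pM2l // lerDl.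
have -> : e = e1 + (e1 + e / 2) by rewrite /e1; field.
rewrite -(subrKA (\int[P n]_w f (dotv b (Y n w)))).
apply: le_trans (ler_normD _ _) _; apply: lerD => //.
rewrite distrC; apply: le_trans near_f _.
by rewrite lerD2l.
Qed.

End GaussianLimit.

(** The coefficients of the linear forms may vary with [n] without converging:
    along each ultrafilter they do converge, and the limiting form has the same
    standard normal law. *)
Theorem slutsky_linear k d (T : nat -> measurableType d) (P : forall n, probability (T n) R)
    (Y : forall n, T n -> 'cV[R]_k) (Sigma : 'M[R]_k) (b : nat -> 'cV[R]_k)
    (X : forall n, T n -> R) (C : R) :
  cvg_to_normal P Y Sigma ->
  (\forall n \near \oo, forall i, `|b n i 0| <= C) ->
  (\forall n \near \oo, qform Sigma (b n) = 1) ->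
  (forall n, measurable_fun [set: T n] (X n)) ->
  (forall K dl : R, 0 < dl -> \forall n \near \oo, forall w,
     dotv (Y n w) (Y n w) <= K -> `|X n w - dotv (b n) (Y n w)| <= dl) ->
  cvg_to_N01 P X.
Proof.
move=> [d' [E [mu [Z [gZ YZ]]]]] bC b1 mX Xb; split.
  move=> n A oA; rewrite -[_ @^-1` _]setTI; apply: mX => //.
  exact: open_measurable.
move=> f cf [M fM].
apply: cvg_ultra => U UU oU.
have [beta bbeta] : exists beta : 'cV[R]_k, forall i, b n i 0 @[n --> U] --> beta i 0.
  have /choice [beta bbeta] : forall i, exists l : R, b n i 0 @[n --> U] --> l.
    move=> i; apply: (@ultra_bounded_cvg _ _ _ _ C UU).
    by apply: oU; apply: filterS bC => n /=; apply.
  by exists (\col_i beta i) => i; rewrite mxE.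
have q1 : qform Sigma beta = 1.
  have qE (v : 'cV[R]_k) : qform Sigma v = \sum_i \sum_j v j 0 * Sigma j i * v i 0.
    rewrite /qform mxE; apply: eq_bigr => i _; rewrite mxE mulr_suml.
    by apply: eq_bigr => j _; rewrite !mxE.
  have : qform Sigma (b n) @[n --> U] --> qform Sigma beta.
    rewrite qE; under eq_fun do rewrite qE.
    apply: (cvg_big add_continuous) => i _.
    apply: (cvg_big add_continuous) => j _.
    by apply: cvgM (bbeta i); apply: cvgM (bbeta j) _; exact: cvg_cst.
  have : qform Sigma (b n) @[n --> U] --> (1 : R).
    by apply: cvg_near_cst; apply: oU b1.
  by move=> q1 qb; apply: (cvg_unique _ qb q1).
have Xbeta K dl : 0 < dl -> U [set n | forall w, dotv (Y n w) (Y n w) <= K ->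
    `|X n w - dotv beta (Y n w)| <= dl].
  move=> dl0; pose dl2 := dl / 2; have dl20 : 0 < dl2 by rewrite divr_gt0.
  pose K1 := Num.max K 1.
  have sum0 : \sum_i `|(b n - beta) i 0| @[n --> U] --> (0 : R).
    have E0 : (0 : R) = \sum_(i < k) (0 : R) by rewrite big1.
    rewrite [X in _ --> X]E0; apply: (cvg_big add_continuous) => i _.
    rewrite -[X in _ --> X](@normr0 _ R); apply: cvg_norm.
    under eq_fun do rewrite !mxE.
    by rewrite -(subrr (beta i 0)); apply: cvgB => //; exact: cvg_cst.
  have : (\sum_i `|(b n - beta) i 0|) * K1 @[n --> U] --> (0 : R).
    by rewrite -[X in _ --> X](mul0r K1); apply: cvgM => //; exact: cvg_cst.
  move=> /cvgrPdist_le /(_ dl2 dl20).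
  have : U _ := oU _ (Xb K dl2 dl20).
  apply: filterS2 => n /= Xbn bn w YK.
  have -> : dl = dl2 + dl2 by rewrite /dl2; field.
  rewrite -(subrKA (dotv (b n) (Y n w))); apply: le_trans (ler_normD _ _) _.
  apply: lerD; first exact: Xbn.
  have -> : dotv (b n) (Y n w) - dotv beta (Y n w) = dotv (b n - beta) (Y n w).
    by rewrite /dotv linearB /= mulmxBl !mxE.
  move: bn; rewrite sub0r normrN ger0_norm; last first.
    by rewrite mulr_ge0 ?sumr_ge0 // /K1 le_max ler01 orbT.
  apply: le_trans; apply: le_dotv_l1 => i.
  rewrite -[leRHS]ger0_norm; last by rewrite /K1 le_max ler01 orbT.
  rewrite -ler_sqr ?nnegrE // !real_normK ?num_real //.
  apply: le_trans (le_coord_dotvv _ i) _; apply: le_trans YK _.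
  have K11 : 1 <= K1 by rewrite /K1 le_max lexx orbT.
  apply: (@le_trans _ _ K1); first by rewrite /K1 le_max lexx.
  by rewrite expr2 ler_peMl // (le_trans ler01).
rewrite -(limit_law gZ q1 cf); last by exists M.
rewrite expectationE; last first.
  split; last by exists M.
  apply: (@measurableT_comp _ _ _ _ _ _ f); first exact: continuous_measurable_fun.
  by case: (gZ beta).
have bfX n : bounded_rv (fun w => f (X n w)).
  split; last by exists M.
  by apply: measurableT_comp => //; exact: continuous_measurable_fun.
under eq_fun do rewrite expectationE //.
apply: cvg_EFin; first exact: filterE.
exact: (slutsky_ultra gZ YZ UU oU q1 mX Xbeta cf fM).
Qed.

End Slutsky.

(** * Measurability of eigenvalues and eigenvectors *)

Section EigenvalueContinuity.
Context {R : realType}.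

Lemma qformE p (M : 'M[R]_p) x : qform M x = \sum_i \sum_j x j 0 * M j i * x i 0.
Proof.
rewrite /qform mxE; apply: eq_bigr => i _; rewrite mxE mulr_suml.
by apply: eq_bigr => j _; rewrite !mxE.
Qed.

Lemma qformD p (A B : 'M[R]_p) x : qform (A + B) x = qform A x + qform B x.
Proof. by rewrite /qform mulmxDr mulmxDl mxE. Qed.

Lemma qform_entries p (D : 'M[R]_p) (e : R) x : 0 <= e -> (forall i j, `|D i j| <= e) ->
  `|qform D x| <= e * p%:R * dotv x x.
Proof.
move=> e0 De.
have -> : e * p%:R * dotv x x =
    \sum_(i < p) \sum_(j < p) e * ((x i 0 ^+ 2 + x j 0 ^+ 2) / 2).
  under eq_bigr do rewrite -mulr_sumr; rewrite -mulr_sumr -mulrA; congr (_ * _).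
  under eq_bigr do rewrite -mulr_suml big_split /= sumr_const card_ord.
  rewrite -mulr_suml big_split /= sumr_const card_ord dotvE.
  rewrite sumrMnl (eq_bigr (fun k => x k 0 ^+ 2)) => [|k _]; last by rewrite expr2.
  by rewrite -[_ *+ p]mulr_natl; field.
rewrite qformE; apply: le_trans (ler_norm_sum _ _ _) _; apply: ler_sum => i _.
apply: le_trans (ler_norm_sum _ _ _) _; apply: ler_sum => j _.
rewrite !normrM mulrAC mulrC ler_pM //.
rewrite -[x i 0 ^+ 2]real_normK ?num_real // -[x j 0 ^+ 2]real_normK ?num_real //.
rewrite -subr_ge0; have -> : forall a b : R, (a ^+ 2 + b ^+ 2) / 2 - b * a = (a - b) ^+ 2 / 2.
  by move=> a b; field.
by rewrite divr_ge0 ?sqr_ge0.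
Qed.

(** Weyl's inequality applied in both directions. *)
Lemma eigval_lipschitz p (A B : 'M[R]_p) (e : R) i : A^T = A -> B^T = B -> 0 <= e ->
  (forall i j, `|A i j - B i j| <= e) -> `|eigval A i - eigval B i| <= e * p%:R.
Proof.
have half (C D : 'M[R]_p) : C^T = C -> D^T = D -> 0 <= e ->
    (forall i j, `|C i j - D i j| <= e) -> eigval C i <= eigval D i + e * p%:R.
  move=> sC sD e0 CD; apply: weyl => // x.
  have -> : C = D + (C - D) by rewrite addrC subrK.
  rewrite qformD lerD2l; apply: le_trans (ler_norm _) _.
  by apply: qform_entries => // a b; rewrite !mxE; have := CD a b.
move=> sA sB e0 AB; have AB1 := half A B sA sB e0 AB.
have BA1 : eigval B i <= eigval A i + e * p%:R.
  by apply: half => // a b; rewrite distrC.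
move: AB1 BA1; move: (eigval A i) (eigval B i) (e * p%:R) => a b c; clear => ab ba.
by rewrite ler_norml; apply/andP; split; lra.
Qed.

End EigenvalueContinuity.

Section MeasurableMatrices.
Context {R : realType} d (T : measurableType d).

Definition measurable_mx m n (M : T -> 'M[R]_(m, n)) :=
  forall i j, measurable_fun [set: T] (fun w => M w i j).

Lemma measurable_sum_cond (I : finType) (Q : pred I) (f : I -> T -> R) :
  (forall i, Q i -> measurable_fun [set: T] (f i)) ->
  measurable_fun [set: T] (fun w => \sum_(i | Q i) f i w).
Proof.
move=> mf; under eq_fun do rewrite big_mkcond.
apply: measurable_sum => i; have := mf i; case: (Q i) => [/(_ isT)//|_].
exact: measurable_cst.
Qed.

Lemma measurable_prod_cond (I : finType) (Q : pred I) (f : I -> T -> R) :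
  (forall i, Q i -> measurable_fun [set: T] (f i)) ->
  measurable_fun [set: T] (fun w => \prod_(i | Q i) f i w).
Proof.
move=> mf; under eq_fun do rewrite big_mkcond.
apply: measurable_prod => i _; have := mf i; case: (Q i) => [/(_ isT)//|_].
exact: measurable_cst.
Qed.

Lemma measurable_inv (f : T -> R) :
  measurable_fun [set: T] f -> measurable_fun [set: T] (fun w => (f w)^-1).
Proof.
have minv : measurable_fun [set: R] (fun x : R => x^-1).
  have -> : [set: R] = [set 0] `|` ~` [set (0 : R)] by rewrite setUCr.
  apply/measurable_funU => //; first exact: measurableC.
  split; first exact: measurable_fun_set1.
  apply: open_continuous_measurable_fun; first exact/closed_openC/closed_eq.
  by move=> x; rewrite inE /= => /eqP x0; apply: inv_continuous.
by move=> mf; apply: measurableT_comp minv mf.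
Qed.

Lemma measurable_sqrt (f : T -> R) :
  measurable_fun [set: T] f -> measurable_fun [set: T] (fun w => Num.sqrt (f w)).
Proof.
move=> mf; apply: measurableT_comp mf; apply: continuous_measurable_fun.
exact: sqrt_continuous.
Qed.

Lemma measurable_natr (b : T -> bool) :
  measurable_fun [set: T] b -> measurable_fun [set: T] (fun w => (b w)%:R : R).
Proof.
move=> mb; rewrite (_ : (fun w => _) = fun w => if b w then 1 else 0).
  exact: measurable_fun_ifT.
by apply/funext => w; case: (b w).
Qed.

Lemma measurable_mulmx m n k (M : T -> 'M[R]_(m, n)) (N : T -> 'M[R]_(n, k)) :
  measurable_mx M -> measurable_mx N -> measurable_mx (fun w => M w *m N w).
Proof.
move=> mM mN i j; under eq_fun do rewrite mxE.
by apply: measurable_sum => l; apply: measurable_funM.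
Qed.

Lemma measurable_cst_mx m n (M : 'M[R]_(m, n)) : measurable_mx (fun=> M).
Proof. by move=> i j; exact: measurable_cst. Qed.

Lemma measurable_trmx m n (M : T -> 'M[R]_(m, n)) :
  measurable_mx M -> measurable_mx (fun w => (M w)^T).
Proof. by move=> mM i j; under eq_fun do rewrite mxE; exact: mM. Qed.

(** A continuous function of a random matrix is a countable union of conditions
    on the distance to rational matrices. *)
Lemma measurable_continuous_mx m n (M : T -> 'M[R]_(m, n)) (F : 'M[R]_(m, n) -> R) :
  measurable_mx M ->
  (forall (A : 'M[R]_(m, n)) (e : R), 0 < e -> exists2 dl : R, 0 < dl &
     forall B : 'M[R]_(m, n), (forall i j, `|A i j - B i j| < dl) -> `|F A - F B| < e) ->
  measurable_fun [set: T] (F \o M).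
Proof.
move=> mM cF; apply: (measurability _ (RGenOInfty.measurableE R)).
move=> _ [_ [t ->] <-]; rewrite setTI.
pose near_q (D : 'M[rat]_(m, n)) (k : nat) : set 'M[R]_(m, n) :=
  [set A | forall i j, `|A i j - ratr (D i j)| < k.+1%:R^-1].
pose good (Dk : 'M[rat]_(m, n) * nat) := forall A, near_q Dk.1 Dk.2 A -> t < F A.
have -> : (F \o M) @^-1` `]t, +oo[ = \bigcup_Dk
    (if `[< good Dk >] then M @^-1` near_q Dk.1 Dk.2 else set0).
  apply/seteqP; split => [w /=|w [Dk _]]; rewrite /= in_itv /= andbT; last first.
    by case: asboolP => // gDk; exact: gDk.
  move=> tFM; have [|dl dl0 dlF] := cF (M w) (F (M w) - t); first by rewrite subr_gt0.
  have [k k_dl] : exists k : nat, 2 * k.+1%:R^-1 < dl.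
    have dl2 : 0 < dl / 2 by rewrite divr_gt0.
    have [k kP] := ltr_add_invr dl2.
    by exists k; move: kP; rewrite add0r ltr_pdivlMr // mulrC.
  have /choice [D DP] : forall ij : 'I_m * 'I_n, exists q : rat,
      `|M w ij.1 ij.2 - ratr q| < k.+1%:R^-1.
    move=> ij; have k0 : (0 : R) < k.+1%:R^-1 by rewrite invr_gt0.
    move: (k.+1%:R^-1) (M w ij.1 ij.2) k0 => h x h0.
    have : x - h < x + h by lra.
    move=> /rat_in_itvoo [q]; rewrite in_itv /= => /andP[q1 q2].
    by exists q; rewrite ltr_norml; apply/andP; split; lra.
  exists (\matrix_(i, j) D (i, j), k) => //=; case: asboolP => [_ i j|[]].
    by rewrite /= mxE; exact: (DP (i, j)).
  move=> A /= AD.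
  have : `|F (M w) - F A| < F (M w) - t.
    apply: dlF => i j; apply: lt_trans k_dl; rewrite mulrDl mul1r.
    rewrite -(subrKA (ratr (D (i, j)))); apply: le_lt_trans (ler_normD _ _) _.
    apply: ltrD; first exact: (DP (i, j)).
    by rewrite distrC; have := AD i j; rewrite mxE.
  by rewrite ltr_norml => /andP[_]; lra.
apply: countable_bigcupT_measurable => [|Dk].
  exact: countableP.
case: ifP => // _.
rewrite (_ : _ @^-1` _ = \bigcap_(ij in [set: 'I_m * 'I_n])
    [set w | `|M w ij.1 ij.2 - ratr (Dk.1 ij.1 ij.2)| < Dk.2.+1%:R^-1]); last first.
  by apply/seteqP; split => [w Mw ij _|w Mw i j]; [exact: Mw|exact: (Mw (i, j))].
apply: fin_bigcap_measurable => // ij _.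
have mlt : measurable_fun [set: T]
    (fun w => `|M w ij.1 ij.2 - ratr (Dk.1 ij.1 ij.2)| < Dk.2.+1%:R^-1).
  apply: measurable_fun_ltr => //; apply: measurableT_comp => //.
  by apply: measurable_funB => //; exact: mM.
by have := mlt measurableT [set true] I; rewrite setTI.
Qed.

(** Continuity holds on symmetric matrices only, hence the symmetrization. *)
Lemma measurable_eigval p (M : T -> 'M[R]_p) i : measurable_mx M ->
  (forall w, (M w)^T = M w) -> measurable_fun [set: T] (fun w => eigval (M w) i).
Proof.
move=> mM sM; pose sym (A : 'M[R]_p) := 2^-1 *: (A + A^T).
have symT A : (sym A)^T = sym A by rewrite /sym linearZ linearD /= trmxK addrC.
have -> : (fun w => eigval (M w) i) = (fun A => eigval (sym A) i) \o M.
  apply/funext => w /=; congr eigval; rewrite /sym sM scalerDr -scalerDl.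
  by rewrite (_ : 2^-1 + 2^-1 = 1) ?scale1r //; field.
apply: measurable_continuous_mx => // A e e0.
have p0 : 0 < p.+1%:R :> R by [].
exists (e / p.+1%:R); first by rewrite divr_gt0.
move=> B AB; apply: (@le_lt_trans _ _ (e / p.+1%:R * p%:R)); last first.
  by rewrite -mulrA gtr_pMr // mulrC ltr_pdivrMr // mul1r ltr_nat.
apply: eigval_lipschitz => //; first by rewrite ltW // divr_gt0.
move=> j k; rewrite !mxE.
have := AB j k; have := AB k j; rewrite !ltr_norml ler_norml => /andP[h1 h2] /andP[h3 h4].
move: (e / p.+1%:R) h1 h2 h3 h4 => h; move: (A k j) (A j k) (B k j) (B j k) => a b c c'.
by clear => h1 h2 h3 h4; apply/andP; split; lra.
Qed.

(** The orthogonal projection on the [i]-th eigenline of a symmetric matrix with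
    simple spectrum, as a rational function of the entries and eigenvalues
    (Lagrange interpolation). *)
Definition eigenprojection q (A : 'M[R]_q.+1) (i : 'I_q.+1) : 'M[R]_q.+1 :=
  \prod_(k | k != i)
    ((eigval A i - eigval A k)^-1 *: (A - (eigval A k)%:M)).

Lemma eigenprojectionE q (A : 'M[R]_q.+1) i : A^T = A -> injective (eigval A) ->
  eigenprojection A i = eigvec A i *m (eigvec A i)^T.
Proof.
move=> sA injA; have [Q spA] := eigval_spectral sA.
have [QQ _ _] := spA; have QTQ := mulmx1C QQ.
have [Av v1 _] := eigvecP i sA.
have [b vE] := simple_eigvec spA injA Av v1.
have prodE (r : seq 'I_q.+1) j :
    (\prod_(k <- r | k != i) ((eigval A i - eigval A k)^-1 *: (A - (eigval A k)%:M)))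
      *m col j Q =
    (\prod_(k <- r | k != i) ((eigval A i - eigval A k)^-1 * (eigval A j - eigval A k)))
      *: col j Q.
  elim: r => [|k r IHr]; first by rewrite !big_nil mul1mx scale1r.
  rewrite !big_cons; case: ifP => // ki.
  rewrite -mulmxE -mulmxA IHr -scalemxAr -scalemxAl mulmxBl mul_scalar_mx.
  have [-> _] := is_spectral_col j spA; rewrite -scalerBl !scalerA; congr (_ *: _).
  by rewrite /eigval; ring.
have colE j : eigenprojection A i *m col j Q = (j == i)%:R *: col j Q.
  rewrite prodE; congr (_ *: _); have [->|ji] := eqVneq j i.
    by rewrite big1 // => k ki; rewrite mulVf // subr_eq0 (inj_eq injA) eq_sym.
  by rewrite (bigD1 j) //= subrr mulr0 mul0r.
have PE : eigenprojection A i = \sum_j (eigenprojection A i *m col j Q) *m (col j Q)^T.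
  rewrite -[LHS]mulmx1 -QTQ mulmxA; apply/matrixP => a c; rewrite mxE summxE.
  apply: eq_bigr => j _; rewrite [RHS]mxE big_ord1 !mxE; congr (_ * _).
  by apply: eq_bigr => k _; rewrite !mxE.
rewrite PE (bigD1 i) //= big1 => [|j /negPf ji]; last by rewrite colE ji scale0r mul0mx.
rewrite colE eqxx scale1r addr0 vE linearZ /= -scalemxAl -scalemxAr scalerA.
by rewrite -expr2 sqrr_sign scale1r.
Qed.

Lemma measurable_eigenprojection q (M : T -> 'M[R]_q.+1) i : measurable_mx M ->
  (forall w, (M w)^T = M w) -> measurable_mx (fun w => eigenprojection (M w) i).
Proof.
move=> mM sM; have ml k := measurable_eigval k mM sM.
rewrite /eigenprojection; elim: (index_enum _) => [|k r IHr].
  by under eq_fun do rewrite big_nil; exact: measurable_cst_mx.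
under eq_fun do rewrite big_cons; case: (k != i) => //.
apply: measurable_mulmx => // a b; under eq_fun do rewrite !mxE.
apply: measurable_funM.
  by apply: measurable_inv; apply: measurable_funB.
apply: measurable_funB; first exact: mM.
rewrite (_ : (fun w => _) = fun w => eigval (M w) k * (a == b)%:R).
  exact: measurable_funM.
by apply/funext => w; rewrite mulr_natr.
Qed.

(** The unit vector with positive first nonzero coordinate spanning the range of
    a rank-one projection [E]. *)
Definition first_pos_vector p (E : 'M[R]_p) (j : 'I_p) : R :=
  \sum_s (E s s != 0)%:R * (\prod_(l < p | (l < s)%N) (E l l == 0)%:R) *
    E j s / Num.sqrt (E s s).

Lemma first_pos_vectorE p (v : 'cV[R]_p) j : first_nz_pos v ->
  first_pos_vector (v *m v^T) j = v j 0.
Proof.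
case=> s vs vmin; have E a b : (v *m v^T) a b = v a 0 * v b 0.
  by rewrite mxE big_ord1 !mxE.
move: (v *m v^T) E => N E.
rewrite /first_pos_vector (bigD1 s) //= [X in _ + X]big1 => [|k ks].
  rewrite !E mulf_neq0 ?gt_eqF // mul1r big1 => [|l ls]; last by rewrite E vmin // mul0r eqxx.
  by rewrite mul1r -expr2 sqrtr_sqr ger0_norm ?ltW // mulfK ?addr0 // gt_eqF.
have [k_s|s_k|/val_inj k_s] := ltngtP k s; last by rewrite k_s eqxx in ks.
  by rewrite E vmin // mul0r eqxx !mul0r.
have N0 : (N s s == 0)%:R = 0 :> R by rewrite E mulf_eq0 orbb gt_eqF.
by rewrite (bigD1 s) //= N0 mul0r mulr0 !mul0r.
Qed.

Lemma measurable_first_pos_vector p (E : T -> 'M[R]_p) j : measurable_mx E ->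
  measurable_fun [set: T] (fun w => first_pos_vector (E w) j).
Proof.
move=> mE.
have m0 s : measurable_fun [set: T] (fun w => E w s s == 0).
  by apply: measurable_fun_eqr => //; exact: mE.
apply: measurable_sum => s; apply: measurable_funM; last first.
  by apply/measurable_inv/measurable_sqrt/mE.
apply: measurable_funM; last exact: mE.
apply: measurable_funM.
  by apply: measurable_natr; apply: measurable_neg.
by apply: measurable_prod_cond => l _; apply: measurable_natr.
Qed.

(** Away from repeated eigenvalues the eigenvector is recovered from its
    eigenprojection, which depends measurably on the matrix. *)
Lemma measurable_eigvec q (M : T -> 'M[R]_q.+1) i : measurable_mx M ->
  (forall w, (M w)^T = M w) ->
  exists2 g : T -> 'cV[R]_q.+1, measurable_mx g &
    forall w, injective (eigval (M w)) -> eigvec (M w) i = g w.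
Proof.
move=> mM sM; exists (fun w => \col_j first_pos_vector (eigenprojection (M w) i) j).
  move=> j k; under eq_fun do rewrite mxE; apply: measurable_first_pos_vector.
  exact: measurable_eigenprojection.
move=> w injM; apply/matrixP => j k; rewrite ord1 mxE eigenprojectionE //.
by rewrite first_pos_vectorE //; case: (eigvecP i (sM w)).
Qed.

End MeasurableMatrices.

(** * Perturbation of well separated spectra *)

Lemma ler_norm_sub (R : realDomainType) (a b c : R) :
  a <= b + c -> b <= a + c -> `|a - b| <= c.
Proof. by move=> ab ba; rewrite ler_norml; apply/andP; split; lra. Qed.

Section DotProduct.
Context {R : realType} (p : nat).
Implicit Types (x y z : 'cV[R]_p) (a : R).

Lemma dotvZl a x y : dotv (a *: x) y = a * dotv x y.
Proof. by rewrite !dotvE mulr_sumr; apply: eq_bigr => i _; rewrite mxE mulrA. Qed.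

Lemma dotvZr a x y : dotv x (a *: y) = a * dotv x y.
Proof. by rewrite dotvC dotvZl dotvC. Qed.

Lemma dotvNr x y : dotv x (- y) = - dotv x y.
Proof. by rewrite -scaleN1r dotvZr mulN1r. Qed.

Lemma dotv_delta (j : 'I_p) y : dotv (delta_mx j 0) y = y j 0.
Proof.
rewrite dotvE (bigD1 j) //= big1 => [|k /negPf kj]; rewrite !mxE ?kj ?mul0r //.
by rewrite !eqxx mul1r addr0.
Qed.

Lemma dotvBr x y z : dotv x (y - z) = dotv x y - dotv x z.
Proof. by rewrite /dotv mulmxBr !mxE. Qed.

End DotProduct.

Section AsymptoticVariance.
Context {R : realType} (p : nat).
Implicit Types (lam : 'I_p -> R) (v : 'I_p -> 'cV[R]_p) (G : 'M[R]_(p * p)).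

(** The coefficient of the [k]-th direction in the expansion of the [i]-th
    eigenvector. *)
Definition direction_coef lam (i k : 'I_p) : R :=
  Num.sqrt (lam i * lam k) / (lam i - lam k).

Lemma qform_sum (J : finType) (Q : pred J) (M : J -> 'M[R]_p) c :
  qform (\sum_(j | Q j) M j) c = \sum_(j | Q j) qform (M j) c.
Proof.
apply: (big_morph (fun N => qform N c)) => [N N'|]; first exact: qformD.
by rewrite /qform mulmx0 mul0mx mxE.
Qed.

Lemma qform_Delta lam v G i c : (forall k, 0 <= lam k) ->
  qform (Delta_of lam v G i) c = \sum_(k | k != i) \sum_(l | l != i)
    direction_coef lam i k * direction_coef lam i l * G (vidx i k) (vidx i l) *
    (dotv c (v k) * dotv c (v l)).
Proof.
move=> lam0; rewrite qform_sum; apply: eq_bigr => k _.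
rewrite qform_sum; apply: eq_bigr => l _.
rewrite {1}/qform -scalemxAr -scalemxAl mxE mulmxA.
have -> : (c^T *m v k *m (v l)^T *m c) 0 0 = dotv c (v k) * dotv c (v l).
  by rewrite -mulmxA mxE big_ord1 -/(dotv _ _) -/(dotv (v l) c) (dotvC (v l)).
congr (_ * _); rewrite /direction_coef !sqrtrM // invfM.
have {1}-> : lam i = Num.sqrt (lam i) * Num.sqrt (lam i) by rewrite -expr2 sqr_sqrtr.
by ring.
Qed.

End AsymptoticVariance.

Section AsymptoticCalculus.
Context {R : realType} (I : Type) (F : set_system I) {FF : Filter F}.
Implicit Types f g h : I -> R.

(** Closeness is stated between two varying quantities: neither side need
    converge along the filter. *)
Definition asym f g := forall e : R, 0 < e -> \forall w \near F, `|f w - g w| <= e.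

Definition ebounded f := exists C : R, \forall w \near F, `|f w| <= C.

Lemma asym_cvg f (l : R) : f w @[w --> F] --> l -> asym f (fun=> l).
Proof. by move=> /cvgrPdist_le fl e /fl; apply: filterS => w; rewrite distrC. Qed.

Lemma asym_near f f' g g' : (\forall w \near F, f w = f' w) ->
  (\forall w \near F, g w = g' w) -> asym f' g' -> asym f g.
Proof.
by move=> ff gg fg e /fg; apply: filterS3 ff gg => w -> ->.
Qed.

Lemma asym_ext f f' g g' : f =1 f' -> g =1 g' -> asym f' g' -> asym f g.
Proof. by move=> ff gg; apply: asym_near; apply: filterE. Qed.

Lemma near_asym f g : (\forall w \near F, f w = g w) -> asym f g.
Proof.
by move=> fg e e0; apply: filterS fg => w ->; rewrite subrr normr0 ltW.
Qed.

Lemma asym_refl f : asym f f.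
Proof. by apply: near_asym; apply: filterE. Qed.

Lemma asym_sym f g : asym f g -> asym g f.
Proof. by move=> fg e /fg; apply: filterS => w; rewrite distrC. Qed.

Lemma near_ebounded f g : (\forall w \near F, f w = g w) -> ebounded g -> ebounded f.
Proof.
by move=> fg [C gC]; exists C; apply: filterS2 fg gC => w ->.
Qed.

Lemma ebounded_cst (c : R) : ebounded (fun=> c).
Proof. by exists `|c|; apply: filterE. Qed.

Lemma eboundedD f g : ebounded f -> ebounded g -> ebounded (fun w => f w + g w).
Proof.
move=> [C fC] [D gD]; exists (C + D); apply: filterS2 fC gD => w fC gD.
by apply: le_trans (ler_normD _ _) _; apply: lerD.
Qed.

Lemma eboundedM f g : ebounded f -> ebounded g -> ebounded (fun w => f w * g w).
Proof.
move=> [C fC] [D gD]; exists (C * D); apply: filterS2 fC gD => w fC gD.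
by rewrite normrM ler_pM.
Qed.

Lemma eboundedN f : ebounded f -> ebounded (fun w => - f w).
Proof. by move=> [C fC]; exists C; apply: filterS fC => w; rewrite normrN. Qed.

Lemma eboundedV f (c : R) : 0 < c -> (\forall w \near F, c <= `|f w|) ->
  ebounded (fun w => (f w)^-1).
Proof.
move=> c0 cf; exists c^-1; apply: filterS cf => w cf.
by rewrite normfV lef_pV2 // posrE (lt_le_trans c0).
Qed.

Lemma ebounded_sum (J : finType) (Q : pred J) (f : J -> I -> R) :
  (forall j, Q j -> ebounded (f j)) -> ebounded (fun w => \sum_(j | Q j) f j w).
Proof.
move=> bf; elim: (index_enum _) => [|j r IHr].
  apply: near_ebounded (ebounded_cst 0); apply: filterE => w.
  by rewrite big_nil.
have [Qj|Qj] := boolP (Q j); last first.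
  by apply: near_ebounded IHr; apply: filterE => w; rewrite big_cons (negPf Qj).
apply: near_ebounded (eboundedD (bf j Qj) IHr); apply: filterE => w.
by rewrite big_cons Qj.
Qed.

Lemma asym_ebounded f g : asym f g -> ebounded g -> ebounded f.
Proof.
move=> /(_ 1 ltr01) fg [C gC]; exists (1 + C); apply: filterS2 fg gC => w fg gC.
by rewrite -[f w](subrK (g w)); apply: le_trans (ler_normD _ _) _; apply: lerD.
Qed.

Lemma asymD f f' g g' : asym f f' -> asym g g' ->
  asym (fun w => f w + g w) (fun w => f' w + g' w).
Proof.
move=> ff gg e e0; have e2 : 0 < e / 2 by rewrite divr_gt0.
apply: filterS2 (ff _ e2) (gg _ e2) => w fw gw.
by rewrite (splitr e) opprD addrACA; apply: le_trans (ler_normD _ _) _; apply: lerD.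
Qed.

Lemma asymN f f' : asym f f' -> asym (fun w => - f w) (fun w => - f' w).
Proof.
by move=> ff e /ff; apply: filterS => w; rewrite -opprD normrN.
Qed.

Lemma asymB f f' g g' : asym f f' -> asym g g' ->
  asym (fun w => f w - g w) (fun w => f' w - g' w).
Proof. by move=> ff gg; apply: asymD => //; apply: asymN. Qed.

Lemma asym_sum (J : finType) (Q : pred J) (f g : J -> I -> R) :
  (forall j, Q j -> asym (f j) (g j)) ->
  asym (fun w => \sum_(j | Q j) f j w) (fun w => \sum_(j | Q j) g j w).
Proof.
move=> fg; elim: (index_enum _) => [|j r IHr].
  by apply: near_asym; apply: filterE => w; rewrite !big_nil.
have [Qj|Qj] := boolP (Q j); last first.
  by apply: asym_ext IHr => w; rewrite big_cons (negPf Qj).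
by apply: asym_ext (asymD (fg j Qj) IHr) => w; rewrite big_cons Qj.
Qed.

Lemma asym_sum0 (J : finType) (Q : pred J) (f : J -> I -> R) :
  (forall j, Q j -> asym (f j) (fun=> 0)) -> asym (fun w => \sum_(j | Q j) f j w) (fun=> 0).
Proof. by move=> f0; apply: asym_ext (asym_sum f0) => // w; rewrite big1. Qed.

Lemma asym0M f g : asym f (fun=> 0) -> ebounded g -> asym (fun w => f w * g w) (fun=> 0).
Proof.
move=> f0 [C gC] e e0.
pose D := `|C| + 1; have D0 : 0 < D by rewrite ltr_wpDl.
have eD : 0 < e / D by rewrite divr_gt0.
apply: filterS2 (f0 _ eD) gC => w; rewrite !subr0 normrM => fe gC'.
have -> : e = e / D * D by rewrite divfK // gt_eqF.
apply: ler_pM => //; apply: le_trans gC' _; apply: le_trans (ler_norm _) _.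
by rewrite lerDl.
Qed.

Lemma asym_sub0 f g : asym f g -> asym (fun w => f w - g w) (fun=> 0).
Proof. by move=> fg e /fg; apply: filterS => w; rewrite subr0. Qed.

Lemma sub0_asym f g : asym (fun w => f w - g w) (fun=> 0) -> asym f g.
Proof. by move=> fg e /fg; apply: filterS => w; rewrite subr0. Qed.

Lemma asymM f f' g g' : ebounded f' -> ebounded g' -> asym f f' -> asym g g' ->
  asym (fun w => f w * g w) (fun w => f' w * g' w).
Proof.
move=> bf bg ff gg; have bg2 := asym_ebounded gg bg.
have h1 : asym (fun w => (f w - f' w) * g w) (fun=> 0).
  by apply: asym0M => //; exact: asym_sub0.
have h2 : asym (fun w => (g w - g' w) * f' w) (fun=> 0).
  by apply: asym0M => //; exact: asym_sub0.
apply: sub0_asym; apply: asym_ext (asymD h1 h2) => w; last by rewrite addr0.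
by ring.
Qed.

Lemma asym_norm_ge f g (c : R) : 0 < c -> (\forall w \near F, c <= `|g w|) -> asym f g ->
  \forall w \near F, c / 2 <= `|f w|.
Proof.
move=> c0 cg fg; have c2 : 0 < c / 2 by rewrite divr_gt0.
apply: filterS2 cg (fg _ c2) => w cg fgw.
have := ler_distD (f w) (g w) 0; rewrite !subr0 => gfw.
have : `|g w| <= c / 2 + `|f w| by apply: le_trans gfw _; rewrite lerD2r distrC.
by move: `|g w| `|f w| cg => a b; clear; lra.
Qed.

Lemma asymV f g (c : R) : 0 < c -> (\forall w \near F, c <= `|g w|) -> asym f g ->
  asym (fun w => (f w)^-1) (fun w => (g w)^-1).
Proof.
move=> c0 cg fg.
have c2 : 0 < c / 2 by rewrite divr_gt0.
have cf := asym_norm_ge c0 cg fg.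
have bf := eboundedV c2 cf; have bg := eboundedV c0 cg.
have gf0 : asym (fun w => g w - f w) (fun=> 0) by apply/asym_sub0/asym_sym.
apply: sub0_asym; apply: asym_near (asym0M gf0 (eboundedM bf bg)); last exact: filterE.
apply: filterS2 cf cg => w cf cg.
have f0 : f w != 0 by rewrite -normr_gt0 (lt_le_trans c2).
have g0 : g w != 0 by rewrite -normr_gt0 (lt_le_trans c0).
by field; rewrite f0 g0.
Qed.

Lemma asym_sqrt f g : asym f g ->
  asym (fun w => Num.sqrt (f w)) (fun w => Num.sqrt (g w)).
Proof.
move=> fg e e0; have e20 : 0 < e ^+ 2 by rewrite exprn_gt0.
apply: filterS (fg _ e20) => w; move: (f w) (g w) => {fg f g w}.
have key (a b : R) : a - b <= e ^+ 2 -> Num.sqrt a - Num.sqrt b <= e.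
  move=> ab; rewrite lerBlDr -[leRHS]ger0_norm ?addr_ge0 ?sqrtr_ge0 ?(ltW e0) //.
  rewrite -sqrtr_sqr; have [a0|a0] := leP a 0; first by rewrite ler0_sqrtr ?sqrtr_ge0.
  rewrite ler_sqrt ?sqr_ge0 //; have [b0|b0] := leP b 0.
    rewrite (ler0_sqrtr b0) addr0; apply: le_trans ab.
    by rewrite lerDl oppr_ge0.
  rewrite sqrrD; apply: (@le_trans _ _ (e ^+ 2 + b)); first by rewrite -lerBlDr.
  by rewrite sqr_sqrtr ?(ltW b0) // addrAC lerDl mulrn_wge0 // mulr_ge0 ?sqrtr_ge0 // ltW.
move=> a b ab; rewrite ler_norml; apply/andP; split.
  rewrite lerNl opprB; apply: key; rewrite -opprB; move: ab.
  by rewrite ler_norml => /andP[+ _]; rewrite lerNl.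
by apply: key; apply: le_trans ab; apply: ler_norm.
Qed.

End AsymptoticCalculus.

Section Perturbation.
Context {R : realType} (I : Type) (F : set_system I) {FF : Filter F} (p : nat).
Context (ell : I -> 'rV[R]_p) (V W A B : I -> 'M[R]_p) (r : I -> R) (M eta : R).

Definition perturbed (w : I) := [/\ (V w)^T *m V w = 1%:M,
  A w = V w *m diag_mx (\row_k ell w 0 k ^+ 2) *m (V w)^T,
  B w = V w *m diag_mx (ell w) *m (1%:M + W w) *m diag_mx (ell w) *m (V w)^T &
  (W w)^T = W w].

(** Only ratios are controlled: the scale of the singular values is free. *)
Definition well_separated (w : I) := [/\ forall k, 0 < ell w 0 k,
  forall j k, ell w 0 j <= M * ell w 0 k &
  forall j k : 'I_p, (j < k)%N -> (1 + eta) * ell w 0 k <= ell w 0 j].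

Hypotheses (eta_gt0 : 0 < eta)
  (near_model : \forall w \near F, perturbed w)
  (near_separated : \forall w \near F, well_separated w)
  (r_gt0 : \forall w \near F, 0 < r w)
  (r_oo : asym F (fun w => (r w)^-1) (fun=> 0))
  (rW_bounded : forall j k, ebounded F (fun w => r w * W w j k)).

Let rho j k w : R := ell w 0 j / ell w 0 k.

Definition relval j w : R := eigval (B w) j / ell w 0 j ^+ 2.

Definition relgap i k w : R := ell w 0 i / ell w 0 k - ell w 0 k / ell w 0 i.

Lemma W_small j k : asym F (fun w => W w j k) (fun=> 0).
Proof.
apply: asym_near (asym0M r_oo (rW_bounded j k)); last exact: filterE.
by apply: filterS r_gt0 => w r0; rewrite mulrA mulVf ?mul1r // gt_eqF.
Qed.

Lemma rho_bounded j k : ebounded F (rho j k).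
Proof.
exists M; apply: filterS near_separated => w [l0 lM _].
by rewrite /rho ger0_norm ?divr_ge0 ?(ltW (l0 _)) // ler_pdivrMr.
Qed.

Lemma separated_nonincreasing w : well_separated w -> nonincreasing (ell w).
Proof.
move=> [l0 _ gap] i j; rewrite leq_eqVlt => /orP[/eqP /val_inj -> //|ij].
apply: le_trans (gap _ _ ij); by rewrite ler_peMl ?(ltW (l0 _)) // lerDl ltW.
Qed.

Lemma spectral_A w : perturbed w -> well_separated w ->
  is_spectral (A w) (V w) (\row_k ell w 0 k ^+ 2).
Proof.
move=> [VV AE _ _] sep; have [l0 _ _] := sep; split=> // i j ij; rewrite !mxE.
by rewrite ler_sqr ?nnegrE ?(ltW (l0 _)) //; exact: separated_nonincreasing sep _ _ ij.
Qed.

Lemma eigval_A j w : perturbed w -> well_separated w -> eigval (A w) j = ell w 0 j ^+ 2.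
Proof. by move=> pw sw; rewrite (eigvalE _ (spectral_A pw sw)) mxE. Qed.

Lemma symmetric_B w : perturbed w -> (B w)^T = B w.
Proof.
move=> [_ _ -> sW]; rewrite !trmx_mul trmxK tr_diag_mx linearD /= trmx1 sW.
by rewrite !mulmxA.
Qed.

Lemma diag_mx_sqr (l : 'rV[R]_p) : diag_mx l *m diag_mx l = diag_mx (\row_k l 0 k ^+ 2).
Proof.
apply/matrixP => a b; rewrite mul_diag_mx !mxE.
by case: eqP => [->|]; rewrite ?mulr0 // !mulr1n expr2.
Qed.

Lemma qform_diff w x : perturbed w ->
  qform (B w) x - qform (A w) x = qform (W w) (diag_mx (ell w) *m (V w)^T *m x).
Proof.
move=> [_ AE BE _].
have -> : B w = A w + V w *m diag_mx (ell w) *m W w *m diag_mx (ell w) *m (V w)^T.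
  rewrite AE BE mulmxDr !mulmxDl mulmx1; congr (_ *m _ + _).
  by rewrite -mulmxA diag_mx_sqr.
by rewrite qformD addrC addKr /qform !trmx_mul trmxK tr_diag_mx !mulmxA.
Qed.

(** Weyl's inequality: the quadratic forms of [A] and [B] differ by that of [W] on
    a vector of length comparable with the [j]-th singular value. *)
Lemma relval_asym j : asym F (relval j) (fun=> 1).
Proof.
move=> e e0; pose C := p.+1%:R * (M ^+ 2 + 1).
have C0 : 0 < C by rewrite mulr_gt0 // ltr_wpDl // sqr_ge0.
have eC : 0 < e / C by rewrite divr_gt0.
have Wall : \forall w \near F, forall a b, `|W w a b| <= e / C.
  have : \forall w \near F, forall ab : 'I_p * 'I_p, `|W w ab.1 ab.2| <= e / C.
    apply: filter_forall => -[a b]; have := W_small a b eC.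
    by apply: filterS => w; rewrite subr0.
  by apply: filterS => w Wab a b; exact: (Wab (a, b)).
apply: filterS3 near_model near_separated Wall => w pw sw Ww.
have [l0 lM _] := sw; have lj0 : 0 < ell w 0 j ^+ 2 by rewrite exprn_gt0.
have diff x : `|qform (B w) x - qform (A w) x| <= e * ell w 0 j ^+ 2 * dotv x x.
  rewrite qform_diff //; apply: le_trans (qform_entries _ (ltW eC) Ww) _.
  have [VV _ _ _] := pw; have VV' := mulmx1C VV.
  have len : dotv (diag_mx (ell w) *m (V w)^T *m x) (diag_mx (ell w) *m (V w)^T *m x)
      <= (M * ell w 0 j) ^+ 2 * dotv x x.
    rewrite -(dotv_orthogonal x x VV) -mulmxA; move: ((V w)^T *m x) => y.
    rewrite !dotvE mulr_sumr; apply: ler_sum => k _; rewrite mul_diag_mx !mxE.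
    have -> : ell w 0 k * y k 0 * (ell w 0 k * y k 0) = ell w 0 k ^+ 2 * (y k 0 ^+ 2) by ring.
    rewrite -expr2 ler_wpM2r ?sqr_ge0 // ler_sqr ?nnegrE ?lM // ltW //.
    exact: lt_le_trans (lM k j).
  apply: le_trans (ler_wpM2l _ len) _; first by rewrite mulr_ge0 ?(ltW eC).
  rewrite [leLHS](_ : _ = e * ell w 0 j ^+ 2 * dotv x x * (p%:R * M ^+ 2 / C)); last first.
    by field; rewrite gt_eqF.
  apply: ler_piMr; first by rewrite mulr_ge0 ?dotvv_ge0 // mulr_ge0 ?sqr_ge0 // ltW.
  by rewrite ler_pdivrMr // mul1r /C ler_pM ?sqr_ge0 ?ler_nat // lerDl.
have [sA sB] : (A w)^T = A w /\ (B w)^T = B w.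
  split; last exact: symmetric_B.
  by have [_ -> _ _] := pw; rewrite !trmx_mul trmxK tr_diag_mx mulmxA.
have le1 : eigval (B w) j <= eigval (A w) j + e * ell w 0 j ^+ 2.
  apply: weyl => // x; have := diff x; rewrite ler_norml => /andP[_].
  by rewrite lerBlDl.
have le2 : eigval (A w) j <= eigval (B w) j + e * ell w 0 j ^+ 2.
  apply: weyl => // x; have := diff x; rewrite distrC ler_norml => /andP[_].
  by rewrite lerBlDl.
rewrite eigval_A // in le1 le2.
have -> : relval j w - 1 = (eigval (B w) j - ell w 0 j ^+ 2) / ell w 0 j ^+ 2.
  by rewrite mulrBl divff // gt_eqF.
rewrite normrM normfV [X in _ / X]ger0_norm ?(ltW lj0) // ler_pdivrMr //.
exact: ler_norm_sub.
Qed.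

Lemma relgap_ge i k w : k != i -> well_separated w -> eta / (1 + eta) <= `|relgap i k w|.
Proof.
have pos (x : R) : 1 + eta <= x -> eta / (1 + eta) <= x - x^-1.
  move=> x1; have x0 : 0 < x by apply: lt_le_trans x1; rewrite ltr_wpDl.
  have -> : eta / (1 + eta) = 1 - (1 + eta)^-1.
    by field; rewrite gt_eqF // ltr_wpDl.
  apply: lerB; first by apply: le_trans x1; rewrite lerDl ltW.
  by rewrite lef_pV2 ?posrE // ltr_wpDl.
move=> ki [l0 _ gap]; rewrite /relgap.
have [ki'|ik|/val_inj/eqP] := ltngtP k i; last by rewrite (negPf ki).
  rewrite distrC; apply: le_trans (ler_norm _).
  by rewrite -[X in _ - X]invf_div; apply: pos; rewrite ler_pdivlMr // gap.
apply: le_trans (ler_norm _).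
by rewrite -[X in _ - X]invf_div; apply: pos; rewrite ler_pdivlMr // gap.
Qed.

Let gap0 : 0 < eta / (1 + eta).
Proof. by rewrite divr_gt0 // ltr_wpDl. Qed.

Lemma relgapV_bounded i k : k != i -> ebounded F (fun w => (relgap i k w)^-1).
Proof.
by move=> ki; apply: eboundedV gap0 _; apply: filterS near_separated => w; exact: relgap_ge.
Qed.

Lemma relval_gap_asym i k :
  asym F (fun w => relval i w * rho i k w - relval k w * rho k i w) (relgap i k).
Proof.
have b1 : ebounded F (fun=> 1 : R) by exact: ebounded_cst.
apply: asym_ext (asymB (asymM b1 (rho_bounded i k) (relval_asym i) (asym_refl _))
  (asymM b1 (rho_bounded k i) (relval_asym k) (asym_refl _))) => w //.
by rewrite !mul1r.
Qed.

(** In this section [u] gives the coordinates, in the basis [V], of a unit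
    eigenvector of [B]. *)
Section Eigenvector.
Context (i : 'I_p) (u : I -> 'cV[R]_p).
Hypothesis near_u : \forall w \near F, [/\
  B w *m (V w *m u w) = eigval (B w) i *: (V w *m u w),
  dotv (u w) (u w) = 1 & 0 <= u w i 0].

Let D k w := relval i w * rho i k w - rho k i w.
Let S k w := \sum_l r w * W w k l * rho l i w * u w l 0.

(** The [k]-th coordinate of the eigenvector equation, divided by the [i]-th and
    [k]-th singular values so that all coefficients stay bounded. For [k] other
    than [i] the factor [D k] is bounded away from zero, so [u] is within [1 / r]
    of the [i]-th basis vector. *)
Lemma eigvec_equation k : \forall w \near F, D k w * (r w * u w k 0) = S k w.
Proof.
apply: filterS3 near_model near_separated near_u => w [VV AE BE _] [l0 _ _] [Bu _ _].
have l0' j : ell w 0 j != 0 by rewrite gt_eqF.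
move: Bu; rewrite /D /relval; set lam := eigval (B w) i.
move=> /(congr1 (fun x => ((V w)^T *m x) k 0)).
rewrite BE /= !mulmxA VV mul1mx -(mulmxA _ (V w)^T) VV mulmx1.
rewrite -scalemxAr mulmxA VV mul1mx mulmxDr mulmx1 !mulmxDl mxE [X in _ + X]mxE [RHS]mxE.
have -> : (diag_mx (ell w) *m diag_mx (ell w) *m u w) k 0 = ell w 0 k ^+ 2 * u w k 0.
  by rewrite mulmx_diag mul_diag_mx !mxE expr2.
have -> : \sum_j (diag_mx (ell w) *m W w *m diag_mx (ell w)) k j * u w j 0 =
    \sum_j ell w 0 k * W w k j * ell w 0 j * u w j 0.
  by apply: eq_bigr => j _; rewrite mul_mx_diag mxE mul_diag_mx mxE.
move=> E.
have -> : S k w = r w / (ell w 0 k * ell w 0 i) *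
    \sum_j ell w 0 k * W w k j * ell w 0 j * u w j 0.
  rewrite mulr_sumr; apply: eq_bigr => j _; rewrite /rho; field.
  by rewrite !l0'.
have -> : \sum_j ell w 0 k * W w k j * ell w 0 j * u w j 0 =
    (lam - ell w 0 k ^+ 2) * u w k 0.
  by rewrite mulrBl -E [X in X - _]addrC addrK.
by rewrite /rho; field; rewrite !l0'.
Qed.

Lemma u_bounded k : ebounded F (fun w => u w k 0).
Proof.
exists 1; apply: filterS near_u => w [_ u1 _].
have := le_coord_dotvv (u w) k; rewrite u1 => uk.
by rewrite -ler_sqr ?nnegrE // expr1n real_normK ?num_real.
Qed.

Let D_asym k : asym F (D k) (relgap i k).
Proof.
have b1 : ebounded F (fun=> 1 : R) by exact: ebounded_cst.
apply: asymB; last exact: asym_refl.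
apply: asym_ext (asymM b1 (rho_bounded i k) (relval_asym i) (asym_refl _)) => w //.
by rewrite mul1r.
Qed.

Let relgap_near k : k != i -> \forall w \near F, eta / (1 + eta) <= `|relgap i k w|.
Proof. by move=> ki; apply: filterS near_separated => w; exact: relgap_ge. Qed.

Let D_neq0 k : k != i -> \forall w \near F, D k w != 0.
Proof.
move=> ki; apply: filterS (asym_norm_ge gap0 (relgap_near ki) (D_asym k)) => w.
by rewrite -normr_gt0; apply: lt_le_trans; rewrite divr_gt0.
Qed.

Let DV_asym k : k != i -> asym F (fun w => (D k w)^-1) (fun w => (relgap i k w)^-1).
Proof. by move=> ki; apply: asymV gap0 (relgap_near ki) (D_asym k). Qed.

Let S_bounded k : ebounded F (S k).
Proof.
apply: ebounded_sum => l _; apply: eboundedM (u_bounded l).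
by apply: eboundedM (rW_bounded k l) (rho_bounded l i).
Qed.

Let ruE k : k != i -> \forall w \near F, r w * u w k 0 = (D k w)^-1 * S k w.
Proof.
move=> ki; apply: filterS2 (D_neq0 ki) (eigvec_equation k) => w D0 <-.
by rewrite mulKf.
Qed.

Let ru_bounded k : k != i -> ebounded F (fun w => r w * u w k 0).
Proof.
move=> ki; apply: near_ebounded (ruE ki) _; apply: eboundedM (S_bounded k).
exact: asym_ebounded (DV_asym ki) (relgapV_bounded ki).
Qed.

Lemma u_off k : k != i -> asym F (fun w => u w k 0) (fun=> 0).
Proof.
move=> ki; apply: asym_near (asym0M r_oo (ru_bounded ki)); last exact: filterE.
by apply: filterS r_gt0 => w r0; rewrite mulrA mulVf ?mul1r // gt_eqF.
Qed.

Let uiE : \forall w \near F, 1 - u w i 0 ^+ 2 = \sum_(k | k != i) u w k 0 * u w k 0.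
Proof.
by apply: filterS near_u => w [_ <- _]; rewrite dotvE (bigD1 i) //= expr2 [X in X - _]addrC addrK.
Qed.

Lemma u_diag : asym F (fun w => u w i 0) (fun=> 1).
Proof.
have sum0 : asym F (fun w => \sum_(k | k != i) u w k 0 * u w k 0) (fun=> 0).
  by apply: asym_sum0 => k ki; exact: asym0M (u_off ki) (u_bounded k).
apply: asym_near (asym_sqrt (asymB (asym_refl (fun=> 1 : R)) sum0)); last first.
  by apply: filterE => w; rewrite subr0 sqrtr1.
apply: filterS2 near_u uiE => w [_ _ u0] <-.
by rewrite opprB addrC subrK sqrtr_sqr ger0_norm.
Qed.

Let S_asym k : asym F (S k) (fun w => r w * W w k i).
Proof.
have term l : asym F (fun w => r w * W w k l * rho l i w * u w l 0)
    (fun w => r w * W w k l * rho l i w * (l == i)%:R).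
  apply: asymM (ebounded_cst _) (asym_refl _) _.
    exact: eboundedM (rW_bounded k l) (rho_bounded l i).
  by have [->|/u_off] := eqVneq l i; first exact: u_diag.
apply: asym_near (asym_sum (Q := xpredT) (fun l _ => term l)); first exact: filterE.
apply: filterS near_separated => w [l0 _ _].
rewrite (bigD1 i) //= big1 => [|l /negPf ->]; last by rewrite mulr0.
by rewrite eqxx mulr1 addr0 /rho divff ?mulr1 // gt_eqF.
Qed.

Lemma eigvec_asym k : k != i ->
  asym F (fun w => r w * u w k 0) (fun w => r w * W w i k / relgap i k w).
Proof.
move=> ki.
apply: asym_near (asymM (relgapV_bounded ki) (rW_bounded k i) (DV_asym ki) (S_asym k)).
  exact: ruE.
apply: filterS near_model => w [_ _ _ sW].
by rewrite mulrC -{1}sW mxE.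
Qed.

(** In the direction of the eigenvector itself the error is of second order, since
    [u] has unit length. *)
Lemma eigvec_asym_diag : asym F (fun w => r w * (u w i 0 - 1)) (fun=> 0).
Proof.
have sum0 : asym F (fun w => \sum_(k | k != i) u w k 0 * (r w * u w k 0)) (fun=> 0).
  by apply: asym_sum0 => k ki; exact: asym0M (u_off ki) (ru_bounded ki).
have inv : ebounded F (fun w => - (1 + u w i 0)^-1).
  apply: eboundedN; apply: (eboundedV ltr01); apply: filterS near_u => w [_ _ u0].
  by apply: le_trans (ler_norm _); rewrite lerDl.
apply: asym_near (asym0M sum0 inv); last exact: filterE.
apply: filterS2 near_u uiE => w [_ _ u0] uE.
have -> : \sum_(k | k != i) u w k 0 * (r w * u w k 0) = r w * (1 - u w i 0 ^+ 2).
  by rewrite uE mulr_sumr; apply: eq_bigr => k _; rewrite mulrCA.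
by field; rewrite gt_eqF // ltr_wpDr.
Qed.

(** The eigenvector equation for [k = i]. *)
Lemma relval_expansion : asym F (fun w => r w * (relval i w - 1)) (fun w => r w * W w i i).
Proof.
have u1 : \forall w \near F, 1 <= `|1 : R| by apply: filterE => w; rewrite normr1.
have uV : asym F (fun w => (u w i 0)^-1) (fun=> 1).
  by apply: asym_ext (asymV ltr01 u1 u_diag) => w //; rewrite invr1.
apply: asym_near (asymM (rW_bounded i i) (ebounded_cst 1) (S_asym i) uV); last by apply: filterE => w; rewrite mulr1.
have un0 : \forall w \near F, u w i 0 != 0.
  apply: filterS (asym_norm_ge ltr01 u1 u_diag) => w h.
  by rewrite -normr_gt0 (lt_le_trans _ h).
apply: filterS3 un0 (eigvec_equation i) near_separated => w u0 <- [l0 _ _].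
by rewrite /D /rho divff ?gt_eqF //; field.
Qed.

Lemma eigval_asym : asym F
  (fun w => r w * ((eigval (B w) i)^-1 * (eigval (B w) i - eigval (A w) i)))
  (fun w => r w * W w i i).
Proof.
have u1 : \forall w \near F, 1 <= `|1 : R| by apply: filterE => w; rewrite normr1.
have tV : asym F (fun w => (relval i w)^-1) (fun=> 1).
  by apply: asym_ext (asymV ltr01 u1 (relval_asym i)) => w //; rewrite invr1.
apply: asym_near (asymM (rW_bounded i i) (ebounded_cst 1) relval_expansion tV); last by apply: filterE => w; rewrite mulr1.
have tn0 : \forall w \near F, relval i w != 0.
  apply: filterS (asym_norm_ge ltr01 u1 (relval_asym i)) => w h.
  by rewrite -normr_gt0 (lt_le_trans _ h).
apply: filterS3 near_model near_separated tn0 => w pw sw.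
rewrite eigval_A // /relval; have [l0 _ _] := sw => t0.
have b0 : eigval (B w) i != 0 by apply: contraNneq t0 => ->; rewrite mul0r.
by field; rewrite b0 gt_eqF.
Qed.

End Eigenvector.

Lemma near_eigval_gt0 j : \forall w \near F, 0 < eigval (B w) j.
Proof.
have half0 : (0 : R) < 1 / 2 by rewrite divr_gt0.
apply: filterS2 near_separated (relval_asym j half0) => w [l0 _ _].
rewrite ler_norml => /andP[h _].
have : 0 < relval j w by move: (relval j w) h => x h; lra.
by rewrite /relval pmulr_lgt0 // invr_gt0 exprn_gt0.
Qed.

Lemma near_eigval_inj : \forall w \near F, injective (eigval (B w)).
Proof.
have inj2 : \forall w \near F, forall jk : 'I_p * 'I_p,
    jk.2 != jk.1 -> eigval (B w) jk.1 != eigval (B w) jk.2.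
  apply: filter_forall => -[j k] /=; have [->|kj] := eqVneq k j.
    by apply: filterE.
  have gapw : \forall w \near F, eta / (1 + eta) <= `|relgap j k w|.
    by apply: filterS near_separated => w; exact: relgap_ge.
  apply: filterS2 near_separated (asym_norm_ge gap0 gapw (relval_gap_asym j k)) => w [l0 _ _].
  have g2 : 0 < eta / (1 + eta) / 2 by rewrite divr_gt0.
  move=> /(lt_le_trans g2); rewrite normr_gt0 => h _; apply: contraNneq h => E.
  rewrite /relval E /rho; apply/eqP; field.
  by rewrite !gt_eqF.
apply: filterS inj2 => w injw j k E; apply/eqP; apply: contraTT isT => jk.
by have := injw (j, k); rewrite eq_sym => /(_ jk); rewrite /= E eqxx.
Qed.

Lemma direction_coef_A i k w : k != i -> perturbed w -> well_separated w ->
  direction_coef (eigval (A w)) i k = (relgap i k w)^-1.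
Proof.
move=> ki pw sw; rewrite /direction_coef !eigval_A // -exprMn sqrtr_sqr.
have := lt_le_trans gap0 (relgap_ge ki sw); rewrite normr_gt0 => g0.
have [l0 _ _] := sw; rewrite ger0_norm ?mulr_ge0 ?(ltW (l0 _)) //.
have lk0 : ell w 0 k != 0 by rewrite gt_eqF.
have li0 : ell w 0 i != 0 by rewrite gt_eqF.
have E : relgap i k w = (ell w 0 i ^+ 2 - ell w 0 k ^+ 2) / (ell w 0 i * ell w 0 k).
  by rewrite /relgap; field; rewrite lk0 li0.
by rewrite E invf_div.
Qed.

Lemma direction_coef_asym i k : k != i ->
  asym F (fun w => direction_coef (eigval (B w)) i k) (fun w => (relgap i k w)^-1).
Proof.
move=> ki; have b1 : ebounded F (fun=> 1 : R) by exact: ebounded_cst.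
have gapw : \forall w \near F, eta / (1 + eta) <= `|relgap i k w|.
  by apply: filterS near_separated => w; exact: relgap_ge.
have dV : asym F (fun w => (relval i w * rho i k w - relval k w * rho k i w)^-1)
    (fun w => (relgap i k w)^-1) by exact: asymV gap0 gapw (relval_gap_asym i k).
have sq : asym F (fun w => Num.sqrt (relval i w * relval k w)) (fun=> 1).
  apply: asym_ext (asym_sqrt (asymM b1 b1 (relval_asym i) (relval_asym k))) => w //.
  by rewrite mulr1 sqrtr1.
apply: asym_near (asymM b1 (relgapV_bounded ki) sq dV); last first.
  by apply: filterE => w; rewrite mul1r.
have g2 : 0 < eta / (1 + eta) / 2 by rewrite divr_gt0.
apply: filterS3 near_separated (asym_norm_ge gap0 gapw (relval_gap_asym i k))
  (filterI (near_eigval_gt0 i) (near_eigval_gt0 k)) => w [l0 _ _].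
move=> /(lt_le_trans g2); rewrite normr_gt0 => D0 [/= bi0 bk0].
have lk0 : ell w 0 k != 0 by rewrite gt_eqF.
have li0 : ell w 0 i != 0 by rewrite gt_eqF.
have -> : relval i w * relval k w =
    eigval (B w) i * eigval (B w) k / (ell w 0 i * ell w 0 k) ^+ 2.
  by rewrite /relval; field; rewrite lk0 li0.
rewrite sqrtrM ?mulr_ge0 ?(ltW bi0) ?(ltW bk0) // sqrtrV ?sqr_ge0 // sqrtr_sqr.
rewrite ger0_norm ?mulr_ge0 ?(ltW (l0 _)) // /direction_coef.
have E : relval i w * rho i k w - relval k w * rho k i w =
    (eigval (B w) i - eigval (B w) k) / (ell w 0 i * ell w 0 k).
  by rewrite /relval /rho; field; rewrite lk0 li0.
have BD0 : eigval (B w) i - eigval (B w) k != 0.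
  by apply: contraNneq D0; rewrite E => ->; rewrite mul0r.
by rewrite E; field; rewrite lk0 li0 BD0.
Qed.

Lemma ell_sqr_inj w : well_separated w -> injective ((\row_k ell w 0 k ^+ 2) 0).
Proof.
move=> [l0 _ gap] a b; rewrite !mxE => /eqP.
rewrite eqrXn2 ?(ltW (l0 _)) // => /eqP lab; apply/eqP; apply: contraTT isT => ab.
have lt1 : 1 < 1 + eta by rewrite ltrDl.
have [ab'|ab'|/val_inj/eqP] := ltngtP a b; last by rewrite (negPf ab).
  by have := gap _ _ ab'; rewrite lab ger_pMl // leNgt lt1.
by have := gap _ _ ab'; rewrite lab ger_pMl // leNgt lt1.
Qed.

Lemma eigval_A_inj w : perturbed w -> well_separated w -> injective (eigval (A w)).
Proof.
move=> pw sw a b; rewrite !eigval_A // => ab; apply: (ell_sqr_inj sw).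
by rewrite !mxE.
Qed.

(** A sign, when the spectrum of [A] is simple. *)
Definition column_sign k w : R := dotv (eigvec (A w) k) (col k (V w)).

Lemma eigvec_A k w : perturbed w -> well_separated w ->
  eigvec (A w) k = column_sign k w *: col k (V w) /\ column_sign k w ^+ 2 = 1.
Proof.
move=> pw sw; have spA := spectral_A pw sw.
have injA := ell_sqr_inj sw.
have sA : (A w)^T = A w.
  by have [_ -> _ _] := pw; rewrite !trmx_mul trmxK tr_diag_mx mulmxA.
have [Av v1 _] := eigvecP k sA.
rewrite (eigvalE k spA) in Av.
have [b vE] := simple_eigvec spA injA Av v1.
have [_ q1] := is_spectral_col k spA.
have -> : column_sign k w = (-1) ^+ b.
  by rewrite /column_sign vE dotvZl q1 mulr1.
by rewrite sqrr_sign.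
Qed.

Lemma eigvec_towardP k w : perturbed w ->
  [/\ B w *m eigvec_toward (A w) (B w) k = eigval (B w) k *: eigvec_toward (A w) (B w) k,
      dotv (eigvec_toward (A w) (B w) k) (eigvec_toward (A w) (B w) k) = 1 &
      0 <= dotv (eigvec (A w) k) (eigvec_toward (A w) (B w) k)].
Proof.
move=> pw; have [Bv v1 _] := eigvecP k (symmetric_B pw).
rewrite /eigvec_toward; case: ifP => [d0|/negbT]; first by split.
rewrite -ltNge => d0; split; first by rewrite mulmxN Bv scalerN.
  by rewrite dotvNr dotvC dotvNr opprK.
by rewrite dotvNr oppr_ge0 ltW.
Qed.

Let u k w := column_sign k w *: ((V w)^T *m eigvec_toward (A w) (B w) k).

Let near_u k : \forall w \near F, [/\
  B w *m (V w *m u k w) = eigval (B w) k *: (V w *m u k w),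
  dotv (u k w) (u k w) = 1 & 0 <= u k w k 0].
Proof.
apply: filterS2 near_model near_separated => w pw sw.
have [Bv v1 v0] := eigvec_towardP k pw; have [vE s1] := eigvec_A k pw sw.
have [VV _ _ _] := pw; have VV' := mulmx1C VV.
have -> : V w *m u k w = column_sign k w *: eigvec_toward (A w) (B w) k.
  by rewrite /u -scalemxAr mulmxA VV' mul1mx.
split.
- by rewrite -scalemxAr Bv !scalerA mulrC.
- by rewrite /u dotvZl dotvZr mulrA -expr2 s1 mul1r dotv_orthogonal.
- move: v0; rewrite vE dotvZl /u mxE dotvE [((V w)^T *m _) k 0]mxE.
  by under eq_bigr do rewrite mxE; under [X in _ -> 0 <= _ * X]eq_bigr do rewrite mxE.
Qed.

Lemma eigval_error_asym i : asym F
  (fun w => r w * ((eigval (B w) i)^-1 * (eigval (B w) i - eigval (A w) i)))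
  (fun w => r w * W w i i).
Proof. exact: eigval_asym (near_u i). Qed.

Section Direction.
Context (c : 'cV[R]_p).
Hypothesis c1 : dotv c c = 1.

Let y k w := ((V w)^T *m c) k 0.

Let y_bounded k : ebounded F (y k).
Proof.
exists 1; apply: filterS near_model => w [VV _ _ _].
have := le_coord_dotvv ((V w)^T *m c) k; rewrite dotv_orthogonal // c1 => yk.
by rewrite -ler_sqr ?nnegrE // expr1n real_normK ?num_real.
Qed.

Let sign_bounded k : ebounded F (column_sign k).
Proof.
exists 1; apply: filterS2 near_model near_separated => w pw sw.
have [_ s1] := eigvec_A k pw sw.
by rewrite -ler_sqr ?nnegrE // expr1n real_normK ?num_real // s1.
Qed.

Lemma dotv_eigvec_A k w : perturbed w -> well_separated w ->
  dotv c (eigvec (A w) k) = column_sign k w * y k w.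
Proof.
move=> pw sw; have [{1}-> _] := eigvec_A k pw sw.
rewrite dotvZr /y; congr (_ * _); rewrite dotvE mxE.
by apply: eq_bigr => j _; rewrite !mxE mulrC.
Qed.

Let dotv_toward k : \forall w \near F, dotv c (eigvec_toward (A w) (B w) k) =
  \sum_j y j w * (column_sign k w * u k w j 0).
Proof.
apply: filterS2 near_model near_separated => w pw sw.
have [_ s1] := eigvec_A k pw sw; have [VV _ _ _] := pw.
rewrite -(dotv_orthogonal _ _ VV) dotvE; apply: eq_bigr => j _.
have -> : u k w j 0 = column_sign k w * ((V w)^T *m eigvec_toward (A w) (B w) k) j 0.
  by rewrite /u mxE.
by rewrite [column_sign k w * _]mulrA -expr2 s1 mul1r.
Qed.

Lemma dotv_eigvec_bounded k : ebounded F (fun w => dotv c (eigvec (A w) k)).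
Proof.
apply: near_ebounded (eboundedM (sign_bounded k) (y_bounded k)).
by apply: filterS2 near_model near_separated => w pw sw; exact: dotv_eigvec_A.
Qed.

Lemma dotv_toward_asym k : asym F (fun w => dotv c (eigvec_toward (A w) (B w) k))
  (fun w => dotv c (eigvec (A w) k)).
Proof.
have term j : asym F (fun w => y j w * (column_sign k w * u k w j 0))
    (fun w => y j w * (column_sign k w * (j == k)%:R)).
  apply: asymM (y_bounded j) _ (asym_refl _) _.
    exact: eboundedM (sign_bounded k) (ebounded_cst _).
  apply: asymM (sign_bounded k) (ebounded_cst _) (asym_refl _) _.
  have [->|jk] := eqVneq j k; first exact: u_diag (near_u k).
  exact: u_off (near_u k) _ jk.
apply: asym_near (asym_sum (Q := xpredT) (fun j _ => term j)); first exact: dotv_toward.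
apply: filterS2 near_model near_separated => w pw sw; rewrite dotv_eigvec_A //.
rewrite (bigD1 k) //= big1 => [|j /negPf ->]; last by rewrite !mulr0.
by rewrite eqxx mulr1 addr0 mulrC.
Qed.

Lemma eigvec_error_asym i : asym F
  (fun w => r w * dotv c (eigvec_toward (A w) (B w) i - eigvec (A w) i))
  (fun w => \sum_(k | k != i)
     column_sign i w * y k w * (relgap i k w)^-1 * (r w * W w i k)).
Proof.
pose e k w : R := u i w k 0 - (k == i)%:R.
have termk k : k != i -> asym F
    (fun w => column_sign i w * y k w * (r w * e k w))
    (fun w => column_sign i w * y k w * (relgap i k w)^-1 * (r w * W w i k)).
  move=> ki; apply: asym_ext (asymM (eboundedM (sign_bounded i) (y_bounded k))
    (eboundedM (rW_bounded i k) (relgapV_bounded ki)) (asym_refl _)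
    (eigvec_asym (near_u i) ki)) => w.
    by rewrite /e (negPf ki) subr0.
  by ring.
have termi : asym F (fun w => column_sign i w * y i w * (r w * e i w)) (fun=> 0).
  apply: asym_ext (asym0M (eigvec_asym_diag (near_u i))
    (eboundedM (sign_bounded i) (y_bounded i))) => w //.
  by rewrite /e eqxx mulrC.
apply: asym_near (asymD termi (asym_sum termk)); last first.
  by apply: filterE => w; rewrite add0r.
apply: filterS3 near_model near_separated (dotv_toward i) => w pw sw dt.
rewrite dotvBr dt dotv_eigvec_A //.
rewrite [X in _ - X](_ : _ = \sum_j y j w * (column_sign i w * (j == i)%:R)); last first.
  rewrite (bigD1 i) //= big1 => [|j /negPf ->]; last by rewrite !mulr0.
  by rewrite eqxx mulr1 addr0 mulrC.
rewrite -sumrB mulr_sumr (bigD1 i) //=; congr (_ + _).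
  by rewrite /e; ring.
by apply: eq_bigr => j _; rewrite /e; ring.
Qed.

Context (i : 'I_p) (G : I -> 'M[R]_(p * p)).
Hypothesis G_bounded : forall k l, ebounded F (fun w => G w (vidx i k) (vidx i l)).

Let Q w := qform (Delta_of (eigval (A w)) (eigvec (A w)) (G w) i) c.

Let eigval_A_ge0 w k : perturbed w -> well_separated w -> 0 <= eigval (A w) k.
Proof. by move=> pw sw; rewrite eigval_A // sqr_ge0. Qed.

Lemma Delta_asym : asym F
  (fun w => qform (Delta_of (eigval (B w)) (eigvec_toward (A w) (B w)) (G w) i) c) Q.
Proof.
have coefA k : k != i -> asym F (fun w => direction_coef (eigval (B w)) i k)
    (fun w => direction_coef (eigval (A w)) i k).
  move=> ki; apply: asym_near (direction_coef_asym ki); first exact: filterE.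
  by apply: filterS2 near_model near_separated => w pw sw; exact: direction_coef_A.
have coefb k : k != i -> ebounded F (fun w => direction_coef (eigval (A w)) i k).
  move=> ki; apply: near_ebounded (relgapV_bounded ki).
  by apply: filterS2 near_model near_separated => w pw sw; exact: direction_coef_A.
have term k l : k != i -> l != i -> asym F
    (fun w => direction_coef (eigval (B w)) i k * direction_coef (eigval (B w)) i l *
      G w (vidx i k) (vidx i l) *
      (dotv c (eigvec_toward (A w) (B w) k) * dotv c (eigvec_toward (A w) (B w) l)))
    (fun w => direction_coef (eigval (A w)) i k * direction_coef (eigval (A w)) i l *
      G w (vidx i k) (vidx i l) * (dotv c (eigvec (A w) k) * dotv c (eigvec (A w) l))).
  move=> ki li; have bk := dotv_eigvec_bounded k; have bl := dotv_eigvec_bounded l.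
  have b2 : ebounded F (fun w => direction_coef (eigval (A w)) i k *
      direction_coef (eigval (A w)) i l) by exact: eboundedM (coefb k ki) (coefb l li).
  apply: asymM (eboundedM b2 (G_bounded k l)) (eboundedM bk bl) _ _.
    apply: asymM b2 (G_bounded k l) _ (asym_refl _).
    exact: asymM (coefb k ki) (coefb l li) (coefA k ki) (coefA l li).
  exact: asymM bk bl (dotv_toward_asym k) (dotv_toward_asym l).
apply: asym_near (asym_sum (fun k ki => asym_sum (fun l li => term k l ki li))).
  have B0 : \forall w \near F, forall k, 0 < eigval (B w) k.
    by apply: filter_forall => k; exact: near_eigval_gt0.
  by apply: filterS B0 => w B0; rewrite qform_Delta // => k; rewrite ltW.
apply: filterS2 near_model near_separated => w pw sw.
by rewrite /Q qform_Delta // => k; exact: eigval_A_ge0.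
Qed.

(** The coefficients of the linear form in [r W] approximating the studentized
    eigenvector error. *)
Definition student_coef w k : R :=
  if k == i then 0 else
    (Num.sqrt (Q w))^-1 * (column_sign i w * y k w * (relgap i k w)^-1).

(** The asymptotic variance of the linearized error is the quadratic form by which
    it is studentized, up to the signs of the columns of [V]. *)
Lemma student_coef_norm w : perturbed w -> well_separated w -> 0 < Q w ->
  (forall k l, k != i -> l != i ->
     column_sign k w * column_sign l w * G w (vidx i k) (vidx i l) =
     G w (vidx i k) (vidx i l)) ->
  \sum_k \sum_l student_coef w k * student_coef w l * G w (vidx i k) (vidx i l) = 1.
Proof.
move=> pw sw Q0 Gsign.
have reduce (f : 'I_p -> R) : (forall k, k == i -> f k = 0) ->
    \sum_k f k = \sum_(k | k != i) f k.
  by move=> f0; rewrite (bigID (fun k => k == i)) /= big1 ?add0r.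
rewrite reduce => [|k ki]; last first.
  by rewrite big1 // => l _; rewrite /student_coef ki !mul0r.
suff E : \sum_(k | k != i) \sum_l student_coef w k * student_coef w l *
    G w (vidx i k) (vidx i l) = (Q w)^-1 * Q w by rewrite E mulVf // gt_eqF.
rewrite {2}/Q qform_Delta => [|k]; last exact: eigval_A_ge0.
rewrite mulr_sumr; apply: eq_bigr => k ki.
rewrite reduce => [|l li]; last by rewrite /student_coef li mulr0 mul0r.
rewrite mulr_sumr; apply: eq_bigr => l li.
rewrite /student_coef (negPf ki) (negPf li) !direction_coef_A // !dotv_eigvec_A //.
have [_ s1] := eigvec_A i pw sw.
rewrite -[in RHS](Gsign k l ki li).
have [_ sk] := eigvec_A k pw sw; have [_ sl] := eigvec_A l pw sw.
have Qs : (Q w)^-1 = (Num.sqrt (Q w))^-1 * (Num.sqrt (Q w))^-1.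
  by rewrite -invfM -expr2 sqr_sqrtr // ltW.
rewrite Qs.
move: s1 sk sl; move: (column_sign i w) (column_sign k w) (column_sign l w) => si sk sl.
move=> si1 sk1 sl1.
pose P := (Num.sqrt (Q w))^-1 * (Num.sqrt (Q w))^-1 *
  (y k w * y l w * (relgap i k w)^-1 * (relgap i l w)^-1 * G w (vidx i k) (vidx i l)).
transitivity (si ^+ 2 * P); first by rewrite /P; ring.
transitivity (sk ^+ 2 * sl ^+ 2 * P); first by rewrite si1 sk1 sl1 mulr1.
by rewrite /P; ring.
Qed.

Lemma student_asym (c0 : R) : 0 < c0 -> (\forall w \near F, c0 <= Q w) -> asym F
  (fun w => r w *
    inv_sqrte (Delta_q (eigval (B w)) (eigvec_toward (A w) (B w)) (G w) i c) *
    dotv c (eigvec_toward (A w) (B w) i - eigvec (A w) i))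
  (fun w => \sum_k student_coef w k * (r w * W w i k)).
Proof.
move=> c00 Qc.
have sc0 : 0 < Num.sqrt c0 by rewrite sqrtr_gt0.
have Qn : \forall w \near F, Num.sqrt c0 <= `|Num.sqrt (Q w)|.
  by apply: filterS Qc => w Qc; rewrite ger0_norm ?sqrtr_ge0 // ler_wsqrtr.
have errb : ebounded F (fun w => \sum_(k | k != i)
    column_sign i w * y k w * (relgap i k w)^-1 * (r w * W w i k)).
  apply: ebounded_sum => k ki; apply: eboundedM (rW_bounded i k).
  exact: eboundedM (eboundedM (sign_bounded i) (y_bounded k)) (relgapV_bounded ki).
apply: asym_near (asymM (eboundedV sc0 Qn) errb (asymV sc0 Qn (asym_sqrt Delta_asym))
  (eigvec_error_asym i)).
  apply: filterS near_eigval_inj => w injw.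
  rewrite /Delta_q (introT (injectiveP _) injw) /=; ring.
apply: filterE => w; rewrite mulr_sumr (bigD1 i) //= {1}/student_coef eqxx mul0r add0r.
by apply: eq_bigr => k /negPf ki; rewrite /student_coef ki; ring.
Qed.

Lemma eigvec_error_bounded :
  ebounded F (fun w => r w * dotv c (eigvec_toward (A w) (B w) i - eigvec (A w) i)).
Proof.
apply: asym_ebounded (eigvec_error_asym i) _.
apply: ebounded_sum => k ki; apply: eboundedM (rW_bounded i k).
exact: eboundedM (eboundedM (sign_bounded i) (y_bounded k)) (relgapV_bounded ki).
Qed.

End Direction.
End Perturbation.

(** If the first coordinate of the eigenvector of [A] dominates the size [1 / r]
    of the error, the sign conventions of [A] and [B] agree. *)
Lemma eigvec_toward_stable (R : realType) (I : Type) (F : set_system I) (FF : Filter F)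
    q (A B : I -> 'M[R]_q.+1) (r : I -> R) k :
  (\forall w \near F, 0 < r w) -> (\forall w \near F, (B w)^T = B w) ->
  ebounded F (fun w => r w *
    dotv (delta_mx 0 0) (eigvec_toward (A w) (B w) k - eigvec (A w) k)) ->
  (forall K : R, \forall w \near F, K <= r w * eigvec (A w) k 0 0) ->
  \forall w \near F, eigvec_toward (A w) (B w) k = eigvec (B w) k.
Proof.
move=> r0 sB [C bC] large; apply: filterS3 (filterI r0 sB) bC (large (C + 1)) => w.
move=> [/= rw sw]; have dot0 (v : 'cV[R]_q.+1) : dotv (delta_mx 0 0) v = v 0 0.
  exact: dotv_delta.
rewrite dot0 !mxE mulrBr => err big.
have t0 : 0 < eigvec_toward (A w) (B w) k 0 0.
  rewrite -(pmulr_rgt0 _ rw); move: err; rewrite ler_norml => /andP[+ _].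
  by move: (r w * _) (r w * _) big => a b big; lra.
move: t0; rewrite /eigvec_toward; case: ifP => // _; rewrite mxE oppr_gt0 => neg.
have [_ _ [j vj jmin]] := eigvecP k sw.
have [j0|j0] := posnP j; last by rewrite jmin ?ltxx in neg.
by move: vj; rewrite (_ : j = 0); [move/(lt_trans neg); rewrite ltxx|apply/val_inj].
Qed.

(** * Statistics that linearize on bounded errors *)

Section LimitsInferiorSuperior.
Context {R : realType}.
Implicit Types (u : nat -> \bar R) (x : \bar R).

Lemma limn_esup_near u x : (limn_esup u < x)%E -> \forall n \near \oo, (u n < x)%E.
Proof.
move=> /ereal_inf_lt [_ [D Doo <-] Dx]; apply: filterS Doo => n Dn.
by apply: le_lt_trans Dx; apply: ereal_sup_ubound; exists n.
Qed.

Lemma limn_einf_near u x : (x < limn_einf u)%E -> \forall n \near \oo, (x < u n)%E.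
Proof.
rewrite /limn_einf lteNr => /limn_esup_near; apply: filterS => n.
by rewrite lteN2.
Qed.

Lemma lte_fin_between (a : R) x : (a%:E < x)%E -> exists2 b : R, a < b & (b%:E < x)%E.
Proof.
case: x => [x| |] //; last by move=> _; exists (a + 1); rewrite ?ltry // ltrDl.
rewrite lte_fin => ax; exists ((a + x) / 2); rewrite ?lte_fin; lra.
Qed.

Lemma lte_between_fin (a : R) x : (x < a%:E)%E -> exists2 b : R, b < a & (x < b%:E)%E.
Proof.
case: x => [x| |] //; last by move=> _; exists (a - 1); rewrite ?ltNyr // gtrBl.
rewrite lte_fin => ax; exists ((a + x) / 2); rewrite ?lte_fin; lra.
Qed.

Lemma lte_pinfty_fin x : (x < +oo)%E -> exists b : R, (x < b%:E)%E.
Proof.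
by case: x => [x _| |_] //; [exists (x + 1); rewrite lte_fin ltrDl|exists 0; rewrite ltNyr].
Qed.

End LimitsInferiorSuperior.

Section Localization.
Context {R : realType} (p : nat) (T : nat -> Type) (z : forall n, T n -> 'M[R]_p).

(** Events that contain, for all large [n], every sample point at which the
    normalized error is at most [K]: asymptotics along this filter are uniform
    over bounded errors. *)
Definition localized (K : R) : set_system {n & T n} :=
  [set E | \forall n \near \oo, forall w : T n,
    (forall j k, `|z w j k| <= K) -> E (existT _ n w)].

Global Instance localized_filter K : Filter (localized K).
Proof.
split; rewrite /localized /=; first by apply: (@filterE _ \oo) => n.
  move=> E1 E2; apply: (@filterS2 _ \oo) => n h1 h2 w zw.
  by split; [exact: h1|exact: h2].
by move=> E1 E2 E12; apply: (@filterS _ \oo) => n h w /h /E12.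
Qed.

Lemma localized_near K (E : nat -> Prop) : (\forall n \near \oo, E n) ->
  localized K [set w | E (projT1 w)].
Proof. by apply: (@filterS _ \oo) => n En w _. Qed.

End Localization.

Section DeltaMethod.
Context {R : realType} (q : nat) d (T : nat -> measurableType d)
  (P : forall n, probability (T n) R)
  (A : nat -> 'M[R]_q.+1) (B W : forall n, T n -> 'M[R]_q.+1)
  (ell : nat -> 'rV[R]_q.+1) (V : nat -> 'M[R]_q.+1) (r : nat -> R) (M eta : R)
  (G : nat -> 'M[R]_(q.+1 * q.+1)) (i : 'I_q.+1).
Arguments B : clear implicits.
Arguments W : clear implicits.

Let z n (w : T n) : 'M[R]_q.+1 := r n *: W n w.

Let S := {n & T n}.
Let ell' (w : S) := ell (projT1 w).
Let V' (w : S) := V (projT1 w).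
Let A' (w : S) := A (projT1 w).
Let r' (w : S) := r (projT1 w).
Let G' (w : S) := G (projT1 w).
Let B' (w : S) := B (projT1 w) (projT2 w).
Let W' (w : S) := W (projT1 w) (projT2 w).

(** Linear forms in the [i]-th row of the normalized error that have unit variance
    under the covariance [G] are asymptotically standard normal, and so are the
    statistics uniformly close to them on bounded errors. *)
Definition row_normal := forall (a : nat -> 'I_q.+1 -> R) (X : forall n, T n -> R),
  (forall n, measurable_fun [set: T n] (X n)) ->
  (\forall n \near \oo,
     \sum_k \sum_l a n k * a n l * G n (vidx i k) (vidx i l) = 1) ->
  (forall K dl : R, 0 < dl -> \forall n \near \oo, forall w : T n,
     (forall j k, `|z w j k| <= K) ->
     `|X n w - \sum_k a n k * z w i k| <= dl) ->
  cvg_to_N01 P X.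

Hypotheses (eta_gt0 : 0 < eta)
  (near_frame : \forall n \near \oo, (V n)^T *m V n = 1%:M /\
     A n = V n *m diag_mx (\row_k ell n 0 k ^+ 2) *m (V n)^T)
  (near_pert : \forall n \near \oo, forall w : T n,
     B n w = V n *m diag_mx (ell n) *m (1%:M + W n w) *m diag_mx (ell n) *m (V n)^T /\
     (W n w)^T = W n w)
  (near_sep : \forall n \near \oo, well_separated (fun n => ell n) M eta n)
  (r_gt0 : \forall n \near \oo, 0 < r n)
  (r_oo : asym \oo (fun n => (r n)^-1) (fun=> 0))
  (rowN : row_normal).

Lemma row_normal_asym (a : nat -> 'I_q.+1 -> R) (X : forall n, T n -> R) :
  (forall n, measurable_fun [set: T n] (X n)) ->
  (\forall n \near \oo,
     \sum_k \sum_l a n k * a n l * G n (vidx i k) (vidx i l) = 1) ->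
  (forall K, asym (localized z K) (fun w => X (projT1 w) (projT2 w))
     (fun w => \sum_k a (projT1 w) k * (r' w * W' w i k))) ->
  cvg_to_N01 P X.
Proof.
move=> mX a1 Xa; apply: rowN mX a1 _ => K dl dl0.
have Xan : \forall n \near \oo, forall w : T n, (forall j k, `|z w j k| <= K) ->
  `|X n w - \sum_k a n k * (r n * W n w i k)| <= dl := Xa K dl dl0.
apply: filterS Xan => n h w /h.
by under [X in _ -> `|_ - X| <= _]eq_bigr do rewrite /z mxE.
Qed.

Let model K : \forall w \near localized z K, perturbed ell' V' W' A' B' w.
Proof.
rewrite /localized /=; apply: (@filterS2 _ \oo) near_frame near_pert.
by move=> n [h1 h2] h w _; case: (h w).
Qed.

Let sep K : \forall w \near localized z K, well_separated ell' M eta w.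
Proof. exact: localized_near near_sep. Qed.

Let rpos K : \forall w \near localized z K, 0 < r' w.
Proof. exact: localized_near r_gt0. Qed.

Let roo K : asym (localized z K) (fun w => (r' w)^-1) (fun=> 0).
Proof. by move=> e /r_oo; exact: localized_near. Qed.

Let rWb K j k : ebounded (localized z K) (fun w => r' w * W' w j k).
Proof.
exists K; rewrite /localized /=; apply: (@filterE _ \oo) => n w /(_ j k).
by rewrite /z mxE.
Qed.

Theorem eigval_normal (c0 : R) (X : forall n, T n -> R) : 0 < c0 ->
  (\forall n \near \oo, c0 <= G n (vidx i i) (vidx i i)) ->
  (forall n, measurable_fun [set: T n] (X n)) ->
  (\forall n \near \oo, forall w, X n w = r n / Num.sqrt (G n (vidx i i) (vidx i i)) *
    ((eigval (B n w) i)^-1 * (eigval (B n w) i - eigval (A n) i))) ->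
  cvg_to_N01 P X.
Proof.
move=> c00 Gc mX XE.
pose a n k : R := (k == i)%:R / Num.sqrt (G n (vidx i i) (vidx i i)).
apply: (@row_normal_asym a) => //.
  apply: filterS Gc => n Gc; have G0 := lt_le_trans c00 Gc.
  rewrite (bigD1 i) //= [X in _ + X]big1 => [|k /negPf ki]; last first.
    by rewrite big1 // => l _; rewrite /a ki !mul0r.
  rewrite (bigD1 i) //= big1 => [|l /negPf li]; last by rewrite /a li !mul0r mulr0 mul0r.
  rewrite !addr0 /a eqxx mul1r -invfM -expr2 sqr_sqrtr ?(ltW G0) // mulVf //.
  by rewrite gt_eqF.
move=> K; have sb : ebounded (localized z K)
    (fun w => (Num.sqrt (G' w (vidx i i) (vidx i i)))^-1).
  apply: (eboundedV (c := Num.sqrt c0)); first by rewrite sqrtr_gt0.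
  apply: (@localized_near _ _ _ z K (fun n => Num.sqrt c0 <= `|Num.sqrt (G n (vidx i i) (vidx i i))|)).
  by apply: filterS Gc => n Gc; rewrite ger0_norm ?sqrtr_ge0 // ler_wsqrtr.
apply: asym_near (asymM sb (rWb K i i) (asym_refl _)
  (eigval_error_asym eta_gt0 (model K) (sep K) (rpos K) (roo K) (@rWb K) i)).
  rewrite /localized /=; apply: (@filterS _ \oo) XE => n XE w _; rewrite XE.
  by rewrite /G' /r' /B' /A' /=; ring.
apply: filterE => w.
rewrite (bigD1 i) //= big1 => [|k /negPf ki]; last by rewrite /a ki !mul0r.
by rewrite addr0 /a eqxx mul1r.
Qed.

Context (c : 'cV[R]_q.+1) (c0 : R).
Hypotheses (c1 : dotv c c = 1) (c00 : 0 < c0)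
  (Qc : \forall n \near \oo,
     c0 <= qform (Delta_of (eigval (A n)) (eigvec (A n)) (G n) i) c)
  (Gb : exists C : R, \forall n \near \oo, forall k l, `|G n (vidx i k) (vidx i l)| <= C)
  (Gsign : \forall n \near \oo, forall k l, k != i -> l != i ->
     column_sign V A k n * column_sign V A l n * G n (vidx i k) (vidx i l) =
     G n (vidx i k) (vidx i l)).

Let Gb' K k l : ebounded (localized z K) (fun w => G' w (vidx i k) (vidx i l)).
Proof.
case: Gb => C GC; exists C.
apply: (@localized_near _ _ _ z K (fun n => `|G n (vidx i k) (vidx i l)| <= C)).
by apply: filterS GC => n; apply.
Qed.

Let Qc' K : \forall w \near localized z K,
  c0 <= qform (Delta_of (eigval (A' w)) (eigvec (A' w)) (G' w) i) c.
Proof. exact: localized_near Qc. Qed.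

(** [X] only has to coincide with the studentized error for large [n] and bounded
    errors. *)
Theorem eigvec_normal (X : forall n, T n -> R) :
  (forall n, measurable_fun [set: T n] (X n)) ->
  (forall K, \forall w \near localized z K, X (projT1 w) (projT2 w) =
    r' w * inv_sqrte (Delta_q (eigval (B' w)) (eigvec_toward (A' w) (B' w)) (G' w) i c) *
    dotv c (eigvec_toward (A' w) (B' w) i - eigvec (A' w) i)) ->
  cvg_to_N01 P X.
Proof.
move=> mX XE.
apply: (@row_normal_asym (fun n k => student_coef ell V A c i G n k)) => //.
    pose B0 n := V n *m diag_mx (ell n) *m (1%:M + 0) *m diag_mx (ell n) *m (V n)^T.
  apply: filterS3 near_sep Qc (filterI near_frame Gsign) => n sn Qn [/= [f1 f2] sgn].
  apply: (@student_coef_norm R nat _ ell V (fun=> 0) A B0 M eta eta_gt0 c i G n) => //.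
    by split=> //; rewrite trmx0.
  exact: lt_le_trans c00 Qn.
move=> K.
apply: asym_near (student_asym eta_gt0 (model K) (sep K) (rpos K) (roo K) (@rWb K) c1
  (Gb' K) c00 (Qc' K)); first exact: XE.
exact: filterE.
Qed.

Lemma eigvec_toward_eventually (s : 'I_q.+1) K :
  (forall n w, (B n w)^T = B n w) -> r n * eigvec (A n) s 0 0 @[n --> \oo] --> +oo ->
  \forall w \near localized z K, eigvec_toward (A' w) (B' w) s = eigvec (B' w) s.
Proof.
move=> sB large; apply: (eigvec_toward_stable (localized_filter z K) (rpos K)).
- by apply: filterE => w; exact: sB.
- have e1 : dotv (delta_mx 0 0 : 'cV[R]_q.+1) (delta_mx 0 0) = 1.
    by rewrite dotv_delta mxE !eqxx.
  exact: (eigvec_error_bounded eta_gt0 (model K) (sep K) (rpos K) (roo K) (@rWb K) e1).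
- move=> C; apply: (@localized_near _ _ _ z K (fun n => C <= r n * eigvec (A n) s 0 0)).
  by move/cvgryPge : large; apply.
Qed.

End DeltaMethod.

(** * Vectorization and linear forms in the sketching error *)

Section Vectorization.
Context {R : realType} (p : nat).
Implicit Types (G : 'M[R]_(p * p)) (W : 'M[R]_p) (a : 'I_p -> R).

Lemma vpairK (r : 'I_(p * p)) : vidx (vpair r).1 (vpair r).2 = r.
Proof.
by rewrite /vidx /vpair /mxvec_index /= -surjective_pairing enum_valK cast_ordKV.
Qed.

Lemma vidx_eq (i j k l : 'I_p) : (vidx i j == vidx k l) = (i == k) && (j == l).
Proof. rewrite -xpair_eqE; apply/eqP/eqP => [e|[-> ->] //].
by rewrite -(vidxK i j) e vidxK. Qed.

(** Position in the vectorization of the pair indexing a column of [dupl]. *)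
Definition upper_pos (b : 'I_#|upper p|) : 'I_(p * p) :=
  vidx (enum_val b).1 (enum_val b).2.

Lemma vpair_eq r (b : 'I_#|upper p|) : (vpair r == enum_val b) = (r == upper_pos b).
Proof.
apply/eqP/eqP => [vr|->]; first by rewrite /upper_pos -vr vpairK.
by rewrite /upper_pos vidxK -surjective_pairing.
Qed.

Lemma dupl_mulmx s (Y : 'M[R]_(p * p, s)) b j : ((dupl p)^T *m Y) b j = Y (upper_pos b) j.
Proof.
rewrite mxE (bigD1 (upper_pos b)) //= big1 => [|r /negPf rb]; rewrite !mxE vpair_eq.
  by rewrite eqxx mul1r addr0.
by rewrite rb mul0r.
Qed.

Lemma half_mxE G b b' : half_mx G b b' = G (upper_pos b) (upper_pos b').
Proof.
rewrite /half_mx -mulmxA dupl_mulmx mxE (bigD1 (upper_pos b')) //= big1 => [|r /negPf rb].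
  by rewrite mxE vpair_eq eqxx mulr1 addr0.
by rewrite mxE vpair_eq rb mulr0.
Qed.

Definition sort_pair (i k : 'I_p) := if (i <= k)%N then (i, k) else (k, i).

Lemma sort_pair_upper i k : sort_pair i k \in upper p.
Proof.
by rewrite inE /sort_pair; case: (leqP i k) => //= /ltnW.
Qed.

Definition upper_idx (i k : 'I_p) : 'I_#|upper p| :=
  enum_rank_in (sort_pair_upper i k) (sort_pair i k).

Lemma upper_idxK i k : upper_pos (upper_idx i k) = if (i <= k)%N then vidx i k else vidx k i.
Proof.
rewrite /upper_pos /upper_idx enum_rankK_in ?sort_pair_upper // /sort_pair.
by case: ifP.
Qed.

Lemma vec_upper W i k : W^T = W -> vec W (upper_pos (upper_idx i k)) 0 = W i k.
Proof.
by move=> sW; rewrite upper_idxK; case: ifP => _; rewrite vecE // -[in LHS]sW mxE.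
Qed.

Lemma half_mx_upper G i j k l : abs_sym G ->
  half_mx G (upper_idx i j) (upper_idx k l) = G (vidx i j) (vidx k l).
Proof.
case=> _ sG _; have [s1 s2 s3] := sG i j k l.
by rewrite half_mxE !upper_idxK; case: ifP => _; case: ifP => _.
Qed.

End Vectorization.

Section QuadraticForms.
Context {R : realType} (p : nat).
Implicit Types (N : 'M[R]_p) (x y : 'cV[R]_p).

Lemma qform_lincomb (J : finType) N (a : J -> R) (g : J -> 'cV[R]_p) :
  qform N (\sum_k a k *: g k) = \sum_k \sum_l a k * a l * ((g k)^T *m N *m g l) 0 0.
Proof.
rewrite /qform; have -> : (\sum_k a k *: g k)^T = \sum_k a k *: (g k)^T.
  by rewrite linear_sum; apply: eq_bigr => k _; rewrite linearZ.
rewrite !mulmx_suml summxE; apply: eq_bigr => k _.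
rewrite mulmx_sumr summxE; apply: eq_bigr => l _.
by rewrite -!scalemxAl -scalemxAr !mxE mulrA.
Qed.

Lemma qform1 x : qform 1%:M x = dotv x x.
Proof. by rewrite /qform mulmx1. Qed.

Lemma dotv_suml (J : finType) (a : J -> R) (g : J -> 'cV[R]_p) y :
  dotv (\sum_k a k *: g k) y = \sum_k a k * dotv (g k) y.
Proof.
rewrite dotvE; under eq_bigr => j _ do rewrite summxE mulr_suml.
rewrite exchange_big; apply: eq_bigr => k _; rewrite dotvE mulr_sumr.
by apply: eq_bigr => j _; rewrite mxE mulrA.
Qed.

Lemma norm_dotv_le x y : `|dotv x y| <= dotv x x + dotv y y.
Proof.
have sq s : 0 <= dotv x x + s ^+ 2 * dotv y y + 2 * s * dotv x y.
  have := dotvv_ge0 (x + s *: y); congr (0 <= _).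
  rewrite !dotvE !mulr_sumr -!big_split; apply: eq_bigr => j _ /=.
  by rewrite !mxE; ring.
have := sq 1; have := sq (-1); have := dotvv_ge0 x; have := dotvv_ge0 y.
rewrite sqrrN !expr1n !mul1r => x0 y0 s1 s2; rewrite ler_norml; apply/andP; split; lra.
Qed.

Lemma bform_delta N i j : ((delta_mx i 0 : 'cV[R]_p)^T *m N *m (delta_mx j 0 : 'cV[R]_p)) 0 0 = N i j.
Proof. by rewrite trmx_delta -rowE -colE !mxE. Qed.

Lemma posdef_unitmx N : posdef N -> N \in unitmx.
Proof.
case=> _ N0; rewrite -row_free_unit -kermx_eq0; apply/rowV0P => v /sub_kermxP vN.
apply/eqP; apply: contraT => v0; have := N0 v^T; rewrite trmx_eq0 => /(_ v0).
by rewrite /qform trmxK vN mul0mx mxE ltxx.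
Qed.

Lemma posdef_psd N : posdef N -> psd N.
Proof.
move=> [sN N0]; split=> // c; have [->|c0] := eqVneq c 0; last exact/ltW/N0.
by rewrite /qform mulmx0 mxE.
Qed.

(** Positivity on the sum and the difference of two basis vectors. *)
Lemma psd_entry_bound N C : psd N -> (forall j, N j j <= C) -> forall i j, `|N i j| <= C.
Proof.
move=> [sN N0] NC i j.
have sq s : 0 <= N i i + s ^+ 2 * N j j + 2 * s * N i j.
  have := N0 (\sum_(b : bool) (if b then s else 1) *: delta_mx (if b then j else i) 0).
  rewrite qform_lincomb !big_bool /= !bform_delta; congr (0 <= _).
  by rewrite (_ : N j i = N i j); [ring|rewrite -[in RHS]sN mxE].
have := sq 1; have := sq (-1); have := NC i; have := NC j.
rewrite sqrrN !expr1n !mul1r => x0 y0 s1 s2; rewrite ler_norml; apply/andP; split; lra.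
Qed.

End QuadraticForms.

Section RowNormality.
Context {R : realType} (q : nat) d (T : nat -> measurableType d)
  (P : forall n, probability (T n) R) (W : forall n, T n -> 'M[R]_q.+1)
  (G : nat -> 'M[R]_(q.+1 * q.+1)) (i : 'I_q.+1).
Arguments W : clear implicits.

(** The entries of [r W] being linear forms of bounded length in an asymptotically
    normal vector, they are bounded wherever this vector is, so closeness on bounded
    errors gives closeness on balls. *)
Lemma row_normal_forms (r : nat -> R) N (Y : forall n, T n -> 'cV[R]_N) (Sigma : 'M[R]_N)
    (g : nat -> 'I_q.+1 -> 'I_q.+1 -> 'cV[R]_N) (C : R) :
  cvg_to_normal P Y Sigma ->
  (\forall n \near \oo, forall w j k, r n * W n w j k = dotv (g n j k) (Y n w)) ->
  (\forall n \near \oo, forall j k, dotv (g n j k) (g n j k) <= C) ->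
  (\forall n \near \oo, forall a : 'I_q.+1 -> R,
     \sum_k \sum_l a k * a l * G n (vidx i k) (vidx i l) = 1 ->
     qform Sigma (\sum_k a k *: g n i k) = 1 /\
     dotv (\sum_k a k *: g n i k) (\sum_k a k *: g n i k) <= 1) ->
  row_normal P W r G i.
Proof.
move=> YN rWE gC gS z a X mX a1 Xa.
pose b n := \sum_k a n k *: g n i k.
apply: (slutsky_linear (C := 1) (b := b) YN) => //.
- apply: filterS2 gS a1 => n /(_ (a n)) h /h [_ b1] j.
  have := le_trans (le_coord_dotvv (b n) j) b1.
  by rewrite -[1 in X in X -> _](expr1n R 2%N) -real_normK ?num_real // ler_sqr ?nnegrE.
- by apply: filterS2 gS a1 => n /(_ (a n)) h /h [].
move=> K dl dl0; apply: filterS3 rWE gC (Xa (C + K) dl dl0) => n rWE gC' h w YK.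
have -> : dotv (b n) (Y n w) = \sum_k a n k * (r n *: W n w) i k.
  by rewrite dotv_suml; apply: eq_bigr => k _; rewrite mxE rWE.
apply: h => j k; rewrite mxE rWE; apply: le_trans (norm_dotv_le _ _) _.
exact: lerD.
Qed.

End RowNormality.

Section SketchErrors.
Context {R : realType} (q : nat) (d : measure_display)
  (T : nat -> nat -> measurableType d) (P : forall m n, probability (T m n) R)
  (S : forall m n, T m n -> 'M[R]_(m, n)) (m : nat -> nat)
  (tau : nat -> nat -> R) (U : frames R q.+1).
Arguments S : clear implicits.

Let W n (w : T (m n) n) : 'M[R]_q.+1 := sketch_gram (S (m n) n w) (U n) - 1%:M.
Let rate n : R := (m n)%:R / tau (m n) n.

Lemma sketch_gram_sym k n p (s : 'M[R]_(k, n)) (X : 'M[R]_(n, p)) :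
  (sketch_gram s X)^T = sketch_gram s X.
Proof. by rewrite /sketch_gram !trmx_mul !trmxK !mulmxA. Qed.

Lemma sketch_error_sym n w : (@W n w)^T = @W n w.
Proof. by rewrite /W linearB /= sketch_gram_sym trmx1. Qed.

Hypothesis tau_pos : \forall n \near \oo, 0 < tau (m n) n.

(** The square root [H] that standardizes the error is undone: each entry of the
    normalized error is the linear form [g], whose Gram matrix is [G], in the
    standardized vector. *)
Theorem row_normal_Sym (G : nat -> 'M[R]_(q.+1 * q.+1)) (C : R) (i : 'I_q.+1) :
  (\forall n \near \oo, abs_sym (G n)) ->
  (\forall n \near \oo, forall a, half_mx (G n) a a <= C) ->
  cvg_to_normal (fun n => P (m n) n)
    (fun n w => Num.sqrt (m n)%:R *:
       (mx_invsqrt (tau (m n) n *: half_mx (G n)) *m (dupl q.+1)^T *m sketch_error S U w))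
    1%:M ->
  row_normal (fun n => P (m n) n) W (fun n => Num.sqrt (rate n)) G i.
Proof.
move=> absG GC YN.
pose H n := psd_sqrt (tau (m n) n *: half_mx (G n)).
pose g n j k : 'cV[R]_#|upper q.+1| :=
  (Num.sqrt (tau (m n) n))^-1 *: (H n *m delta_mx (upper_idx j k) 0).
have Hsqr : \forall n \near \oo, [/\ (H n)^T = H n,
    H n *m H n = tau (m n) n *: half_mx (G n) & H n \in unitmx].
  apply: filterS2 tau_pos absG => n t0 [_ _ [sG pG]].
  have pN : posdef (tau (m n) n *: half_mx (G n)).
    split=> [|c c0]; first by rewrite linearZ /= sG.
    by rewrite /qform -scalemxAr -scalemxAl mxE mulr_gt0 //; exact: pG.
  have [[sH _] HH] := psd_sqrtP (posdef_psd pN); split=> //.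
  by have := posdef_unitmx pN; rewrite -HH unitmx_mul => /andP[].
have bil : \forall n \near \oo, forall j k l,
    ((g n j k)^T *m g n j l) 0 0 = G n (vidx j k) (vidx j l).
  apply: filterS3 tau_pos absG Hsqr => n t0 aG [sH HH _] j k l.
  have -> : (g n j k)^T = (Num.sqrt (tau (m n) n))^-1 *:
      ((delta_mx (upper_idx j k) 0 : 'cV[R]_#|upper q.+1|)^T *m H n).
    by rewrite /g linearZ /= trmx_mul sH.
  rewrite /g -scalemxAl -scalemxAr scalerA mulmxA -(mulmxA _ (H n) (H n)) HH.
  rewrite -invfM -expr2 sqr_sqrtr ?(ltW t0) // -scalemxAr -scalemxAl scalerA mulVf ?gt_eqF //.
  by rewrite scale1r bform_delta half_mx_upper.
apply: (row_normal_forms (g := g) (C := C) YN).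
- apply: filterS2 tau_pos Hsqr => n t0 [sH _ uH] w j k.
  have HY : H n *m (Num.sqrt (m n)%:R *: (mx_invsqrt (tau (m n) n *: half_mx (G n))
      *m (dupl q.+1)^T *m sketch_error S U w)) =
      Num.sqrt (m n)%:R *: ((dupl q.+1)^T *m sketch_error S U w).
    by rewrite -scalemxAr !mulmxA mulmxV // mul1mx.
  rewrite dotvZl /dotv trmx_mul sH -(mulmxA _ (H n)) HY -scalemxAr.
  rewrite trmx_delta -rowE 2![in RHS]mxE dupl_mulmx.
  rewrite /sketch_error vec_upper ?sketch_error_sym //.
  by rewrite /rate sqrtrM ?ler0n // sqrtrV ?(ltW t0) //; ring.
- apply: filterS3 absG bil GC => n aG b GC j k.
  by rewrite /dotv b -(half_mx_upper _ _ _ _ aG).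
apply: filterS bil => n b a a1; rewrite -[X in X <= _]qform1.
suff E : qform 1%:M (\sum_k a k *: g n i k) = 1 by rewrite E.
rewrite qform_lincomb -[RHS]a1; apply: eq_bigr => k _; apply: eq_bigr => l _.
by rewrite mulmx1 b.
Qed.

(** For [alpha = 0], the covariance of a Gaussian symmetric matrix with variance 2
    on the diagonal and 1 off it; [alpha] adds an independent Gaussian multiple of
    the identity. *)
Definition wick_cov (alpha : nat) : 'M[R]_(q.+1 * q.+1) :=
  1%:M + perm_P q.+1 + alpha%:R *: proj_Q q.+1.

Lemma wick_covE alpha (i k l : 'I_q.+1) : wick_cov alpha (vidx i k) (vidx i l) =
  (k == l)%:R + ((k == i) && (l == i))%:R * (1 + alpha%:R).
Proof.
have v k0 : vec 1%:M (vidx i k0) 0 = (i == k0)%:R :> R by rewrite vecE mxE.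
have vv : proj_Q q.+1 (vidx i k) (vidx i l) = ((i == k)%:R * (i == l)%:R : R).
  by rewrite /proj_Q mxE big_ord1 [X in _ * X]mxE !v.
rewrite /wick_cov 2![(_ + _ : 'M[R]__) _ _]mxE [(_ *: _ : 'M[R]__) _ _]mxE vv !mxE.
rewrite !vidxK vidx_eq eqxx /= (eq_sym i k) (eq_sym i l).
by case: (k == i); case: (l == i); rewrite /=; ring.
Qed.

(** Here the vectorized error itself converges, possibly to a singular law; on the
    [i]-th row the covariance dominates the identity, which bounds the
    coefficients of standardized linear forms. *)
Theorem row_normal_Sym1 (alpha : nat) (i : 'I_q.+1) :
  cvg_to_normal (fun n => P (m n) n)
    (fun n w => (Num.sqrt (m n)%:R / Num.sqrt (tau (m n) n)) *: sketch_error S U w)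
    (wick_cov alpha) ->
  row_normal (fun n => P (m n) n) W (fun n => Num.sqrt (rate n)) (fun=> wick_cov alpha) i.
Proof.
move=> YN; pose g (n : nat) j k : 'cV[R]_(q.+1 * q.+1) := delta_mx (vidx j k) 0.
apply: (row_normal_forms (g := g) (C := 1) YN).
- apply: filterS tau_pos => n t0 w j k.
  by rewrite /g dotv_delta [RHS]mxE /sketch_error vecE /rate sqrtrM ?ler0n // sqrtrV // ltW.
- by apply: filterE => n j k; rewrite /g dotv_delta mxE !eqxx.
apply: filterE => n a a1; split.
  rewrite qform_lincomb -a1; apply: eq_bigr => k _; apply: eq_bigr => l _.
  by rewrite bform_delta.
have lhsE : \sum_k \sum_l a k * a l * wick_cov alpha (vidx i k) (vidx i l) =
    \sum_k a k ^+ 2 + a i ^+ 2 * (1 + alpha%:R).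
  rewrite -[X in _ + X](_ : \sum_k \sum_l
      a k * a l * (((k == i) && (l == i))%:R * (1 + alpha%:R)) = _).
    rewrite -big_split; apply: eq_bigr => k _ /=.
    under eq_bigr => l _ do rewrite wick_covE mulrDr.
    rewrite big_split /=; congr (_ + _).
    rewrite (bigD1 k) //= eqxx mulr1 big1 ?addr0 ?expr2 //.
    by move=> l /negPf lk; rewrite eq_sym lk mulr0.
  rewrite (bigD1 i) //= [X in _ + X]big1 ?addr0 => [|k /negPf ki]; last first.
    by rewrite big1 // => l _; rewrite ki mul0r mulr0.
  rewrite (bigD1 i) //= big1 ?addr0 => [|l /negPf li]; last by rewrite li andbF mul0r mulr0.
  by rewrite !eqxx /= mul1r expr2.
rewrite -[leRHS]a1 lhsE -qform1 qform_lincomb.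
rewrite [leLHS](_ : _ = \sum_k a k ^+ 2).
  by rewrite lerDl mulr_ge0 ?sqr_ge0 // addr_ge0.
apply: eq_bigr => k _; rewrite (bigD1 k) //= bform_delta mxE eqxx mulr1.
rewrite big1 ?addr0 ?expr2 // => l /negPf lk.
by rewrite bform_delta mxE vidx_eq eqxx /= eq_sym lk mulr0.
Qed.

End SketchErrors.

(** * The spectrum of a sketched Gram matrix *)

Section PositiveSemidefinite.
Context {R : realType}.

Lemma eigval_psd_ge0 p (N : 'M[R]_p) k : psd N -> 0 <= eigval N k.
Proof.
move=> [sN N0]; have [Nv v1 _] := eigvecP k sN.
have := N0 (eigvec N k); rewrite /qform -mulmxA Nv -scalemxAr mxE.
by rewrite -/(dotv _ _) v1 mulr1.
Qed.

Lemma psd_gram n p (X : 'M[R]_(n, p)) : psd (gram X).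
Proof.
split=> [|c]; first by rewrite /gram trmx_mul trmxK.
rewrite (_ : qform _ c = dotv (X *m c) (X *m c)) ?dotvv_ge0 //.
by rewrite /qform /dotv /gram trmx_mul !mulmxA.
Qed.

Lemma psd_sketch_gram k n p (S : 'M[R]_(k, n)) (X : 'M[R]_(n, p)) : psd (sketch_gram S X).
Proof.
by have := psd_gram (S *m X); rewrite /gram trmx_mul /sketch_gram !mulmxA.
Qed.

Lemma loewner_diag p (M N : 'M[R]_p) a : loewner_le M N -> M a a <= N a a.
Proof.
case=> _ /(_ (delta_mx a 0)); rewrite /qform bform_delta.
by rewrite !mxE subr_ge0.
Qed.

End PositiveSemidefinite.

Section WickCovariance.
Context {R : realType} (q : nat).
Implicit Types (lam : 'I_q.+1 -> R) (v : 'I_q.+1 -> 'cV[R]_q.+1).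

Lemma wick_cov_off alpha (i k l : 'I_q.+1) : k != i ->
  wick_cov (R := R) q alpha (vidx i k) (vidx i l) = (k == l)%:R.
Proof. by move=> /negPf ki; rewrite wick_covE ki mul0r addr0. Qed.

Lemma wick_cov_diag alpha (i : 'I_q.+1) :
  wick_cov (R := R) q alpha (vidx i i) (vidx i i) = (2 + alpha)%:R.
Proof. by rewrite wick_covE !eqxx mul1r addrA natrD. Qed.

Lemma qform_Delta1 alpha lam v i c : (forall k, 0 <= lam k) ->
  qform (Delta_of lam v (wick_cov q alpha) i) c =
  \sum_(k | k != i) lam i * lam k / (lam i - lam k) ^+ 2 * dotv c (v k) ^+ 2.
Proof.
move=> lam0; rewrite qform_Delta //; apply: eq_bigr => k ki.
rewrite (bigD1 k) //= big1 ?addr0 => [|l /andP[_ /negPf lk]]; last first.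
  by rewrite wick_cov_off // eq_sym lk mulr0 mul0r.
rewrite wick_cov_off // eqxx mulr1 -!expr2 /direction_coef expr_div_n sqr_sqrtr //.
exact: mulr_ge0.
Qed.

Lemma Delta1_qE alpha lam v i c : (forall k, 0 <= lam k) ->
  Delta1_q lam v i c = Delta_q lam v (wick_cov q alpha) i c.
Proof. by move=> lam0; rewrite /Delta1_q /Delta_q (qform_Delta1 alpha) //. Qed.

(** The sign of an eigenvector only enters through its square. *)
Lemma Delta1_q_toward (A B : 'M[R]_q.+1) lam i c :
  Delta1_q lam (eigvec_toward A B) i c = Delta1_q lam (eigvec B) i c.
Proof.
rewrite /Delta1_q; case: ifP => // _; congr _%:E; apply: eq_bigr => k _.
by rewrite /eigvec_toward; case: ifP => // _; rewrite dotvNr sqrrN.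
Qed.

End WickCovariance.

Section Measurability.
Context {R : realType} d (T : measurableType d) (q : nat) (M : T -> 'M[R]_q.+1).
Hypotheses (mM : measurable_mx M) (psdM : forall w, psd (M w)).

Let sM w : (M w)^T = M w. Proof. by case: (psdM w). Qed.

(** Measurability where the spectrum is simple; elsewhere the statistics below
    vanish, [inv_sqrte] being zero at infinity. *)
Definition measurable_simple (v : T -> 'cV[R]_q.+1) :=
  exists2 g, measurable_mx g & forall w, injective (eigval (M w)) -> v w = g w.

Lemma measurable_simple_eigvec k : measurable_simple (fun w => eigvec (M w) k).
Proof. exact: measurable_eigvec. Qed.

Lemma measurable_dotv (c : 'cV[R]_q.+1) g : measurable_mx g ->
  measurable_fun [set: T] (fun w => dotv c (g w)).
Proof.
move=> mg; under eq_fun do rewrite dotvE.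
apply: measurable_sum_cond => j _; apply: measurable_funM; [exact: measurable_cst|exact: mg].
Qed.

Lemma measurable_simple_toward (A : 'M[R]_q.+1) k :
  measurable_simple (fun w => eigvec_toward A (M w) k).
Proof.
have [g mg gE] := measurable_simple_eigvec k.
exists (fun w => if 0 <= dotv (eigvec A k) (g w) then g w else - g w); last first.
  by move=> w /gE gw; rewrite /eigvec_toward gw.
move=> a b; rewrite (_ : (fun w => _) = fun w =>
    if 0 <= dotv (eigvec A k) (g w) then g w a b else - g w a b); last first.
  by apply/funext => w; case: ifP; rewrite ?mxE.
apply: measurable_fun_ifT.
- apply: measurable_fun_ler; [exact: measurable_cst|exact: measurable_dotv].
- exact: mg.
- by apply: measurableT_comp => //; exact: mg.
Qed.

Lemma measurable_student (v : T -> 'I_q.+1 -> 'cV[R]_q.+1) (u : T -> 'cV[R]_q.+1)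
    (G : 'M[R]_(q.+1 * q.+1)) i c e (r : R) :
  (forall k, measurable_simple (fun w => v w k)) -> measurable_simple u ->
  measurable_fun [set: T] (fun w =>
    r * inv_sqrte (Delta_q (eigval (M w)) (v w) G i c) * dotv c (u w - e)).
Proof.
move=> mv [h mh uh].
have /choice[g mg] k : exists gk, measurable_mx gk /\
    forall w, injective (eigval (M w)) -> v w k = gk w.
  by have [gk mg vg] := mv k; exists gk.
pose lam k w := eigval (M w) k.
have mlam k : measurable_fun [set: T] (lam k) by exact: measurable_eigval.
pose D w := \prod_j \prod_(k | k != j) (lam j w - lam k w).
have mcoef k : measurable_fun [set: T] (fun w => direction_coef (eigval (M w)) i k).
  apply: measurable_funM; first by apply: measurable_sqrt; apply: measurable_funM; exact: mlam.
  by apply: measurable_inv; apply: measurable_funB; exact: mlam.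
have mD : measurable_fun [set: T] D.
  by do 2! [apply: measurable_prod_cond => ? _]; apply: measurable_funB; exact: mlam.
rewrite (_ : (fun w => _) = fun w => D w * (D w)^-1 *
    (r * (Num.sqrt (\sum_(k | k != i) \sum_(l | l != i)
      direction_coef (eigval (M w)) i k * direction_coef (eigval (M w)) i l *
      G (vidx i k) (vidx i l) * (dotv c (g k w) * dotv c (g l w))))^-1 *
     (dotv c (h w) - dotv c e))); last first.
  apply/funext => w; rewrite /Delta_q; case: ifPn => [inj|ninj].
    have injw := injectiveP _ inj.
    have -> : D w / D w = 1.
      apply: mulfV; apply/prodf_neq0 => j _; apply/prodf_neq0 => k kj.
      by rewrite subr_eq0; apply: contraNneq kj => /injw ->.
    rewrite mul1r uh // dotvBr /= qform_Delta => [|k]; last exact: eigval_psd_ge0.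
    congr (_ / Num.sqrt _ * _); apply: eq_bigr => k _; apply: eq_bigr => l _.
    by rewrite ((mg k).2 w injw) ((mg l).2 w injw).
  rewrite /= mulr0 mul0r (_ : D w = 0) ?mul0r //.
  move/injectivePn : ninj => [j [k jk ljk]].
  by rewrite /D (bigD1 j) //= (bigD1 k) 1?eq_sym //= /lam ljk subrr !mul0r.
apply: measurable_funM.
  by apply: measurable_funM => //; exact: measurable_inv.
apply: measurable_funM; last first.
  by apply: measurable_funB => //; exact: measurable_dotv.
apply: measurable_funM => //; apply: measurable_inv; apply: measurable_sqrt.
apply: measurable_sum_cond => k _; apply: measurable_sum_cond => l _.
apply: measurable_funM.
  by apply: measurable_funM => //; exact: measurable_funM.
have [[mk _] [ml _]] := (mg k, mg l).
by apply: measurable_funM; exact: measurable_dotv.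
Qed.

End Measurability.

Section SketchedSpectrum.
Context (R : realType) (q : nat) (d : measure_display)
  (T : nat -> nat -> measurableType d) (P : forall m n, probability (T m n) R)
  (S : forall m n, T m n -> 'M[R]_(m, n))
  (m : nat -> nat) (tau : nat -> nat -> R)
  (X U : frames R q.+1) (ell : nat -> 'rV[R]_q.+1) (V : nat -> 'M[R]_q.+1).
Arguments S : clear implicits.
Hypotheses
  (meas_S : forall k n i j, measurable_fun [set: T k n] (fun w => S k n w i j))
  (m_oo : m @ \oo --> \oo)
  (tau_gt0 : forall k n, (0 < k)%N -> (0 < n)%N -> 0 < tau k n)
  (tau_m : tau (m n) n / (m n)%:R @[n --> \oo] --> (0 : R))
  (svd_X : forall n, (q.+1 <= n)%N -> is_svd (X n) (U n) (ell n) (V n))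
  (cond_X : (limn_esup (fun n => (ell n 0 ord0 / ell n 0 ord_max)%:E) < +oo)%E)
  (gap_X : (1%:E < limn_einf (fun n => \big[Order.min/+oo]_(i < q)
      (ell n 0 (widen_ord (leqnSn q) i) / ell n 0 (lift ord0 i))%:E))%E).

Let A n := gram (X n).
Let B n (w : T (m n) n) := sketch_gram (S (m n) n w) (X n).
Let W n (w : T (m n) n) : 'M[R]_q.+1 := sketch_gram (S (m n) n w) (U n) - 1%:M.
Let Pm n := P (m n) n.
Let rate n : R := (m n)%:R / tau (m n) n.
Let r n : R := Num.sqrt (rate n).
Arguments B : clear implicits.
Arguments W : clear implicits.
Let z n (w : T (m n) n) : 'M[R]_q.+1 := r n *: W n w.

Lemma orthonormal_svd : orthonormal_frames U.
Proof. by move=> n /svd_X []. Qed.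

Let near_svd : \forall n \near \oo, is_svd (X n) (U n) (ell n) (V n).
Proof. by apply: filterS (nbhs_infty_ge q.+1) => n; exact: svd_X. Qed.

Let near_m0 : \forall n \near \oo, (0 < m n)%N.
Proof. exact: m_oo (nbhs_infty_gt 0). Qed.

Lemma near_tau_gt0 : \forall n \near \oo, 0 < tau (m n) n.
Proof. by apply: filterS2 near_m0 (nbhs_infty_gt 0) => n; exact: tau_gt0. Qed.

Lemma near_rate_gt0 : \forall n \near \oo, 0 < rate n.
Proof.
by apply: filterS2 near_m0 near_tau_gt0 => n m0 t0; rewrite divr_gt0 // ltr0n.
Qed.

Lemma near_r_gt0 : \forall n \near \oo, 0 < r n.
Proof. by apply: filterS near_rate_gt0 => n r0; rewrite sqrtr_gt0. Qed.

Lemma r_inv_asym0 : asym \oo (fun n => (r n)^-1) (fun=> 0).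
Proof.
apply: asym_near (asym_sqrt (asym_cvg tau_m)).
  by apply: filterS near_rate_gt0 => n r0; rewrite -sqrtrV ?(ltW r0) // invf_div.
by apply: filterE => n; rewrite sqrtr0.
Qed.

(** Consecutive ratios bounded away from one separate all pairs, the singular
    values being sorted. *)
Lemma svd_well_separated : exists M eta : R,
  0 < eta /\ \forall n \near \oo, well_separated (fun n => ell n) M eta n.
Proof.
have [M /limn_esup_near condM] := lte_pinfty_fin cond_X.
have [b b1 /limn_einf_near gapb] := lte_fin_between gap_X.
exists M, (b - 1); split; first by rewrite subr_gt0.
apply: filterS3 near_svd condM gapb => n [_ _ _ dec l0]; rewrite lte_fin => cM gap.
have M0 : 0 < M by apply: lt_trans cM; rewrite divr_gt0.
split=> // [j k|j k jk].
  apply: le_trans (dec ord0 j _) _ => //.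
  apply: le_trans (_ : M * ell n 0 ord_max <= _).
    by rewrite -ler_pdivrMr // ltW.
  by rewrite ler_pM2l // dec // -ltnS.
have jq : (j < q)%N by apply: leq_trans jk _; rewrite -ltnS.
have := lt_le_trans gap (bigmin_le _ (Ordinal jq) _); rewrite lte_fin ltr_pdivlMr // addrC subrK.
rewrite (_ : widen_ord _ _ = j); last exact/val_inj.
by move=> /ltW; apply: le_trans; rewrite ler_pM2l ?(lt_trans ltr01) // dec.
Qed.

Lemma near_spectral_A : \forall n \near \oo, (V n)^T *m V n = 1%:M /\
  A n = V n *m diag_mx (\row_k ell n 0 k ^+ 2) *m (V n)^T.
Proof.
apply: filterS near_svd => n [XE UU VV _ _]; split=> //.
rewrite /A /gram {}XE !trmx_mul trmxK tr_diag_mx -diag_mx_sqr.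
by rewrite !mulmxA -(mulmxA _ (U n)^T) UU mulmx1.
Qed.

Lemma near_perturbed_B : \forall n \near \oo, forall w,
  B n w = V n *m diag_mx (ell n) *m (1%:M + W n w) *m diag_mx (ell n) *m (V n)^T /\
  (W n w)^T = W n w.
Proof.
apply: filterS near_svd => n [XE _ _ _ _] w; split; last exact: sketch_error_sym.
rewrite /B /W [1%:M + _]addrC subrK /sketch_gram {}XE !trmx_mul trmxK tr_diag_mx.
by rewrite !mulmxA.
Qed.

Lemma measurable_sketch_gram n : measurable_mx (B n).
Proof.
have mS : measurable_mx (S (m n) n) by move=> i j; exact: meas_S.
apply: measurable_mulmx (measurable_cst_mx _).
by apply: measurable_mulmx mS; apply: measurable_mulmx (measurable_cst_mx _) _; exact: measurable_trmx.
Qed.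

Lemma sketch_gram_symm n w : (B n w)^T = B n w.
Proof. exact: sketch_gram_sym. Qed.

Let near_A : \forall n \near \oo, perturbed ell V (fun=> 0) A
  (fun n => V n *m diag_mx (ell n) *m (1%:M + 0) *m diag_mx (ell n) *m (V n)^T) n.
Proof.
by apply: filterS near_spectral_A => n [VV AE]; split=> //; rewrite trmx0.
Qed.

(** [eigvec] and the columns of [V] follow the same sign convention. *)
Lemma column_sign1 : (forall n k, (q.+1 <= n)%N -> first_nz_pos (col k (V n))) ->
  \forall n \near \oo, forall k, column_sign V A k n = 1.
Proof.
move=> posV; have [M [eta [eta0 sep]]] := svd_well_separated.
apply: filterS3 (nbhs_infty_ge q.+1) near_A sep => n qn pn sn k.
have [vE /eqP] := eigvec_A eta0 k pn sn; rewrite sqrf_eq1 => /orP[/eqP //|/eqP s1].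
have [_ _] := eigvecP k (psd_gram (X n)).1; rewrite -/(A n) vE s1 => pos.
by have := first_nz_pos_uniq (b := true) (posV n k qn) pos.
Qed.

(** Distinct directions are uncorrelated, so the signs of the columns of [V] only
    enter through their squares. *)
Lemma wick_column_sign alpha (i : 'I_q.+1) :
  \forall n \near \oo, forall k l, k != i -> l != i ->
    column_sign V A k n * column_sign V A l n * wick_cov q alpha (vidx i k) (vidx i l) =
    wick_cov q alpha (vidx i k) (vidx i l).
Proof.
have [M [eta [eta0 sep]]] := svd_well_separated.
apply: filterS2 near_A sep => n pn sn k l ki _; rewrite wick_cov_off //.
have [<-|_] := eqVneq k l; last by rewrite mulr0.
by rewrite mulr1 -expr2 (eigvec_A eta0 k pn sn).2.
Qed.

Lemma near_eigval_inj_A : \forall n \near \oo, injective (eigval (A n)).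
Proof.
have [M [eta [eta0 sep]]] := svd_well_separated.
by apply: filterS2 near_A sep => n; exact: eigval_A_inj.
Qed.

(** Relative gaps being bounded, the variance is small only if [c] is nearly
    aligned with the [i]-th eigenvector. *)
Lemma wick_Delta_lower alpha (i : 'I_q.+1) c : dotv c c = 1 ->
  (limn_esup (fun n => (dotv c (eigvec (A n) i) ^+ 2)%:E) < 1%:E)%E ->
  exists2 c0 : R, 0 < c0 & \forall n \near \oo,
    c0 <= qform (Delta_of (eigval (A n)) (eigvec (A n)) (wick_cov q alpha) i) c.
Proof.
move=> c1 /lte_between_fin[b b1 /limn_esup_near aligned].
have [M [eta [eta0 sep]]] := svd_well_separated.
have M0 : 0 < M ^+ 2 + 1 by rewrite ltr_wpDl ?sqr_ge0.
exists ((1 - b) / (M ^+ 2 + 1)); first by rewrite divr_gt0 ?subr_gt0.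
apply: filterS3 near_A sep aligned => n pn sn; rewrite lte_fin => al.
have parseval : \sum_k dotv c (eigvec (A n) k) ^+ 2 = 1.
  have [VV _ _ _] := pn; rewrite -c1 -(dotv_orthogonal c c VV) dotvE.
  apply: eq_bigr => k _; rewrite (dotv_eigvec_A eta0 c k pn sn) exprMn.
  by rewrite (eigvec_A eta0 k pn sn).2 mul1r expr2.
rewrite qform_Delta1 => [|k]; last by rewrite (eigval_A eta0 k pn sn) sqr_ge0.
apply: (@le_trans _ _ ((M ^+ 2 + 1)^-1 * \sum_(k | k != i) dotv c (eigvec (A n) k) ^+ 2)).
  rewrite mulrC ler_pM2l ?invr_gt0 // -parseval (bigD1 i) //=.
  by rewrite addrAC gerDr subr_le0 ltW.
rewrite mulr_sumr; apply: ler_sum => k ki; rewrite ler_wpM2r ?sqr_ge0 //.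
rewrite !(eigval_A eta0 _ pn sn); have [l0 lM _] := sn.
have neq : ell n 0 i ^+ 2 - ell n 0 k ^+ 2 != 0.
  rewrite subr_eq0 -!(eigval_A eta0 _ pn sn).
  by apply: contraNneq ki => /(eigval_A_inj eta0 pn sn) ->.
rewrite ler_pdivlMr ?exprn_even_gt0 // ler_pdivrMl //.
have := l0 i; have := l0 k; have := lM i k; have := lM k i.
move: (ell n 0 i) (ell n 0 k) => x y yx xy y0 x0.
have bound (s t : R) : 0 < t -> t <= s -> s <= M * t ->
    (s ^+ 2 - t ^+ 2) ^+ 2 <= (M ^+ 2 + 1) * (s ^+ 2 * t ^+ 2).
  move=> t0 ts sM; have s0 := lt_le_trans t0 ts.
  apply: (@le_trans _ _ (s ^+ 2 * s ^+ 2)).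
    rewrite expr2; apply: ler_pM; rewrite ?subr_ge0 ?ler_sqr ?nnegrE ?(ltW s0) ?(ltW t0) //;
    by rewrite gerBl sqr_ge0.
  apply: (@le_trans _ _ (s ^+ 2 * (M * t) ^+ 2)).
    by rewrite ler_wpM2l ?sqr_ge0 // ler_sqr ?nnegrE ?(ltW s0) ?(le_trans (ltW s0) sM).
  by rewrite exprMn mulrCA ler_wpM2r ?lerDl ?ler01 // mulr_ge0 ?sqr_ge0.
have [yx'|xy'] := leP y x; first exact: bound.
by rewrite -sqrrN opprB [_ ^+ 2 * _ ^+ 2]mulrC; apply: bound => //; exact: ltW.
Qed.

Context (G : nat -> 'M[R]_(q.+1 * q.+1)) (i : 'I_q.+1).
Hypothesis rowN : row_normal Pm W r G i.

Theorem sketched_eigval_normal (c0 : R) (s : nat -> R) : 0 < c0 ->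
  (\forall n \near \oo, c0 <= G n (vidx i i) (vidx i i)) ->
  (\forall n \near \oo, s n = tau (m n) n * G n (vidx i i) (vidx i i)) ->
  cvg_to_N01 Pm (fun n w => Num.sqrt ((m n)%:R / s n)
    * ((eigval (B n w) i)^-1 * (eigval (B n w) i - eigval (A n) i))).
Proof.
move=> c00 Gc sE; have [M [eta [eta0 sep]]] := svd_well_separated.
apply: (eigval_normal eta0 near_spectral_A near_perturbed_B sep near_r_gt0 r_inv_asym0
  rowN c00 Gc) => [n|].
  have mB := measurable_eigval i (@measurable_sketch_gram n) (@sketch_gram_symm n).
  apply: measurable_funM; first exact: measurable_cst.
  exact: measurable_funM (measurable_inv mB) (measurable_funB mB (measurable_cst _)).
apply: filterS3 sE near_rate_gt0 Gc => n sE r0 Gc w; congr (_ * _).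
have G0 := lt_le_trans c00 Gc.
by rewrite sE invfM mulrA sqrtrM ?(ltW r0) // sqrtrV // ltW.
Qed.

Context (c : 'cV[R]_q.+1) (c0 : R).
Hypotheses (c1 : dotv c c = 1) (c00 : 0 < c0)
  (Qc : \forall n \near \oo,
     c0 <= qform (Delta_of (eigval (A n)) (eigvec (A n)) (G n) i) c)
  (Gb : exists C : R, \forall n \near \oo, forall k l, `|G n (vidx i k) (vidx i l)| <= C)
  (Gsign : \forall n \near \oo, forall k l, k != i -> l != i ->
     column_sign V A k n * column_sign V A l n * G n (vidx i k) (vidx i l) =
     G n (vidx i k) (vidx i l)).

(** The estimates [v] and [u] of the eigenvectors only have to agree with those of
    matched signs when the error is bounded and [n] is large. *)
Theorem sketched_eigvec_normal (Y : forall n, T (m n) n -> R)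
    (v : forall n, T (m n) n -> 'I_q.+1 -> 'cV[R]_q.+1)
    (u : forall n, T (m n) n -> 'cV[R]_q.+1) :
  (forall n w, Y n w =
     r n * inv_sqrte (Delta_q (eigval (B n w)) (v n w) (G n) i c) *
     dotv c (u n w - eigvec (A n) i)) ->
  (forall n k, measurable_simple (B n) (fun w => v n w k)) ->
  (forall n, measurable_simple (B n) (u n)) ->
  (forall K, \forall w \near localized z K,
     Delta_q (eigval (B (projT1 w) (projT2 w))) (v (projT1 w) (projT2 w)) (G (projT1 w)) i c =
     Delta_q (eigval (B (projT1 w) (projT2 w)))
       (eigvec_toward (A (projT1 w)) (B (projT1 w) (projT2 w))) (G (projT1 w)) i c /\
     u (projT1 w) (projT2 w) = eigvec_toward (A (projT1 w)) (B (projT1 w) (projT2 w)) i) ->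
  cvg_to_N01 Pm Y.
Proof.
move=> YE mv mu vu; have [M [eta [eta0 sep]]] := svd_well_separated.
apply: (eigvec_normal eta0 near_spectral_A near_perturbed_B sep near_r_gt0 r_inv_asym0
  rowN c1 c00 Qc Gb Gsign) => [n|K].
  rewrite (_ : Y n = fun w => r n *
     inv_sqrte (Delta_q (eigval (B n w)) (v n w) (G n) i c) *
     dotv c (u n w - eigvec (A n) i)); last by apply/funext => w.
  apply: (measurable_student (@measurable_sketch_gram n)) => //.
  by move=> w; exact: psd_sketch_gram.
by apply: filterS (vu K) => w [DE uE]; rewrite YE DE uE.
Qed.

Lemma sign_stable_toward k K : r n * eigvec (A n) k ord0 0 @[n --> \oo] --> +oo ->
  \forall w \near localized z K,
    eigvec_toward (A (projT1 w)) (B (projT1 w) (projT2 w)) k =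
    eigvec (B (projT1 w) (projT2 w)) k.
Proof.
have [M [eta [eta0 sep]]] := svd_well_separated.
exact: (eigvec_toward_eventually eta0 near_spectral_A near_perturbed_B sep near_r_gt0
  r_inv_asym0 K sketch_gram_symm).
Qed.

End SketchedSpectrum.

(** * Asymptotic normality of the sketched spectrum *)

Unset Implicit Arguments.

(* The dimension p >= 1 is written q.+1. *)
Theorem mainTheorem3 (R : realType) (q : nat) (d : measure_display)
  (T : nat -> nat -> measurableType d) (P : forall m n, probability (T m n) R)
  (S : forall m n, T m n -> 'M[R]_(m, n))
  (m : nat -> nat) (tau : nat -> nat -> R)
  (Pf : frames R q.+1 -> Prop)
  (X U : frames R q.+1) (ell : nat -> 'rV[R]_q.+1) (V : nat -> 'M[R]_q.+1)
  (meas_S : forall k n i j, measurable_fun [set: T k n] (fun w => S k n w i j))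
  (m_oo : m @ \oo --> \oo)
  (m_lt : \forall n \near \oo, (m n < n)%N)
  (tau_gt0 : forall k n, (0 < k)%N -> (0 < n)%N -> 0 < tau k n)
  (tau_m : tau (m n) n / (m n)%:R @[n --> \oo] --> (0 : R))
  (svd_X : forall n, (q.+1 <= n)%N -> is_svd (X n) (U n) (ell n) (V n))
  (cond_X : (limn_esup (fun n => (ell n 0 ord0 / ell n 0 ord_max)%:E) < +oo)%E)
  (gap_X : (1%:E < limn_einf (fun n => \big[Order.min/+oo]_(i < q)
      (ell n 0 (widen_ord (leqnSn q) i) / ell n 0 (lift ord0 i))%:E))%E)
  (PfU : Pf U) :
  let A n := gram (X n) in
  let B n w := sketch_gram (S (m n) n w) (X n) in
  let Pm n := P (m n) n in
  let rate n : R := (m n)%:R / tau (m n) n in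
  (* the convention on the sign of v_k(X_n^T X_n) is asymptotically stable *)
  let sign_stable k := Num.sqrt (rate n) * eigvec (A n) k ord0 0 @[n --> \oo] --> +oo in
  (forall G : frames R q.+1 -> nat -> 'M[R]_(q.+1 * q.+1),
    cond_Sym P S m tau Pf G ->
    forall i : 'I_q.+1,
    cvg_to_N01 Pm (fun n w =>
      Num.sqrt ((m n)%:R / (tau (m n) n * G U n (vidx i i) (vidx i i)))
        * ((eigval (B n w) i)^-1 * (eigval (B n w) i - eigval (A n) i)))
    /\
    ((forall n k, (q.+1 <= n)%N -> first_nz_pos (col k (V n))) ->
     forall c : 'cV[R]_q.+1, dotv c c = 1 ->
     (0 < limn_einf (fun n =>
        Delta_q (eigval (A n)) (eigvec (A n)) (G U n) i c))%E ->
     cvg_to_N01 Pm (fun n w =>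
       Num.sqrt (rate n)
       * inv_sqrte (Delta_q (eigval (B n w)) (eigvec_toward (A n) (B n w)) (G U n) i c)
       * dotv c (eigvec_toward (A n) (B n w) i - eigvec (A n) i))
     /\
     ((forall k, sign_stable k) ->
      cvg_to_N01 Pm (fun n w =>
        Num.sqrt (rate n)
        * inv_sqrte (Delta_q (eigval (B n w)) (eigvec (B n w)) (G U n) i c)
        * dotv c (eigvec (B n w) i - eigvec (A n) i)))))
  /\
  (forall alpha : nat, (alpha <= 1)%N ->
    cond_Sym1 P S m tau alpha Pf ->
    forall i : 'I_q.+1,
    cvg_to_N01 Pm (fun n w =>
      Num.sqrt ((m n)%:R / ((2 + alpha)%:R * tau (m n) n))
        * ((eigval (B n w) i)^-1 * (eigval (B n w) i - eigval (A n) i)))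
    /\
    (forall c : 'cV[R]_q.+1, dotv c c = 1 ->
     (limn_esup (fun n => (dotv c (eigvec (A n) i) ^+ 2)%:E) < 1%:E)%E ->
     cvg_to_N01 Pm (fun n w =>
       Num.sqrt (rate n)
       * inv_sqrte (Delta1_q (eigval (B n w)) (eigvec (B n w)) i c)
       * dotv c (eigvec_toward (A n) (B n w) i - eigvec (A n) i))
     /\
     (sign_stable i ->
      cvg_to_N01 Pm (fun n w =>
        Num.sqrt (rate n)
        * inv_sqrte (Delta1_q (eigval (B n w)) (eigvec (B n w)) i c)
        * dotv c (eigvec (B n w) i - eigvec (A n) i))))).
Proof.
move=> A B Pm rate sign_stable.
have orthU := orthonormal_svd svd_X.
have tau0 := near_tau_gt0 m_oo tau_gt0.
have simple_eigvec n k : measurable_simple (B n) (fun w => eigvec (B n w) k).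
  apply: measurable_simple_eigvec => [|w]; first exact: measurable_sketch_gram.
  exact: psd_sketch_gram.
have simple_toward n k : measurable_simple (B n) (fun w => eigvec_toward (A n) (B n w) k).
  apply: measurable_simple_toward => [|w]; first exact: measurable_sketch_gram.
  exact: psd_sketch_gram.
pose W n w : 'M[R]_q.+1 := sketch_gram (S (m n) n w) (U n) - 1%:M.
have stable k K := @sign_stable_toward _ _ _ _ S _ _ _ _ _ _ m_oo tau_gt0 tau_m svd_X
  cond_X gap_X k K.
split=> [G symG i|alpha alpha1 symG i].
  have [absG [c0 [C0 [c00 cC Gbounds]]] YN] := symG U orthU PfU.
  have near_absG : \forall n \near \oo, abs_sym (G U n).
    by apply: filterS (nbhs_infty_gt 0) => n; exact: absG.
  have halfG : \forall n \near \oo, forall a, c0 <= half_mx (G U n) a a <= C0.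
    apply: filterS (nbhs_infty_gt 0) => n /Gbounds[lo hi] a.
    have := loewner_diag a lo; have := loewner_diag a hi.
    by rewrite !mxE eqxx !mulr1n => -> ->.
  have rowN : row_normal Pm W (fun n => Num.sqrt (rate n)) (G U) i.
    apply: (row_normal_Sym tau0 (C := C0)) YN => //.
    by apply: filterS halfG => n h a; case/andP: (h a).
  split.
    apply: (sketched_eigval_normal meas_S m_oo tau_gt0 tau_m svd_X cond_X gap_X rowN c00).
      apply: filterS2 halfG near_absG => n h aG; rewrite -(half_mx_upper _ _ _ _ aG).
      by case/andP: (h (upper_idx i i)).
    exact: filterE.
  move=> posV c c1 /lte_fin_between[e0 e00 /limn_einf_near Qe].
  (* Simplicity of the spectrum makes the infinite branch of Delta_q void. *)
  have Qc : \forall n \near \oo,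
      e0 <= qform (Delta_of (eigval (A n)) (eigvec (A n)) (G U n) i) c.
    apply: filterS2 Qe (near_eigval_inj_A svd_X cond_X gap_X) => n + injA.
    by rewrite /Delta_q (introT (injectiveP _) injA) lte_fin => /ltW.
  have Gb : exists C : R, \forall n \near \oo, forall k l, `|G U n (vidx i k) (vidx i l)| <= C.
    exists C0; apply: filterS2 halfG near_absG => n h aG k l.
    rewrite -(half_mx_upper _ _ _ _ aG); apply: psd_entry_bound => [|a].
      by case: aG => _ _ /posdef_psd.
    by case/andP: (h a).
  have Gsign : \forall n \near \oo, forall k l, k != i -> l != i ->
      column_sign V A k n * column_sign V A l n * G U n (vidx i k) (vidx i l) =
      G U n (vidx i k) (vidx i l).
    by apply: filterS (column_sign1 svd_X cond_X gap_X posV) => n s1 k l _ _; rewrite !s1 !mul1r.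
  split=> [|sgn].
    apply: (sketched_eigvec_normal meas_S m_oo tau_gt0 tau_m svd_X cond_X gap_X rowN c1 e00
      Qc Gb Gsign (v := fun n w => eigvec_toward (A n) (B n w))
      (u := fun n w => eigvec_toward (A n) (B n w) i)) => // K.
    exact: filterE.
  apply: (sketched_eigvec_normal meas_S m_oo tau_gt0 tau_m svd_X cond_X gap_X rowN c1 e00
    Qc Gb Gsign (v := fun n w => eigvec (B n w)) (u := fun n w => eigvec (B n w) i)) => // K.
  have : \forall w \near localized (fun n (w : T (m n) n) => Num.sqrt (rate n) *: W n w) K,
      forall k, eigvec_toward (A (projT1 w)) (B (projT1 w) (projT2 w)) k =
        eigvec (B (projT1 w) (projT2 w)) k.
    by apply: filter_forall => k; exact: stable (sgn k).
  by apply: filterS => w /funext E; rewrite -E.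
have rowN : row_normal Pm W (fun n => Num.sqrt (rate n)) (fun=> wick_cov q alpha) i.
  apply: row_normal_Sym1 => //; exact: symG.
split.
  apply: (sketched_eigval_normal meas_S m_oo tau_gt0 tau_m svd_X cond_X gap_X rowN ltr01).
    by apply: filterE => n; rewrite wick_cov_diag ler1n.
  by apply: filterE => n; rewrite wick_cov_diag mulrC.
move=> c c1 aligned.
have [e0 e00 Qc] := wick_Delta_lower svd_X cond_X gap_X alpha c1 aligned.
have Gb : exists C : R, \forall n \near \oo, forall k l,
    `|wick_cov (R := R) q alpha (vidx i k) (vidx i l)| <= C.
  exists (1 + (1 + alpha%:R)); apply: filterE => n k l; rewrite wick_covE.
  rewrite ger0_norm ?addr_ge0 ?mulr_ge0 ?ler0n // lerD ?lern1 ?leq_b1 //.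
  by rewrite ler_piMl ?addr_ge0 ?lern1 ?leq_b1.
have Gsign := wick_column_sign svd_X cond_X gap_X alpha i.
have eigval_B0 n w k : 0 <= eigval (B n w) k by exact/eigval_psd_ge0/psd_sketch_gram.
have D1 n w : Delta1_q (eigval (B n w)) (eigvec (B n w)) i c =
    Delta_q (eigval (B n w)) (eigvec_toward (A n) (B n w)) (wick_cov q alpha) i c.
  by rewrite -(Delta1_q_toward (A n)) (Delta1_qE alpha).
split=> [|sgn].
  apply: (sketched_eigvec_normal meas_S m_oo tau_gt0 tau_m svd_X cond_X gap_X rowN c1 e00
    Qc Gb Gsign (v := fun n w => eigvec_toward (A n) (B n w))
    (u := fun n w => eigvec_toward (A n) (B n w) i)) => // [n w|K]; last exact: filterE.
  by rewrite -D1.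
apply: (sketched_eigvec_normal meas_S m_oo tau_gt0 tau_m svd_X cond_X gap_X rowN c1 e00
  Qc Gb Gsign (v := fun n w => eigvec_toward (A n) (B n w))
  (u := fun n w => eigvec (B n w) i)) => // [n w|K]; first by rewrite -D1.
by apply: filterS (stable i K sgn) => w ->.
Qed.
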